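(* Let $\{p_k/q_k\}\subset(0,1)$ be an irrationally tuned sequence of even rational parameters converging to an irrational number, let $\omega_k=p_k+q_k$, and for each $k$ let $B_k$ be a block associated to $p_k/q_k$. Let $N$ be any fixed positive integer. Then there is some $\delta>0$ such that for all sufficiently large $k$: at least $N$ distinct plaid polygons (for $p_k/q_k$) contained in $B_k$ have $x$-diameter at least $\delta\omega_k$, and every point of $B_k$ is within distance $\omega_k/N$ of a plaid polygon of $x$-diameter at least $\delta\omega_k$.
   Context: An even rational parameter is a rational $p/q\in(0,1)$, $p,q$ positive coprime integers, $pq$ even. Put $\omega=p+q$, $P=2p/\omega$, $Q=2q/\omega$. Tune: let $\alpha$ be the unique integer in $(0,\omega/2)$ with $2\alpha p\equiv\pm1\pmod\omega$, and $\tau(p/q)=\alpha/\omega$. A sequence of parameters is irrationally tuned if $\tau(p_k/q_k)$ converges to an irrational number. Line families: $\mathcal H$ = lines $y=n$, $\mathcal V$ = lines $x=n$ ($n\in\mathbb Z$), $\mathcal P$ = lines of slope $-P$ with integer $y$-intercept, $\mathcal Q$ = lines of slope $-Q$ with integer $y$-intercept. Functions mod $2\mathbb Z$, values represented in $(-1,1]$: $F_H=2Py$, $F_V=2Px$, $F_P=Py+P^2x+1$, $F_Q=Py+PQx+1$. A unit segment is an edge of a unit square of the integer grid; horizontal ones lie on $\mathcal H$-lines (set $A=H$), vertical ones on $\mathcal V$-lines ($A=V$). A point $z$ of a unit segment $s$ is a light point of $s$ if for some $B\in\{P,Q\}$, $z$ lies on a line of $\mathcal B$, $F_A(z)F_B(z)>0$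 and $|F_B(z)|<|F_A(z)|$. The light count of $s$ is the number of distinct light points of $s$, a light point that is the midpoint of a horizontal $s$ counted twice; $s$ is good if its light count is $1$. In each unit square draw the segments joining its center to the midpoints of its good edges; plaid polygons are the connected components of the union of all these segments. A block is a square $[0,\omega]^2+\ell$ with $\ell$ in the lattice generated by $(\omega^2,0)$ and $(0,\omega)$. The $x$-diameter of a planar set is the diameter of its projection to the $x$-axis. *)

(* Defs.v *)
From Stdlib Require Import Reals Lra ZArith List.
From mathcomp Require Import classical_sets topology Rstruct Rstruct_topology.
Open Scope R_scope.

Definition even_param (p q : nat) : Prop :=
  (0 < p)%nat /\ (p < q)%nat /\ Nat.gcd p q = 1%nat /\ Nat.Even (p * q)%nat.

Definition omega (p q : nat) : R := INR (p + q).
Definition Pc (p q : nat) : R := 2 * INR p / omega p q.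
Definition Qc (p q : nat) : R := 2 * INR q / omega p q.

(* alpha is THE integer in (0, omega/2) with 2 alpha p = +-1 mod omega
   (it is unique for an even rational parameter); tau = alpha / omega. *)
Definition is_tune_alpha (p q alpha : nat) : Prop :=
  (0 < alpha)%nat /\ (2 * alpha < p + q)%nat /\
  ((2 * alpha * p) mod (p + q) = 1 mod (p + q) \/
   (2 * alpha * p + 1) mod (p + q) = 0)%nat.

Definition irrational (x : R) : Prop :=
  forall m n : Z, n <> 0%Z -> x <> IZR m / IZR n.

Definition irrationally_tuned (p q : nat -> nat) : Prop :=
  exists alpha : nat -> nat,
    (forall k, is_tune_alpha (p k) (q k) (alpha k)) /\
    exists L, irrational L /\
      Un_cv (fun k => INR (alpha k) / omega (p k) (q k)) L.

(* red2 x is the representative in (-1,1] of x mod 2Z: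
   red2 x = x - 2 * ceil((x-1)/2), with ceil y = 1 - up(-y)... written via
   up (Stdlib: up y is the least integer > y), ceil((x-1)/2) = 1 - up((1-x)/2). *)
Definition red2 (x : R) : R := x - 2 * IZR (1 - up ((1 - x) / 2))%Z.

Definition pt2 := (R * R)%type.

Definition F_H (p q : nat) (z : pt2) : R := red2 (2 * Pc p q * snd z).
Definition F_V (p q : nat) (z : pt2) : R := red2 (2 * Pc p q * fst z).
Definition F_P (p q : nat) (z : pt2) : R :=
  red2 (Pc p q * snd z + Pc p q ^ 2 * fst z + 1).
Definition F_Q (p q : nat) (z : pt2) : R :=
  red2 (Pc p q * snd z + Pc p q * Qc p q * fst z + 1).

Definition on_P_line (p q : nat) (z : pt2) : Prop :=
  exists b : Z, snd z = - Pc p q * fst z + IZR b.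
Definition on_Q_line (p q : nat) (z : pt2) : Prop :=
  exists b : Z, snd z = - Qc p q * fst z + IZR b.

(* Hseg m n : from (m,n) to (m+1,n);  Vseg m n : from (m,n) to (m,n+1) *)
Inductive useg := Hseg (m n : Z) | Vseg (m n : Z).

Definition on_useg (s : useg) (z : pt2) : Prop :=
  match s with
  | Hseg m n => snd z = IZR n /\ IZR m <= fst z <= IZR m + 1
  | Vseg m n => fst z = IZR m /\ IZR n <= snd z <= IZR n + 1
  end.

Definition midpoint (s : useg) : pt2 :=
  match s with
  | Hseg m n => (IZR m + /2, IZR n)
  | Vseg m n => (IZR m, IZR n + /2)
  end.

Definition F_A (p q : nat) (s : useg) (z : pt2) : R :=
  match s with Hseg _ _ => F_H p q z | Vseg _ _ => F_V p q z end.

Definition light_point (p q : nat) (s : useg) (z : pt2) : Prop :=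
  on_useg s z /\
  ((on_P_line p q z /\ F_A p q s z * F_P p q z > 0 /\
      Rabs (F_P p q z) < Rabs (F_A p q s z)) \/
   (on_Q_line p q z /\ F_A p q s z * F_Q p q z > 0 /\
      Rabs (F_Q p q z) < Rabs (F_A p q s z))).

Definition is_horizontal (s : useg) : Prop :=
  match s with Hseg _ _ => True | Vseg _ _ => False end.

Definition light_count (p q : nat) (s : useg) (c : nat) : Prop :=
  exists l : list pt2,
    NoDup l /\ (forall z, In z l <-> light_point p q s z) /\
    ((is_horizontal s /\ light_point p q s (midpoint s)) ->
        c = S (length l)) /\
    (~ (is_horizontal s /\ light_point p q s (midpoint s)) ->
        c = length l).

Definition good (p q : nat) (s : useg) : Prop := light_count p q s 1.

Definition center (m n : Z) : pt2 := (IZR m + /2, IZR n + /2).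

Definition edges (m n : Z) : list useg :=
  Hseg m n :: Hseg m (n + 1) :: Vseg m n :: Vseg (m + 1) n :: nil.

Definition in_closed_segment (a b z : pt2) : Prop :=
  exists t, 0 <= t <= 1 /\
    fst z = fst a + t * (fst b - fst a) /\ snd z = snd a + t * (snd b - snd a).

Definition plaid_union (p q : nat) : set pt2 :=
  fun z => exists (m n : Z) (s : useg),
    In s (edges m n) /\ good p q s /\
    in_closed_segment (center m n) (midpoint s) z.

Definition plaid_polygon (p q : nat) (C : set pt2) : Prop :=
  exists z, plaid_union p q z /\ C = connected_component (plaid_union p q) z.

Definition in_block (p q : nat) (a b : Z) (z : pt2) : Prop :=
  IZR a * omega p q ^ 2 <= fst z <= IZR a * omega p q ^ 2 + omega p q /\
  IZR b * omega p q <= snd z <= IZR b * omega p q + omega p q.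

Definition xdiam_ge (S : set pt2) (d : R) : Prop :=
  forall e, 0 < e -> exists u v, S u /\ S v /\ Rabs (fst u - fst v) > d - e.

Definition dist (u v : pt2) : R :=
  sqrt ((fst u - fst v) ^ 2 + (snd u - snd v) ^ 2).

Definition dist_le (z : pt2) (S : set pt2) (r : R) : Prop :=
  forall e, 0 < e -> exists w, S w /\ dist z w < r + e.

(* Main.v *)
Require Import Defs.
From Stdlib Require Import Reals ZArith List.
From mathcomp Require Import classical_sets topology Rstruct Rstruct_topology.
From mathcomp Require ssreflect ssrfun ssrbool order ssralg ssrnum interval boolp.
From mathcomp Require num_normedtype normed_module.
From Stdlib Require Import List Lra Lia Znumtheory Bool Permutation Sorting Relations.
From Stdlib Require Import Classical ClassicalDescription.
Open Scope R_scope.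

(** In units of 1/omega every mass is an integer mod 2 omega, and the light
    masses on a line form an arc of that circle.  Writing arc membership through
    integer parts, the four edges of a unit square telescope, so every square has
    an even number of good edges; hence a component crosses a closed curve of grid
    lines an even number of times.

    The line at height or abscissa c alpha mod omega has capacity 2|c|: it carries
    at most 2|c| good segments per block.  The lines with |c| <= K cut a block into
    (2K+1)^2 rooms using fewer than that many good segments in total, so some room
    has no good segment on its boundary and keeps its polygons to itself.

    On a line c alpha with c large, every window contains a crossing with a Q-line
    that stays at distance of order omega from all other light points of the line.
    The polygon through it must cross the line again, so it is long; this gives
    density.  Applied inside empty rooms of smaller and smaller width, it
    produces arbitrarily many different long polygons. *)

(** * Masses and parity *)

Section Masses.
Local Open Scope Z_scope.

(** The width has to be a fixed fraction of omega while k varies. A light line on the line c alpha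
    meets it according to an integer d alpha - i omega with |d| < |c|. After division by omega and
    for fixed c this is a finite pattern, which converges together with alpha/omega and p/omega. So
    c and every other constant are chosen from the two limits alone; a nonzero difference of limits
    becomes a gap of order omega, and finitely many differences give one common delta. The obstacle
    is coincidence in the limit: the limits of alpha/omega and p/omega may be related, so a
    Q-crossing and a P-crossing can merge at scale omega. Such coincidences are not excluded one by
    one but counted: as Q > P in the limit, a window holds more Q-crossings than P-crossings, and
    some Q-crossing stays unmatched. Two different Q-crossings never merge, because the limit of
    alpha/omega is irrational. *)

Definition cmod (W k : Z) : Z := W - (W - k) mod (2 * W).

Definition light (W g h : Z) : bool :=
  (0 <? cmod W g * cmod W h) && (Z.abs (cmod W g) <? Z.abs (cmod W h)).

Lemma cmod_spec (W k : Z) : 0 < W ->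
  - W < cmod W k <= W /\ exists j, k = cmod W k + 2 * W * j.
Proof.
  intros HW. unfold cmod.
  pose proof (Z.mod_pos_bound (W - k) (2 * W) ltac:(lia)).
  pose proof (Z.div_mod (W - k) (2 * W) ltac:(lia)) as E.
  split; [lia|]. exists (- ((W - k) / (2 * W))). lia.
Qed.

Lemma cmod_unique (W k r j : Z) : 0 < W ->
  - W < r <= W -> k = r + 2 * W * j -> cmod W k = r.
Proof.
  intros HW Hr E. destruct (cmod_spec W k HW) as [B [i Ei]].
  assert (j = i) by nia. subst j. lia.
Qed.

Lemma light_true (W g h : Z) : light W g h = true <->
  0 < cmod W g < cmod W h \/ cmod W h < cmod W g < 0.
Proof.
  unfold light. rewrite andb_true_iff, Z.ltb_lt, Z.ltb_lt. nia.
Qed.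

Lemma light_shift (W g h i j : Z) : 0 < W ->
  light W (g + 2 * W * i) (h + 2 * W * j) = light W g h.
Proof.
  intros HW. unfold light.
  destruct (cmod_spec W g HW) as [Bg [a Ea]].
  destruct (cmod_spec W h HW) as [Bh [b Eb]].
  rewrite (cmod_unique W (g + 2 * W * i) (cmod W g) (a + i)); try lia.
  rewrite (cmod_unique W (h + 2 * W * j) (cmod W h) (b + j)); try lia.
Qed.

(* Light masses are those lying on the short arc from 0 to [h] of the circle
   Z/2W, and that arc is invariant under [g |-> h - g]. *)
Lemma light_sym (W g g' h k : Z) : 0 < W ->
  g + g' = h + 2 * W * k -> light W g h = light W g' h.
Proof.
  intros HW.
  assert (S : forall g g' k, g + g' = h + 2 * W * k ->
            light W g h = true -> light W g' h = true).
  { intros x x' l E. rewrite !light_true. intros Hx.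
    destruct (cmod_spec W x HW) as [Bg [a Ea]].
    destruct (cmod_spec W h HW) as [Bh [b Eb]].
    rewrite (cmod_unique W x' (cmod W h - cmod W x) (b + l - a)); try lia. }
  intros E. destruct (light W g h) eqn:A, (light W g' h) eqn:B; auto.
  - rewrite (S g g' k E A) in B. discriminate.
  - rewrite (S g' g k ltac:(lia) B) in A. discriminate.
Qed.

Lemma div_add_turn (W x k : Z) : 0 < W -> (x + 2 * W * k) / (2 * W) = x / (2 * W) + k.
Proof.
  intros. replace (x + 2 * W * k) with (x + k * (2 * W)) by ring.
  apply Z.div_add. lia.
Qed.

Lemma div_opp_odd (W x : Z) : 0 < W -> Z.Odd x -> (- x) / (2 * W) = - (x / (2 * W)) - 1.
Proof.
  intros HW [y Hy].
  symmetry. apply Z.div_unique with (2 * W - x mod (2 * W)).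
  - left. pose proof (Z.mod_pos_bound x (2 * W) ltac:(lia)).
    pose proof (Z.div_mod x (2 * W) ltac:(lia)). nia.
  - pose proof (Z.div_mod x (2 * W) ltac:(lia)). nia.
Qed.

(** With representatives r of g and t of h, up to even terms the first quotient records whether r >
    0 and the second whether r >= t. Exactly one of the two holds precisely when r lies strictly
    between 0 and t. The parities keep r away from 0 and from t. *)
Lemma light_turns (W g h k : Z) : 0 < W -> Z.Odd g -> Z.Even h ->
  h = cmod W h + 2 * W * k ->
  light W g h = Z.odd ((- g) / (2 * W) + (h - g) / (2 * W) + k).
Proof.
  intros HW Og Eh Hk.
  destruct (cmod_spec W g HW) as [Bg [a Ea]].
  destruct (cmod_spec W h HW) as [Bh [b Eb]].
  assert (b = k) by nia. subst b.
  set (r := cmod W g) in *. set (t := cmod W h) in *.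
  assert (Or : r <> 0) by (intros R0; destruct Og; nia).
  assert (Nrt : t <> r) by (intros R0; destruct Og, Eh; nia).
  replace (- g) with (- r + 2 * W * (- a)) by lia.
  replace (h - g) with (t - r + 2 * W * (k - a)) by lia.
  rewrite !div_add_turn by lia.
  replace ((- r) / (2 * W)) with (if 0 <? r then -1 else 0).
  2:{ destruct (Z.ltb_spec 0 r).
      - apply Z.div_unique with (2 * W - r); lia.
      - apply Z.div_unique with (- r); lia. }
  replace ((t - r) / (2 * W)) with (if r <? t then 0 else -1).
  2:{ destruct (Z.ltb_spec r t).
      - apply Z.div_unique with (t - r); lia.
      - apply Z.div_unique with (t - r + 2 * W); lia. }
  replace (_ + - a + _ + k) with
    ((if 0 <? r then -1 else 0) + (if r <? t then 0 else -1) + 2 * (k - a)) by lia.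
  rewrite Z.odd_add_mul_2.
  apply eq_true_iff_eq. rewrite light_true. fold r t.
  destruct (Z.ltb_spec 0 r), (Z.ltb_spec r t); cbn; intuition (try lia; try discriminate).
Qed.

(* The number of turns separating [h] from its representative cancels when two
   masses are compared with the same [h]. *)
Lemma light_pair_turns (W g g' h : Z) : 0 < W -> Z.Odd g -> Z.Odd g' -> Z.Even h ->
  xorb (light W g h) (light W g' h) =
  Z.odd ((- g) / (2 * W) + (- g') / (2 * W) + (h - g) / (2 * W) + (h - g') / (2 * W)).
Proof.
  intros HW Og Og' Eh. destruct (cmod_spec W h HW) as [_ [k Ek]].
  rewrite (light_turns W g h k), (light_turns W g' h k) by assumption.
  rewrite <- Z.odd_add.
  match goal with |- Z.odd ?a = Z.odd ?b => replace a with (b + 2 * k) by ring end.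
  apply Z.odd_add_mul_2.
Qed.

Variables p q : Z.

(** This is W (P b + 1): F_P is constant and equal to P b + 1 on the P-line of intercept b, and F_Q
    takes the same value on the Q-line of intercept b. *)
Definition mass (p q b : Z) : Z := 2 * p * b + (p + q).

(* [slack] and [ceilP] are [W (ceil(Pm) - Pm)] and [ceil(Pm)]: the [P]-line
   meeting the vertical edge at [(m,n)] is the one of intercept [n + ceilP m],
   at height [slack / W], and the [Q]-line meets it at height [1 - slack / W]. *)
Definition slack (p q m : Z) : Z := (- (2 * p * m)) mod (p + q).
Definition ceilP (p q m : Z) : Z := - ((- (2 * p * m)) / (p + q)).
Definition lineP (p q m n : Z) : Z := n + ceilP p q m.
Definition lineQ (p q m n : Z) : Z := n + 2 * m - ceilP p q m + 1.

(** Because P + Q = 2, an edge has two candidate lines, so a light count of 1 becomes an exclusive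
    or. For a vertical edge there is one candidate in each family. *)
Definition goodV (p q m n : Z) : bool :=
  xorb (light (p + q) (mass p q (lineP p q m n)) (4 * p * m))
       (light (p + q) (mass p q (lineQ p q m n)) (4 * p * m)).

(** As P < 1 < Q, at most one P-line is a candidate. It crosses at abscissa m + slack / (2p), so the
    test asks whether this is before m + 1; if it is not, the edge has two Q-candidates instead. *)
Definition goodH (p q m n : Z) : bool :=
  if slack p q m <? 2 * p then
    xorb (light (p + q) (mass p q (lineP p q m n)) (4 * p * n))
         (light (p + q) (mass p q (lineQ p q m n)) (4 * p * n))
  else
    xorb (light (p + q) (mass p q (lineQ p q m n)) (4 * p * n))
         (light (p + q) (mass p q (lineQ p q m n + 1)) (4 * p * n)).

Hypothesis Hp : 0 < p.
Hypothesis Hpq : p < q.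
Hypothesis Hodd : Z.Odd (p + q).

Lemma slack_spec (m : Z) :
  0 <= slack p q m < p + q /\ 2 * p * m + slack p q m = (p + q) * ceilP p q m.
Proof.
  unfold slack, ceilP. split; [apply Z.mod_pos_bound; lia|].
  pose proof (Z.div_mod (- (2 * p * m)) (p + q) ltac:(lia)). lia.
Qed.

Lemma ceilP_succ (m : Z) :
  ceilP p q (m + 1) = if slack p q m <? 2 * p then ceilP p q m + 1 else ceilP p q m.
Proof.
  pose proof (slack_spec m). pose proof (slack_spec (m + 1)).
  destruct (Z.ltb_spec (slack p q m) (2 * p)); nia.
Qed.

Lemma mass_odd (b : Z) : Z.Odd (mass p q b).
Proof. destruct Hodd as [x Hx]. exists (p * b + x). unfold mass. lia. Qed.

(** In both cases each candidate line serves exactly two of the four edges, so the quotients of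
    -[mass] occur twice. The remaining eight quotients pair off, either as equal terms or by the
    reflection x + y = -2W, which comes from P + Q = 2 and under which two quotients add up to
    -2. *)
Lemma degree_even (m n : Z) :
  xorb (xorb (goodH p q m n) (goodH p q m (n + 1)))
       (xorb (goodV p q m n) (goodV p q (m + 1) n)) = false.
Proof.
  pose proof (ceilP_succ m) as C.
  set (W := p + q). set (D := fun x => x / (2 * W)).
  assert (HW : 0 < W) by (unfold W; lia).
  assert (L : forall b b' x h, h = 4 * p * x ->
    xorb (light W (mass p q b) h) (light W (mass p q b') h) =
    Z.odd (D (- mass p q b) + D (- mass p q b') + D (h - mass p q b) + D (h - mass p q b'))).
  { intros. apply light_pair_turns; auto using mass_odd. exists (2 * p * x); lia. }
  assert (R : forall x y, Z.Odd x -> x + y = - (2 * W) -> D y = - 2 - D x).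
  { intros x y Ox E. unfold D. replace y with (- x + 2 * W * (-1)) by lia.
    rewrite div_add_turn, div_opp_odd by (auto; lia). lia. }
  assert (O : forall b x, Z.Odd (2 * x - mass p q b)).
  { intros b x. destruct (mass_odd b) as [y Hy]. exists (x - y - 1). lia. }
  unfold goodH, goodV. fold W.
  set (c := ceilP p q m) in *.
  destruct (slack p q m <? 2 * p) eqn:S.
  - rewrite (L _ _ n), (L _ _ (n + 1)), (L _ _ m), (L _ _ (m + 1)) by reflexivity.
    rewrite <- !Z.odd_add. unfold lineP, lineQ. rewrite C. fold c.
    set (b := n + c). set (b' := n + 2 * m - c + 1).
    replace (n + 1 + c) with (b + 1) by (unfold b; ring).
    replace (n + (c + 1)) with (b + 1) by (unfold b; ring).
    replace (n + 1 + 2 * m - c + 1) with (b' + 1) by (unfold b'; ring).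
    replace (n + 2 * (m + 1) - (c + 1) + 1) with (b' + 1) by (unfold b'; ring).
    rewrite (R (4 * p * n - mass p q b) (4 * p * (m + 1) - mass p q (b' + 1))).
    rewrite (R (4 * p * m - mass p q b) (4 * p * (n + 1) - mass p q (b' + 1))).
    rewrite (R (4 * p * (n + 1) - mass p q (b + 1)) (4 * p * m - mass p q b')).
    rewrite (R (4 * p * (m + 1) - mass p q (b + 1)) (4 * p * n - mass p q b')).
    all: try (match goal with |- Z.Odd (4 * p * ?x - mass p q ?y) =>
         replace (4 * p * x) with (2 * (2 * p * x)) by ring; apply O end).
    all: try (unfold mass, b, b', W; ring).
    match goal with |- Z.odd ?a = false => assert (E : Z.Even a) end.
    { exists (D (- mass p q b) + D (- mass p q b') + D (- mass p q (b + 1)) + D (- mass p q (b' + 1)) - 4). ring. }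
    rewrite <- Z.negb_even. apply Z.even_spec in E. rewrite E. reflexivity.
  - rewrite (L _ _ n), (L _ _ (n + 1)), (L _ _ m), (L _ _ (m + 1)) by reflexivity.
    rewrite <- !Z.odd_add. unfold lineP, lineQ. rewrite C. fold c.
    set (b := n + c). set (b' := n + 2 * m - c + 1).
    replace (n + 1 + 2 * m - c + 1) with (b' + 1) by (unfold b'; ring).
    replace (n + 2 * (m + 1) - c + 1) with (b' + 1 + 1) by (unfold b'; ring).
    rewrite (R (4 * p * (m + 1) - mass p q b) (4 * p * n - mass p q (b' + 1))).
    rewrite (R (4 * p * m - mass p q b) (4 * p * (n + 1) - mass p q (b' + 1))).
    (* Without a P-crossing two pairs are equal terms: one step in the edge coordinate changes h by
       4p, exactly as two steps of the intercept change the mass. *)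
    replace (4 * p * (n + 1) - mass p q (b' + 1 + 1)) with (4 * p * n - mass p q b')
      by (unfold mass; ring).
    replace (4 * p * (m + 1) - mass p q (b' + 1 + 1)) with (4 * p * m - mass p q b')
      by (unfold mass; ring).
    all: try (match goal with |- Z.Odd (4 * p * ?x - mass p q ?y) =>
         replace (4 * p * x) with (2 * (2 * p * x)) by ring; apply O end).
    all: try (unfold mass, b, b', W; ring).
    match goal with |- Z.odd ?a = false => assert (E : Z.Even a) end.
    { exists (D (- mass p q b) + D (- mass p q b') + D (- mass p q (b' + 1)) + D (- mass p q (b' + 1 + 1))
        + D (4 * p * m - mass p q b') + D (4 * p * n - mass p q b') - 2). ring. }
    rewrite <- Z.negb_even. apply Z.even_spec in E. rewrite E. reflexivity.
Qed.
End Masses.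

(** * Good segments in integer terms *)

(** Coprimality and even pq mean that exactly one of p, q is even, hence odd p + q. This makes all
    masses odd, while the values 4pm and 4pn are even. *)
Definition param (p q : Z) : Prop :=
  (0 < p < q)%Z /\ Z.Odd (p + q) /\ rel_prime p (p + q).

Lemma even_param_Z (p q : nat) : even_param p q -> param (Z.of_nat p) (Z.of_nat q).
Proof.
  intros (Hp & Hpq & G & E). split; [lia|].
  assert (B : rel_prime (Z.of_nat p) (Z.of_nat q)).
  { apply Zgcd_1_rel_prime.
    pose proof (Z.gcd_nonneg (Z.of_nat p) (Z.of_nat q)) as Pos.
    assert (X : forall r, Z.divide (Z.gcd (Z.of_nat p) (Z.of_nat q)) (Z.of_nat r) ->
              Nat.divide (Z.to_nat (Z.gcd (Z.of_nat p) (Z.of_nat q))) r).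
    { intros r [x Hx]. destruct (Nat.eq_dec r 0) as [->|R0]; [exists 0%nat; reflexivity|].
      exists (Z.to_nat x). apply Nat2Z.inj.
      rewrite Nat2Z.inj_mul, !Z2Nat.id; [exact Hx| lia | nia]. }
    pose proof (Nat.gcd_greatest _ _ _ (X p (Z.gcd_divide_l _ _)) (X q (Z.gcd_divide_r _ _))) as D.
    rewrite G in D. apply Nat.divide_1_r in D. lia. }
  split.
  - assert (~ (Nat.Even p /\ Nat.Even q)).
    { intros [[x Hx] [y Hy]].
      assert (D : Nat.divide 2 (Nat.gcd p q)).
      { apply Nat.gcd_greatest; [exists x | exists y]; lia. }
      rewrite G in D. destruct D as [z Hz]. lia. }
    destruct (Nat.Even_or_Odd p) as [Ep|[x Hx]], (Nat.Even_or_Odd q) as [Eq|[y Hy]].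
    + tauto.
    + destruct Ep as [x Hx]. exists (Z.of_nat x + Z.of_nat y)%Z. lia.
    + destruct Eq as [y Hy]. exists (Z.of_nat x + Z.of_nat y)%Z. lia.
    + destruct E as [e He]. exfalso. nia.
  - apply rel_prime_sym. apply rel_prime_sym in B.
    destruct (rel_prime_bezout _ _ B) as [u v H].
    apply bezout_rel_prime. exists u (v - u)%Z. lia.
Qed.

Lemma red2_cmod (W k : Z) : (0 < W)%Z -> red2 (IZR k / IZR W) = IZR (cmod W k) / IZR W.
Proof.
  intros HW. unfold red2, cmod.
  assert (HR : 0 < IZR W) by (apply IZR_lt; lia).
  pose proof (Z.mod_pos_bound (W - k) (2 * W) ltac:(lia)) as B.
  pose proof (Z.div_mod (W - k) (2 * W) ltac:(lia)) as E.
  set (d := ((W - k) / (2 * W))%Z) in *. set (r := ((W - k) mod (2 * W))%Z) in *.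
  rewrite <- (up_tech ((1 - IZR k / IZR W) / 2) d).
  - replace (1 - (d + 1))%Z with (- d)%Z by lia.
    replace k with (W - 2 * W * d - r)%Z by lia.
    rewrite opp_IZR, !minus_IZR, !mult_IZR. field. lra.
  - apply Rmult_le_reg_r with (2 * IZR W); [lra|].
    replace ((1 - IZR k / IZR W) / 2 * (2 * IZR W)) with (IZR (W - k)).
    2:{ rewrite minus_IZR. field. lra. }
    rewrite <- mult_IZR, <- mult_IZR. apply IZR_le. lia.
  - apply Rmult_lt_reg_r with (2 * IZR W); [lra|].
    replace ((1 - IZR k / IZR W) / 2 * (2 * IZR W)) with (IZR (W - k)).
    2:{ rewrite minus_IZR. field. lra. }
    rewrite <- mult_IZR, <- mult_IZR. apply IZR_lt. lia.
Qed.

Lemma light_real (W g h : Z) : (0 < W)%Z ->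
  (red2 (IZR h / IZR W) * red2 (IZR g / IZR W) > 0 /\
   Rabs (red2 (IZR g / IZR W)) < Rabs (red2 (IZR h / IZR W))) <-> light W g h = true.
Proof.
  intros HW. rewrite !red2_cmod by assumption.
  assert (HR : 0 < IZR W) by (apply IZR_lt; lia).
  unfold light. rewrite andb_true_iff, Z.ltb_lt, Z.ltb_lt.
  unfold Rdiv. rewrite !Rabs_mult, <- !abs_IZR.
  pose proof (Rinv_0_lt_compat _ HR) as HI. rewrite (Rabs_pos_eq (/ IZR W)) by lra.
  split; intros [A B]; split.
  - apply lt_IZR. rewrite mult_IZR.
    replace (IZR (cmod W h) * / IZR W * (IZR (cmod W g) * / IZR W)) with
      (IZR (cmod W g) * IZR (cmod W h) * (/ IZR W * / IZR W)) in A by ring.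
    apply Rmult_lt_reg_r with (/ IZR W * / IZR W); [nra|]. lra.
  - apply lt_IZR. apply Rmult_lt_reg_r with (/ IZR W); lra.
  - replace (IZR (cmod W h) * / IZR W * (IZR (cmod W g) * / IZR W)) with
      (IZR (cmod W g) * IZR (cmod W h) * (/ IZR W * / IZR W)) by ring.
    rewrite <- mult_IZR. apply IZR_lt in A. apply Rmult_lt_0_compat; nra.
  - apply IZR_lt in B. nra.
Qed.

Section Bridge.
Variables p q : nat.
Hypothesis Hpar : even_param p q.
Let zp := Z.of_nat p.
Let zq := Z.of_nat q.
Let W := (zp + zq)%Z.

Lemma omega_IZR : omega p q = IZR W.
Proof. unfold omega, W, zp, zq. rewrite INR_IZR_INZ, Nat2Z.inj_add. reflexivity. Qed.

Lemma W_pos : 0 < IZR W.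
Proof. apply IZR_lt. destruct (even_param_Z _ _ Hpar). unfold W, zp, zq; lia. Qed.

Lemma Pc_IZR : Pc p q = 2 * IZR zp / IZR W.
Proof. unfold Pc. rewrite omega_IZR, INR_IZR_INZ. reflexivity. Qed.

Lemma Qc_IZR : Qc p q = 2 * IZR zq / IZR W.
Proof. unfold Qc. rewrite omega_IZR, INR_IZR_INZ. reflexivity. Qed.

Lemma mass_real (b : Z) : Pc p q * IZR b + 1 = IZR (mass zp zq b) / IZR W.
Proof.
  pose proof W_pos. rewrite Pc_IZR. unfold mass. fold W.
  rewrite plus_IZR, !mult_IZR. field. lra.
Qed.

Lemma F_P_on_line (z : pt2) (b : Z) : snd z = - Pc p q * fst z + IZR b ->
  F_P p q z = red2 (IZR (mass zp zq b) / IZR W).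
Proof. intros E. unfold F_P. rewrite <- mass_real, E. f_equal. ring. Qed.

Lemma F_Q_on_line (z : pt2) (b : Z) : snd z = - Qc p q * fst z + IZR b ->
  F_Q p q z = red2 (IZR (mass zp zq b) / IZR W).
Proof. intros E. unfold F_Q. rewrite <- mass_real, E. f_equal. ring. Qed.

(** The geometry with denominators cleared: a P-line of intercept b reaches height n where P x = b -
    n, a Q-line where Q x = b - n. *)
Lemma light_point_H (m n : Z) (z : pt2) :
  light_point p q (Hseg m n) z <->
  on_useg (Hseg m n) z /\ exists b, light W (mass zp zq b) (4 * zp * n) = true /\
    (IZR ((b - n) * W) = 2 * IZR zp * fst z \/ IZR ((b - n) * W) = 2 * IZR zq * fst z).
Proof.
  pose proof W_pos as HW. assert (HWz : (0 < W)%Z) by (apply lt_IZR; lra).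
  unfold light_point.
  assert (X : forall (A B C : Prop), (A -> (B <-> C)) -> (A /\ B <-> A /\ C)) by tauto.
  apply X. intros [Ey Ex]. clear X.
  assert (EF : F_A p q (Hseg m n) z = red2 (IZR (4 * zp * n) / IZR W)).
  { unfold F_A, F_H. rewrite Ey, Pc_IZR. f_equal. rewrite !mult_IZR. field. lra. }
  assert (LP : forall b, IZR ((b - n) * W) = 2 * IZR zp * fst z <-> snd z = - Pc p q * fst z + IZR b).
  { intros b. rewrite mult_IZR, minus_IZR, Ey, Pc_IZR. split; intros E.
    - replace (IZR b) with (IZR n + 2 * IZR zp * fst z / IZR W); [field; lra|].
      rewrite <- E. field. lra.
    - replace (IZR b) with (IZR n - - (2 * IZR zp / IZR W) * fst z) by lra. field. lra. }
  assert (LQ : forall b, IZR ((b - n) * W) = 2 * IZR zq * fst z <-> snd z = - Qc p q * fst z + IZR b).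
  { intros b. rewrite mult_IZR, minus_IZR, Ey, Qc_IZR. split; intros E.
    - replace (IZR b) with (IZR n + 2 * IZR zq * fst z / IZR W); [field; lra|].
      rewrite <- E. field. lra.
    - replace (IZR b) with (IZR n - - (2 * IZR zq / IZR W) * fst z) by lra. field. lra. }
  rewrite EF. split.
  - intros [[[b Eb] H]|[[b Eb] H]]; exists b.
    + rewrite (F_P_on_line z b Eb) in H. apply light_real in H; auto.
      split; auto. left. apply LP, Eb.
    + rewrite (F_Q_on_line z b Eb) in H. apply light_real in H; auto.
      split; auto. right. apply LQ, Eb.
  - intros [b [H [E|E]]]; [left; apply LP in E | right; apply LQ in E]; (split; [exists b; exact E|]).
    + rewrite (F_P_on_line z b E). apply light_real; auto.
    + rewrite (F_Q_on_line z b E). apply light_real; auto.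
Qed.

Lemma light_point_V (m n : Z) (z : pt2) :
  light_point p q (Vseg m n) z <->
  on_useg (Vseg m n) z /\ exists b, light W (mass zp zq b) (4 * zp * m) = true /\
    (IZR (b * W - 2 * zp * m) = IZR W * snd z \/ IZR (b * W - 2 * zq * m) = IZR W * snd z).
Proof.
  pose proof W_pos as HW. assert (HWz : (0 < W)%Z) by (apply lt_IZR; lra).
  unfold light_point.
  assert (X : forall (A B C : Prop), (A -> (B <-> C)) -> (A /\ B <-> A /\ C)) by tauto.
  apply X. intros [Ex Ey]. clear X.
  assert (EF : F_A p q (Vseg m n) z = red2 (IZR (4 * zp * m) / IZR W)).
  { unfold F_A, F_V. rewrite Ex, Pc_IZR. f_equal. rewrite !mult_IZR. field. lra. }
  assert (LP : forall b, IZR (b * W - 2 * zp * m) = IZR W * snd z <-> snd z = - Pc p q * fst z + IZR b).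
  { intros b. rewrite minus_IZR, !mult_IZR, Ex, Pc_IZR. split; intros E.
    - apply Rmult_eq_reg_l with (IZR W); [|lra]. rewrite <- E. field. lra.
    - rewrite E. field. lra. }
  assert (LQ : forall b, IZR (b * W - 2 * zq * m) = IZR W * snd z <-> snd z = - Qc p q * fst z + IZR b).
  { intros b. rewrite minus_IZR, !mult_IZR, Ex, Qc_IZR. split; intros E.
    - apply Rmult_eq_reg_l with (IZR W); [|lra]. rewrite <- E. field. lra.
    - rewrite E. field. lra. }
  rewrite EF. split.
  - intros [[[b Eb] H]|[[b Eb] H]]; exists b.
    + rewrite (F_P_on_line z b Eb) in H. apply light_real in H; auto.
      split; auto. left. apply LP, Eb.
    + rewrite (F_Q_on_line z b Eb) in H. apply light_real in H; auto.
      split; auto. right. apply LQ, Eb.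
  - intros [b [H [E|E]]]; [left; apply LP in E | right; apply LQ in E]; (split; [exists b; exact E|]).
    + rewrite (F_P_on_line z b E). apply light_real; auto.
    + rewrite (F_Q_on_line z b E). apply light_real; auto.
Qed.

(* Two candidate light points: coinciding ones must either be dark or sit at the
   midpoint of a horizontal segment, where the light count weighs them twice. *)
Lemma good_two_candidates (s : useg) (l1 l2 : bool) (z1 z2 : pt2) :
  (forall z, light_point p q s z <-> (l1 = true /\ z = z1) \/ (l2 = true /\ z = z2)) ->
  (z1 = z2 -> l1 = l2 /\ (l1 = true -> is_horizontal s /\ z1 = midpoint s)) ->
  (is_horizontal s -> z1 = midpoint s \/ z2 = midpoint s -> z1 = z2) ->
  (good p q s <-> xorb l1 l2 = true).
Proof.
  intros HL HE HM. unfold good, light_count. split.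
  - intros (l & ND & Hl & C1 & C2).
    destruct (classic (is_horizontal s /\ light_point p q s (midpoint s))) as [C|C].
    + specialize (C1 C). destruct l as [|z l]; [|discriminate].
      destruct C as [_ C]. apply Hl in C. destruct C.
    + specialize (C2 C). destruct l as [|z [|z' l]]; try discriminate.
      destruct l1 eqn:E1, l2 eqn:E2; auto; exfalso.
      * assert (I1 : In z1 (z :: nil)) by (apply Hl, HL; auto).
        assert (I2 : In z2 (z :: nil)) by (apply Hl, HL; auto).
        cbn in I1, I2. destruct I1 as [I1|[]], I2 as [I2|[]]; subst.
        destruct (HE eq_refl) as [_ [H1 H2]]; auto.
        apply C. split; auto. rewrite <- H2. apply HL. auto.
      * assert (I : In z (z :: nil)) by (cbn; auto). apply Hl, HL in I.
        destruct I as [[? _]|[? _]]; discriminate.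
  - intros X. exists (if l1 then z1 :: nil else z2 :: nil).
    assert (NE : z1 <> z2).
    { intros E. destruct (HE E) as [E' _]. subst l2. rewrite xorb_nilpotent in X. discriminate. }
    split; [destruct l1; repeat constructor; auto|].
    split; [|split].
    + intros z. rewrite HL. destruct l1, l2; try discriminate; cbn;
      intuition (auto; discriminate).
    + intros [Hh C]. exfalso. apply HL in C. apply NE, HM; auto.
      destruct C as [[_ C]|[_ C]]; auto.
    + intros _. destruct l1; reflexivity.
Qed.

Lemma good_V (m n : Z) : good p q (Vseg m n) <-> goodV zp zq m n = true.
Proof.
  pose proof W_pos as HW.
  destruct (even_param_Z _ _ Hpar) as [[Hp Hpq] [Hodd _]]. fold zp zq in Hp, Hpq, Hodd.
  destruct (slack_spec zp zq Hp Hpq m) as [Bs Es]. fold W in Es, Bs, Hodd.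
  unfold goodV. fold W.
  set (s := slack zp zq m) in *. set (c := ceilP zp zq m) in *.
  assert (Hs : 0 <= IZR s < IZR W) by (split; [apply IZR_le|apply IZR_lt]; lia).
  assert (EP : IZR W * (IZR (lineP zp zq m n) - IZR n) = IZR (2 * zp * m) + IZR s).
  { rewrite <- plus_IZR, <- minus_IZR, <- mult_IZR. f_equal. unfold lineP. fold c. lia. }
  apply good_two_candidates with (z1 := (IZR m, IZR n + IZR s / IZR W))
     (z2 := (IZR m, IZR n + 1 - IZR s / IZR W)).
  - intros [x y]. rewrite light_point_V. cbn [on_useg fst snd].
    (* For s = 0 further lines pass through the endpoints of the edge, but then 4pm is a multiple of
       2W, F_V vanishes and nothing is light. *)
    destruct (Z.eq_dec s 0) as [S0|S0].
    { assert (Dark : forall g, light W g (4 * zp * m) = false).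
      { intros g. destruct (light W g (4 * zp * m)) eqn:L; auto.
        apply light_true in L. rewrite (cmod_unique W (4 * zp * m) 0 c) in L; lia. }
      split.
      - intros [_ [b [L _]]]. rewrite Dark in L. discriminate.
      - rewrite !Dark. intros [[? _]|[? _]]; discriminate. }
    assert (Hs1 : (1 <= s)%Z) by lia.
    split.
    + intros [[Hx Hy] [b [L [E|E]]]].
      * left. assert (b = lineP zp zq m n).
        { assert (n * W <= b * W - 2 * zp * m)%Z by (apply le_IZR; rewrite E, mult_IZR; nra).
          assert (b * W - 2 * zp * m <= (n + 1) * W)%Z by (apply le_IZR; rewrite E, mult_IZR, plus_IZR; nra).
          unfold lineP; fold c. nia. }
        subst b. split; auto. f_equal; auto.
        apply Rmult_eq_reg_l with (IZR W); [|lra]. rewrite <- E.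
        replace (IZR W * (IZR n + IZR s / IZR W)) with (IZR W * IZR n + IZR s) by (field; lra).
        rewrite minus_IZR, mult_IZR. lra.
      * right. assert (b = lineQ zp zq m n).
        { assert (n * W <= b * W - 2 * zq * m)%Z by (apply le_IZR; rewrite E, mult_IZR; nra).
          assert (b * W - 2 * zq * m <= (n + 1) * W)%Z by (apply le_IZR; rewrite E, mult_IZR, plus_IZR; nra).
          unfold lineQ; fold c. unfold W in *. nia. }
        subst b. split; auto. f_equal; auto.
        apply Rmult_eq_reg_l with (IZR W); [|lra]. rewrite <- E.
        replace (IZR W * (IZR n + 1 - IZR s / IZR W)) with (IZR W * IZR n + IZR W - IZR s) by (field; lra).
        rewrite <- mult_IZR, <- plus_IZR, <- minus_IZR. f_equal. unfold lineQ; fold c. unfold W in *. lia.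
    + assert (F : 0 <= IZR s / IZR W <= 1).
      { split; [apply Rmult_le_pos; [lra| left; apply Rinv_0_lt_compat; lra]|].
        apply Rmult_le_reg_r with (IZR W); [lra|]. unfold Rdiv. rewrite Rmult_assoc, Rinv_l; lra. }
      intros [[L E]|[L E]]; injection E as -> ->; (split; [split; [reflexivity | lra]|]).
      * exists (lineP zp zq m n). split; auto. left.
        replace (IZR W * (IZR n + IZR s / IZR W)) with (IZR W * IZR n + IZR s) by (field; lra).
        rewrite minus_IZR, mult_IZR. lra.
      * exists (lineQ zp zq m n). split; auto. right.
        replace (IZR W * (IZR n + 1 - IZR s / IZR W)) with (IZR W * IZR n + IZR W - IZR s) by (field; lra).
        rewrite <- mult_IZR, <- plus_IZR, <- minus_IZR. f_equal. unfold lineQ; fold c. unfold W in *. lia.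
  (* The heights s/W and 1 - s/W agree only for 2s = W, and W is odd. *)
  - intros E. injection E as E. exfalso.
    assert (2 * IZR s = IZR W).
    { apply Rmult_eq_reg_r with (/ IZR W); [|apply Rinv_neq_0_compat; lra].
      rewrite Rinv_r by lra. unfold Rdiv in E. lra. }
    rewrite <- mult_IZR in H. apply eq_IZR in H. destruct Hodd. lia.
  - intros [].
Qed.

Lemma good_H (m n : Z) : good p q (Hseg m n) <-> goodH zp zq m n = true.
Proof.
  pose proof W_pos as HW.
  destruct (even_param_Z _ _ Hpar) as [[Hp Hpq] [Hodd Hrel]]. fold zp zq in Hp, Hpq, Hodd, Hrel.
  destruct (slack_spec zp zq Hp Hpq m) as [Bs Es]. fold W in Es, Bs, Hodd, Hrel.
  unfold goodH. fold W.
  assert (Rp : 0 < IZR zp) by (apply IZR_lt; lia).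
  assert (Rq : 0 < IZR zq) by (apply IZR_lt; lia).
  set (s := slack zp zq m) in *. set (c := ceilP zp zq m) in *.
  set (zP := fun b => (IZR ((b - n) * W) / (2 * IZR zp), IZR n) : pt2).
  set (zQ := fun b => (IZR ((b - n) * W) / (2 * IZR zq), IZR n) : pt2).
  assert (EqP : forall b x, x = IZR ((b - n) * W) / (2 * IZR zp) <-> IZR ((b - n) * W) = 2 * IZR zp * x).
  { intros b x; split; intros E; [rewrite E; field; lra | rewrite E; field; lra]. }
  assert (EqQ : forall b x, x = IZR ((b - n) * W) / (2 * IZR zq) <-> IZR ((b - n) * W) = 2 * IZR zq * x).
  { intros b x; split; intros E; [rewrite E; field; lra | rewrite E; field; lra]. }
  assert (RangeP : forall b x, IZR ((b - n) * W) = 2 * IZR zp * x ->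
    (IZR m <= x <= IZR m + 1 <-> (2 * zp * m <= (b - n) * W <= 2 * zp * (m + 1))%Z)).
  { intros b x E. split; intros [H1 H2].
    - split; apply le_IZR; rewrite E, !mult_IZR, ?plus_IZR; nra.
    - apply IZR_le in H1, H2. rewrite E, !mult_IZR, ?plus_IZR in *. split; nra. }
  assert (RangeQ : forall b x, IZR ((b - n) * W) = 2 * IZR zq * x ->
    (IZR m <= x <= IZR m + 1 <-> (2 * zq * m <= (b - n) * W <= 2 * zq * (m + 1))%Z)).
  { intros b x E. split; intros [H1 H2].
    - split; apply le_IZR; rewrite E, !mult_IZR, ?plus_IZR; nra.
    - apply IZR_le in H1, H2. rewrite E, !mult_IZR, ?plus_IZR in *. split; nra. }
  assert (zP_neq_zQ : forall b b', ((b - n) * zq <> (b' - n) * zp)%Z -> zP b <> zQ b').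
  { intros b b' H E. apply H. injection E as E.
    apply eq_IZR. rewrite !mult_IZR in *.
    apply Rmult_eq_reg_r with (IZR W / (2 * IZR zp * IZR zq)).
    2:{ apply Rgt_not_eq. apply Rdiv_lt_0_compat; nra. }
    transitivity (IZR (b - n) * IZR W / (2 * IZR zp)); [field; lra|].
    rewrite E. field. lra. }
  assert (zP_eq_zQ : forall b b', ((b - n) * zq = (b' - n) * zp)%Z -> zP b = zQ b').
  { intros b b' H. unfold zP, zQ. f_equal. apply (f_equal IZR) in H. rewrite !mult_IZR in *.
    transitivity (IZR (b - n) * IZR zq * IZR W / (2 * IZR zp * IZR zq)); [field; lra|].
    rewrite H. field. lra. }
  assert (midP : forall b, zP b = midpoint (Hseg m n) <-> ((b - n) * W = zp * (2 * m + 1))%Z).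
  { intros b. unfold zP, midpoint. split.
    - intros E. injection E as E. apply eq_IZR. symmetry in E. apply EqP in E. rewrite E.
      rewrite mult_IZR, plus_IZR, mult_IZR. field.
    - intros E. f_equal. symmetry. apply EqP. rewrite E, mult_IZR, plus_IZR, mult_IZR. field. }
  assert (midQ : forall b, zQ b = midpoint (Hseg m n) <-> ((b - n) * W = zq * (2 * m + 1))%Z).
  { intros b. unfold zQ, midpoint. split.
    - intros E. injection E as E. apply eq_IZR. symmetry in E. apply EqQ in E. rewrite E.
      rewrite mult_IZR, plus_IZR, mult_IZR. field.
    - intros E. f_equal. symmetry. apply EqQ. rewrite E, mult_IZR, plus_IZR, mult_IZR. field. }
  assert (LPt : forall z, light_point p q (Hseg m n) z <-> exists b,
     light W (mass zp zq b) (4 * zp * n) = true /\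
     ((z = zP b /\ (2 * zp * m <= (b - n) * W <= 2 * zp * (m + 1))%Z) \/
      (z = zQ b /\ (2 * zq * m <= (b - n) * W <= 2 * zq * (m + 1))%Z))).
  { intros [x y]. rewrite light_point_H. cbn [on_useg fst snd]. split.
    - intros [[-> Hx] [b [L [E|E]]]]; exists b; split; auto; [left|right].
      + split; [unfold zP; f_equal; apply EqP, E | apply (RangeP b x E), Hx].
      + split; [unfold zQ; f_equal; apply EqQ, E | apply (RangeQ b x E), Hx].
    - intros [b [L [[E H]|[E H]]]]; injection E as Ex Ey.
      + apply EqP in Ex. split; [split; [auto|apply (RangeP b x Ex), H]|]. exists b. auto.
      + apply EqQ in Ex. split; [split; [auto|apply (RangeQ b x Ex), H]|]. exists b. auto. }
  assert (HWz : (0 < W)%Z) by (unfold W; lia).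
  assert (EW : (W = zp + zq)%Z) by reflexivity.
  assert (OffP : forall b, ((b - n) * W - 2 * zp * m = (b - n - c) * W + s)%Z) by (intros; lia).
  assert (OffQ : forall b, ((b - n) * W - 2 * zq * m = (b - n - 2 * m + c) * W - s)%Z).
  { intros b. replace zq with (W - zp)%Z by lia. lia. }
  assert (MemP : forall b, (2 * zp * m <= (b - n) * W <= 2 * zp * (m + 1) <->
             0 <= (b - n - c) * W + s <= 2 * zp)%Z) by (intros b; rewrite <- OffP; lia).
  assert (MemQ : forall b, (2 * zq * m <= (b - n) * W <= 2 * zq * (m + 1) <->
             0 <= (b - n - 2 * m + c) * W - s <= 2 * W - 2 * zp)%Z)
    by (intros b; rewrite <- OffQ; lia).
  (* A P-line b and a Q-line b' meeting at (x, n) satisfy b + b' - 2n = 2x, again by P + Q = 2.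
     Their masses then add up to 4pn modulo 2W, so [light_sym] gives both the same status. *)
  assert (Sym : forall b b', ((2 * zp * m + zp * (b + b' - 2 * n - 2 * m)) mod W = 0)%Z ->
     light W (mass zp zq b) (4 * zp * n) = light W (mass zp zq b') (4 * zp * n)).
  { intros b b' E. apply Z.mod_divide in E; [|lia]. destruct E as [k E].
    apply light_sym with (k := (k + 1)%Z); auto. unfold mass. rewrite <- EW. lia. }
  clearbody W.
  assert (Same : forall b b', (zq * ((b - n - c) * W + s) = zp * ((b' - n - 2 * m + c) * W - s))%Z
     <-> ((b - n) * zq = (b' - n) * zp)%Z).
  { intros b b'. rewrite <- OffP, <- OffQ. split; nia. }
  assert (Div0 : forall x k, (x = k * W -> x mod W = 0)%Z).
  { intros x k ->. apply Z_mod_mult. }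
  assert (ZeroP : forall e, (0 <= e * W + s <= 2 * zp)%Z -> e = 0%Z).
  { intros e He. assert (e < 1)%Z by nia. assert (e > -1)%Z by nia. lia. }
  assert (ZeroQ : forall e, (0 <= e * W - s <= 2 * W - 2 * zp)%Z ->
    (e = 0 /\ s = 0 \/ e = 1 \/ e = 2 /\ 2 * zp <= s)%Z).
  { intros e He. assert (e < 3)%Z by nia. assert (e > -1)%Z by nia.
    assert (e = 0 \/ e = 1 \/ e = 2)%Z as [-> | [-> | ->]] by lia; lia. }
  destruct (Z.ltb_spec s (2 * zp)) as [Hs|Hs].
  - assert (e1 : (lineP zp zq m n - n - c = 0)%Z) by (unfold lineP; fold c; lia).
    assert (e2 : (lineQ zp zq m n - n - 2 * m + c = 1)%Z) by (unfold lineQ; fold c; lia).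
    (* s = p places both candidates at the midpoint, and they coincide nowhere else; this is the
       case that the double weight of the midpoint takes care of. *)
    assert (Meet : zP (lineP zp zq m n) = zQ (lineQ zp zq m n) <-> s = zp).
    { split; intros E.
      - destruct (Z.eq_dec s zp) as [|X]; auto. exfalso.
        apply (zP_neq_zQ (lineP zp zq m n) (lineQ zp zq m n)); auto.
        rewrite <- Same, e1, e2. nia.
      - apply zP_eq_zQ, Same. rewrite e1, e2. nia. }
    apply good_two_candidates with (z1 := zP (lineP zp zq m n)) (z2 := zQ (lineQ zp zq m n)).
    + intros z. rewrite LPt. split.
      * intros [b [L [[E H]|[E H]]]].
        -- left. apply MemP in H. assert (b = lineP zp zq m n) by (pose proof (ZeroP _ H); lia). subst b; auto.
        -- apply MemQ in H.
           (* For s = 0 a further Q-line passes through the left endpoint. It meets the P-candidate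
              there and shares its status, so it adds no light point. *)
           assert (C : (b = lineQ zp zq m n \/ (b = lineQ zp zq m n - 1 /\ s = 0))%Z).
           { pose proof (ZeroQ _ H). lia. }
           destruct C as [->|[-> S0]]; [right; auto|].
           left. split.
           ++ rewrite <- L. apply Sym, Div0 with c. replace (lineQ zp zq m n - 1)%Z with (n + 2 * m - c)%Z by lia.
              replace (lineP zp zq m n) with (n + c)%Z by lia. lia.
           ++ rewrite E. symmetry. apply zP_eq_zQ, Same. rewrite e1, S0.
              replace (lineQ zp zq m n - 1 - n - 2 * m + c)%Z with 0%Z by lia. lia.
      * intros [[L E]|[L E]].
        -- exists (lineP zp zq m n). split; auto. left. split; auto. apply MemP. rewrite e1. lia.
        -- exists (lineQ zp zq m n). split; auto. right. split; auto. apply MemQ. rewrite e2. lia.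
    + intros E. apply Meet in E. split.
      * apply Sym, Div0 with c.
        replace (lineQ zp zq m n) with (n + 2 * m - c + 1)%Z by lia.
        replace (lineP zp zq m n) with (n + c)%Z by lia. lia.
      * intros _. split; [exact I|]. apply midP.
        pose proof (OffP (lineP zp zq m n)) as O. rewrite e1 in O. lia.
    + intros _ [E|E]; apply Meet.
      * apply midP in E. pose proof (OffP (lineP zp zq m n)) as O. rewrite e1 in O. lia.
      * apply midQ in E. pose proof (OffQ (lineQ zp zq m n)) as O. rewrite e2 in O. lia.
  - assert (e1 : (lineQ zp zq m n - n - 2 * m + c = 1)%Z) by (unfold lineQ; fold c; lia).
    assert (e2 : (lineQ zp zq m n + 1 - n - 2 * m + c = 2)%Z) by lia.
    apply good_two_candidates with (z1 := zQ (lineQ zp zq m n)) (z2 := zQ (lineQ zp zq m n + 1)%Z).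
    + intros z. rewrite LPt. split.
      * intros [b [L [[E H]|[E H]]]].
        (* For s = 2p a P-line passes through the right endpoint, where it duplicates the second
           Q-candidate. *)
        -- apply MemP in H. right.
           pose proof (ZeroP _ H) as B0. assert (S0 : s = (2 * zp)%Z) by (rewrite B0 in H; lia).
           split.
           ++ rewrite <- L. apply Sym, Div0 with c. replace b with (n + c)%Z by lia.
              replace (lineQ zp zq m n + 1)%Z with (n + 2 * m - c + 2)%Z by lia. lia.
           ++ rewrite E. apply zP_eq_zQ, Same. rewrite e2, B0, S0. nia.
        -- apply MemQ in H.
           assert (C : (b - n - 2 * m + c = 1 \/ b - n - 2 * m + c = 2)%Z) by (pose proof (ZeroQ _ H); lia).
           assert (b = lineQ zp zq m n \/ b = lineQ zp zq m n + 1)%Z as [->| ->] by lia; auto.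
      * intros [[L E]|[L E]].
        -- exists (lineQ zp zq m n). split; auto. right. split; auto. apply MemQ. rewrite e1. lia.
        -- exists (lineQ zp zq m n + 1)%Z. split; auto. right. split; auto. apply MemQ. rewrite e2. lia.
    + intros E. exfalso. injection E as E.
      assert (E' : IZR ((lineQ zp zq m n - n) * W) = IZR ((lineQ zp zq m n + 1 - n) * W)).
      { apply Rmult_eq_reg_r with (/ (2 * IZR zq)); [exact E|]. apply Rinv_neq_0_compat. lra. }
      apply eq_IZR in E'. lia.
    + intros _ [E|E]; exfalso; apply midQ in E.
      * pose proof (OffQ (lineQ zp zq m n)) as O. rewrite e1 in O. lia.
      * pose proof (OffQ (lineQ zp zq m n + 1)%Z) as O. rewrite e2 in O. lia.
Qed.
End Bridge.

(** * Capacity *)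

Section Capacity.
Local Open Scope Z_scope.

(** The sign s covers both congruences at once; s * al is the inverse of 2p modulo p + q. *)
Definition tune (p q al : Z) : Prop :=
  0 < al /\ 2 * al < p + q /\ exists s, s * s = 1 /\ (p + q | 2 * p * al - s).

Definition Zrange (n : Z) : list Z := map Z.of_nat (seq 0 (Z.to_nat n)).

Lemma in_Zrange (n x : Z) : In x (Zrange n) <-> 0 <= x < n.
Proof.
  unfold Zrange. rewrite in_map_iff. split.
  - intros [i [<- Hi]]. apply in_seq in Hi. lia.
  - intros H. exists (Z.to_nat x). rewrite in_seq. lia.
Qed.

Lemma NoDup_Zrange (n : Z) : NoDup (Zrange n).
Proof.
  apply FinFun.Injective_map_NoDup; [|apply seq_NoDup]. intros x y. apply Nat2Z.inj.
Qed.

Lemma length_Zrange (n : Z) : length (Zrange n) = Z.to_nat n.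
Proof. unfold Zrange. rewrite length_map, length_seq. reflexivity. Qed.

(** A relation replaces an injective map, so that partners known only to exist can be used without a
    choice function. *)
Lemma pigeonhole_rel {A B : Type} (R : A -> B -> Prop) (l : list A) (l' : list B) :
  NoDup l ->
  (forall x, In x l -> exists y, In y l' /\ R x y) ->
  (forall x x' y, In x l -> In x' l -> R x y -> R x' y -> x = x') ->
  (length l <= length l')%nat.
Proof.
  revert l'. induction l as [|a l IH]; intros l' ND HR HI; cbn; [lia|].
  inversion ND as [|? ? Ha ND']; subst.
  destruct (HR a) as [y [Hy Ray]]; [cbn; auto|].
  destruct (in_split y l' Hy) as [l1 [l2 E]]. subst l'.
  assert (length l <= length (l1 ++ l2))%nat.
  { apply IH; auto.
    - intros x Hx. destruct (HR x) as [y' [Hy' Rx]]; [cbn; auto|].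
      exists y'. split; auto. apply in_app_iff in Hy'. apply in_app_iff.
      destruct Hy' as [?|[<-|?]]; auto.
      exfalso. apply Ha. rewrite (HI a x y); cbn; auto.
    - intros x x' y' Hx Hx'. apply HI; cbn; auto. }
  rewrite length_app in *. cbn. lia.
Qed.

(* the offsets of the lines carrying light points on a line of capacity [2|c|] *)
Definition offsets (c : Z) : list Z := map (fun i => 2 * i + 1 - Z.abs c) (Zrange (Z.abs c)).

Lemma in_offsets (c d : Z) : In d (offsets c) <-> Z.abs d < Z.abs c /\ Z.Odd (d + c).
Proof.
  unfold offsets. rewrite in_map_iff. split.
  - intros [i [<- Hi]]. apply in_Zrange in Hi. split; [lia|].
    destruct (Z.abs_spec c) as [[_ ->]|[_ ->]]; [exists i | exists (i + c)]; lia.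
  - intros [Hd [x Hx]].
    destruct (Z.abs_spec c) as [[Hc ->]|[Hc ->]]; [exists x | exists (x - c)];
      rewrite in_Zrange; lia.
Qed.

Lemma NoDup_offsets (c : Z) : NoDup (offsets c).
Proof.
  apply FinFun.Injective_map_NoDup; [|apply NoDup_Zrange]. intros x y. lia.
Qed.

Lemma length_offsets (c : Z) : length (offsets c) = Z.to_nat (Z.abs c).
Proof. unfold offsets. rewrite length_map. apply length_Zrange. Qed.

Variables p q al : Z.
Hypothesis Hpar : param p q.
Hypothesis Htune : tune p q al.
Let W := p + q.

Lemma W_pos_Z : 0 < W.
Proof. pose proof (proj1 Hpar). unfold W. lia. Qed.

Lemma W_rel_prime_2p : rel_prime W (2 * p).
Proof.
  destruct (proj2 Hpar) as ([x Hx] & R). fold W in Hx, R.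
  apply rel_prime_mult; [|apply rel_prime_sym, R].
  apply bezout_rel_prime. apply Bezout_intro with (u := 1) (v := - x). lia.
Qed.

Lemma divide_2p (x : Z) : (W | 2 * p * x) -> (W | x).
Proof. intros H. apply Gauss with (2 * p); [exact H | apply W_rel_prime_2p]. Qed.

Lemma divide_al (x : Z) : (W | x * al) -> (W | x).
Proof.
  intros [k Hk]. destruct Htune as (_ & _ & s & Hs & [l Hl]). fold W in Hl.
  exists (s * (2 * p * k - l * x)).
  replace x with (s * s * x) at 1 by (rewrite Hs; ring).
  replace (s * x) with (2 * p * (x * al) - l * W * x); [|nia].
  transitivity (s * (s * x)); [ring|].
  replace (s * x) with (2 * p * (x * al) - l * W * x) by nia. rewrite Hk. ring.
Qed.

(** Since 2p al is s modulo W, the value 4pn reduces to 2sc modulo 2W, and a line b = n + d al with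
    d + c odd has mass s(d + c) modulo 2W. The odd numbers strictly between 0 and 2sc are the s(d +
    c) with |d| < |c| and d + c odd. *)
Lemma light_on_line (c n b : Z) : (W | n - c * al) -> 2 * Z.abs c < W ->
  light W (mass p q b) (4 * p * n) = true <->
  exists d, In d (offsets c) /\ (W | b - n - d * al).
Proof.
  intros [k Hk] Hc. pose proof W_pos_Z as HW.
  destruct Htune as (_ & _ & s & Hs & [l Hl]). fold W in Hl.
  assert (S1 : s = 1 \/ s = -1) by nia.
  assert (E4 : 4 * p * n = 2 * (s * c) + 2 * W * (2 * p * k + c * l)).
  { replace n with (c * al + k * W) by lia.
    transitivity (2 * c * (2 * p * al) + 4 * p * k * W); [ring|].
    replace (2 * p * al) with (s + l * W) by lia. ring. }
  assert (Bsc : - W < 2 * (s * c) <= W) by (destruct S1; subst s; lia).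
  rewrite light_true, (cmod_unique W (4 * p * n) _ _ HW Bsc E4).
  destruct (cmod_spec W (mass p q b) HW) as [Br [j Hj]].
  set (r := cmod W (mass p q b)) in *. unfold mass in Hj. fold W in Hj.
  destruct (proj1 (proj2 Hpar)) as [w Hw]. fold W in Hw.
  split.
  - intros Hr. exists (s * r - c). split.
    + apply in_offsets. split; [destruct S1; subst s; lia|].
      destruct S1; subst s; [exists (p * b + w - W * j) | exists (- (p * b + w - W * j) - 1)]; lia.
    + apply divide_2p.
      exists (2 * j - 1 - l * s * r - 2 * p * k).
      transitivity (2 * p * b - 2 * p * n - (s * r - c) * (2 * p * al)); [ring|].
      replace (2 * p * al) with (s + l * W) by lia.
      replace (2 * p * n) with (s * c + W * (2 * p * k + c * l)) by lia.
      transitivity (2 * p * b - s * s * r - W * (2 * p * k + l * s * r)); [ring|].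
      rewrite Hs. lia.
  - intros [d [Hd [i Hi]]]. apply in_offsets in Hd. destruct Hd as [Bd [y Hy]].
    assert (Er : mass p q b = s * (d + c) + 2 * W * ((2 * p * b + W - s * (d + c)) / (2 * W))).
    { assert (D : (2 * W | 2 * p * b + W - s * (d + c))).
      { assert (D1 : 2 * p * b - s * (d + c) = W * (2 * p * (i + k) + (d + c) * l)).
        { replace b with (n + d * al + i * W) by lia.
          replace n with (c * al + k * W) by lia.
          transitivity ((d + c) * (2 * p * al) + 2 * p * (i + k) * W - s * (d + c)); [ring|].
          replace (2 * p * al) with (s + l * W) by lia. ring. }
        (* 2pb is even and s(d + c) is odd, so the cofactor of W is odd; the summand W of the mass
           then completes a multiple of 2W. *)
        assert (D2 : Z.Odd (2 * p * (i + k) + (d + c) * l)).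
        { destruct (Z.Even_or_Odd (2 * p * (i + k) + (d + c) * l)) as [[u Hu]|]; auto.
          exfalso. rewrite Hu in D1. destruct S1; subst s; lia. }
        destruct D2 as [u Hu]. exists (u + 1). rewrite Hu in D1. lia. }
      destruct D as [u Hu]. rewrite Hu, Z.div_mul by lia. unfold mass. fold W. lia. }
    assert (R : r = s * (d + c)).
    { apply (cmod_unique W _ _ _ HW) in Er; [exact Er|]. destruct S1; subst s; lia. }
    rewrite R. destruct S1; subst s; lia.
Qed.

Lemma goodH_light (m n : Z) : goodH p q m n = true ->
  exists b, light W (mass p q b) (4 * p * n) = true /\
    (2 * p * m <= (b - n) * W <= 2 * p * (m + 1) \/
     2 * q * m <= (b - n) * W <= 2 * q * (m + 1)).
Proof.
  destruct Hpar as [[Hp Hpq] _].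
  destruct (slack_spec p q Hp Hpq m) as [Bs Es]. fold W in Bs, Es.
  assert (EW : forall x, 2 * q * x = 2 * W * x - 2 * p * x) by (intros; unfold W; ring).
  unfold goodH. fold W. intros G.
  destruct (Z.ltb_spec (slack p q m) (2 * p)) as [S|S].
  - destruct (light W (mass p q (lineP p q m n)) (4 * p * n)) eqn:L1.
    + exists (lineP p q m n). split; auto. left. unfold lineP. lia.
    + exists (lineQ p q m n). split; auto. right. unfold lineQ. rewrite !EW. lia.
  - destruct (light W (mass p q (lineQ p q m n)) (4 * p * n)) eqn:L1.
    + exists (lineQ p q m n). split; auto. right. unfold lineQ. rewrite !EW. lia.
    + exists (lineQ p q m n + 1). split; auto. right. unfold lineQ. rewrite !EW. lia.
Qed.

Lemma goodV_light (m n : Z) : goodV p q m n = true ->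
  exists b, light W (mass p q b) (4 * p * m) = true /\
    (n * W <= b * W - 2 * p * m <= (n + 1) * W \/
     n * W <= b * W - 2 * q * m <= (n + 1) * W).
Proof.
  destruct Hpar as [[Hp Hpq] _].
  destruct (slack_spec p q Hp Hpq m) as [Bs Es]. fold W in Bs, Es.
  assert (EW : forall x, 2 * q * x = 2 * W * x - 2 * p * x) by (intros; unfold W; ring).
  unfold goodV. fold W. intros G.
  destruct (light W (mass p q (lineP p q m n)) (4 * p * m)) eqn:L1.
  - exists (lineP p q m n). split; auto. left. unfold lineP. lia.
  - exists (lineQ p q m n). split; auto. right. unfold lineQ. rewrite !EW. lia.
Qed.

(** Strict inequalities for b make it one of the candidates of [goodH], and darkness of all other
    lines on the closed edge settles the other candidate, whichever branch applies. *)
Lemma goodH_isolated (m n b : Z) :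
  light W (mass p q b) (4 * p * n) = true ->
  2 * q * m < (b - n) * W < 2 * q * (m + 1) ->
  (forall b', 2 * p * m <= (b' - n) * W <= 2 * p * (m + 1) ->
     light W (mass p q b') (4 * p * n) = false) ->
  (forall b', b' <> b -> 2 * q * m <= (b' - n) * W <= 2 * q * (m + 1) ->
     light W (mass p q b') (4 * p * n) = false) ->
  goodH p q m n = true.
Proof.
  intros L Hb DP DQ. destruct Hpar as [[Hp Hpq] _].
  destruct (slack_spec p q Hp Hpq m) as [Bs Es]. fold W in Bs, Es.
  assert (EW : forall x, 2 * q * x = 2 * W * x - 2 * p * x) by (intros; unfold W; ring).
  assert (Off : (b - n) * W - 2 * q * m = (b - n - 2 * m + ceilP p q m) * W - slack p q m)
    by (rewrite !EW; lia).
  unfold goodH. fold W.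
  destruct (Z.ltb_spec (slack p q m) (2 * p)) as [S|S].
  - assert (b - n - 2 * m + ceilP p q m = 1) by nia.
    replace (lineQ p q m n) with b by (unfold lineQ; lia).
    rewrite L, DP; auto. unfold lineP. lia.
  - assert (C : b - n - 2 * m + ceilP p q m = 1 \/ b - n - 2 * m + ceilP p q m = 2) by nia.
    destruct C as [C|C].
    + replace (lineQ p q m n) with b by (unfold lineQ; lia).
      rewrite L, DQ; auto; [lia|]. rewrite !EW. replace (b + 1) with (n + 2 * m - ceilP p q m + 2) by lia. lia.
    + replace (lineQ p q m n + 1) with b by (unfold lineQ; lia).
      replace (lineQ p q m n) with (b - 1) by (unfold lineQ; lia).
      rewrite L, DQ; auto; [lia|]. rewrite !EW. replace (b - 1) with (n + 2 * m - ceilP p q m + 1) by lia. lia.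
Qed.

Definition countH (n : Z) : nat := length (filter (fun m => goodH p q m n) (Zrange W)).
Definition countV (m : Z) : nat := length (filter (fun n => goodV p q m n) (Zrange W)).

(* The block side at height [n] seen through the intercepts of the P-lines
   (nonnegative) and of the Q-lines (nonpositive) is a circle of length 2W, so
   every class mod W is met exactly twice. *)
Lemma countH_le (c n : Z) : (W | n - c * al) -> 2 * Z.abs c < W ->
  (countH n <= 2 * Z.to_nat (Z.abs c))%nat.
Proof.
  intros Hn Hc. pose proof W_pos_Z as HW. destruct Hpar as [[Hp Hpq] _].
  assert (EW : W = p + q) by reflexivity.
  set (r := fun d => (d * al + 2 * q) mod W).
  set (L := map (fun d => r d - 2 * q) (offsets c) ++ map (fun d => r d - 2 * q + W) (offsets c)).
  replace (2 * Z.to_nat (Z.abs c))%nat with (length L).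
  2:{ unfold L. rewrite length_app, !length_map, length_offsets. lia. }
  assert (InL : forall x d, In d (offsets c) -> (W | x - d * al) -> - 2 * q <= x < 2 * p -> In x L).
  { intros x d Hd [k Hk] Hx. unfold L. apply in_app_iff.
    assert (B : 0 <= r d < W) by (apply Z.mod_pos_bound; lia).
    assert (E : exists j, x = r d - 2 * q + j * W).
    { exists (k + (d * al + 2 * q) / W).
      pose proof (Z.div_mod (d * al + 2 * q) W ltac:(lia)). fold (r d) in H. lia. }
    destruct E as [j E].
    assert (j = 0 \/ j = 1) as [-> | ->] by nia.
    - left. apply in_map_iff. exists d. split; auto. lia.
    - right. apply in_map_iff. exists d. split; auto. lia. }
  unfold countH.
  apply pigeonhole_rel with (R := fun m x =>
     (0 <= x /\ 2 * p * m <= x * W <= 2 * p * (m + 1)) \/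
     (x <= 0 /\ 2 * q * m <= - x * W <= 2 * q * (m + 1))).
  - apply NoDup_filter, NoDup_Zrange.
  - intros m Hm. apply filter_In in Hm. destruct Hm as [Hm G]. apply in_Zrange in Hm.
    destruct (goodH_light m n G) as [b [Lb Wb]].
    apply (light_on_line c n b Hn Hc) in Lb. destruct Lb as [d [Hd [k Hk]]].
    destruct Wb as [Wb|Wb].
    (* The value 2p is just outside the half-open window from -2q to 2p. It is the crossing at the
       right end of the block, where a Q-line of relative intercept 2q also passes; hence the code
       -2q, congruent to 2p. *)
    + destruct (Z.eq_dec (b - n) (2 * p)) as [E|E].
      * exists (- 2 * q). split.
        -- apply InL with d; auto; [exists (k - 2); lia | lia].
        -- right. split; [lia|]. assert (m = W - 1) by nia. subst m. nia.
      * exists (b - n). split; [|left; split; [nia|exact Wb]].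
        apply InL with d; auto; [exists k; lia|]. nia.
    + exists (- (b - n)). split; [|right; split; [nia|]].
      (* Q-intercepts are coded with a minus sign; the set of offsets is symmetric, so the class
         stays admissible. *)
      * apply InL with (- d).
        -- apply in_offsets in Hd. apply in_offsets. split; [lia|].
           destruct Hd as [_ [y Hy]]. exists (y - d). lia.
        -- exists (- k). lia.
        -- nia.
      * replace (- - (b - n)) with (b - n) by ring. exact Wb.
  (* A crossing shared by edges m < m' lies at the integer abscissa m', which forces W to divide m';
     this is impossible inside the block. *)
  - assert (Key : forall m m' x a, 0 < a -> rel_prime W a -> 0 <= m < W -> 0 <= m' < W ->
       a * m <= x * W <= a * (m + 1) -> a * m' <= x * W <= a * (m' + 1) -> ~ m < m').
    { intros m m' x a Ha Ra Hm Hm' H1 H2 Lt.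
      assert (x * W = a * m') by nia.
      assert (D : (W | m')) by (apply Gauss with a; auto; exists x; lia).
      apply Z.divide_pos_le in D; lia. }
    assert (R2p : rel_prime W (2 * p)) by apply W_rel_prime_2p.
    assert (R2q : rel_prime W (2 * q)).
    { apply rel_prime_sym in R2p. destruct (rel_prime_bezout _ _ R2p) as [u v H].
      apply bezout_rel_prime. apply Bezout_intro with (u := v + 2 * u) (v := - u). lia. }
    intros m m' x Hm Hm'. apply filter_In in Hm, Hm'. destruct Hm as [Hm _], Hm' as [Hm' _].
    apply in_Zrange in Hm, Hm'.
    intros [[H1 H2]|[H1 H2]] [[H3 H4]|[H3 H4]].
    + destruct (Z.lt_total m m') as [Lt|[Eq|Lt]]; auto; exfalso; revert Lt;
        apply Key with x (2 * p); auto; lia.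
    + assert (x = 0) by lia. subst x. nia.
    + assert (x = 0) by lia. subst x. nia.
    + destruct (Z.lt_total m m') as [Lt|[Eq|Lt]]; auto; exfalso; revert Lt;
        apply Key with (- x) (2 * q); auto; lia.
Qed.

(** Intercepts in one class modulo W differ by multiples of W, the height of the block. So every
    offset contributes at most one P-crossing and one Q-crossing. *)
Lemma countV_le (c m : Z) : (W | m - c * al) -> 2 * Z.abs c < W ->
  (countV m <= 2 * Z.to_nat (Z.abs c))%nat.
Proof.
  intros Hm Hc. pose proof W_pos_Z as HW. destruct Hpar as [[Hp Hpq] _].
  destruct (Z.eq_dec c 0) as [C0|C0].
  { unfold countV. rewrite (filter_ext_in _ (fun _ => false)).
    - clear. induction (Zrange W); cbn; lia.
    - intros n _. destruct (goodV p q m n) eqn:G; auto.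
      destruct (goodV_light m n G) as [b [L _]].
      apply (light_on_line c m b Hm Hc) in L. destruct L as [d [Hd _]].
      apply in_offsets in Hd. lia. }
  assert (ND : ~ (W | m)).
  { intros [x Hx]. destruct Hm as [y Hy].
    assert (D : (W | c)) by (apply divide_al; exists (x - y); lia).
    apply Z.divide_abs_r in D. apply Z.divide_pos_le in D; lia. }
  assert (EW : W = p + q) by reflexivity.
  set (L := map (fun d => (true, d)) (offsets c) ++ map (fun d => (false, d)) (offsets c)).
  replace (2 * Z.to_nat (Z.abs c))%nat with (length L).
  2:{ unfold L. rewrite length_app, !length_map, length_offsets. lia. }
  unfold countV.
  apply pigeonhole_rel with (R := fun n (x : bool * Z) => exists b, (W | b - m - snd x * al) /\
     n * W <= b * W - 2 * (if fst x then p else q) * m <= (n + 1) * W).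
  - apply NoDup_filter, NoDup_Zrange.
  - intros n Hn. apply filter_In in Hn. destruct Hn as [Hn G].
    destruct (goodV_light m n G) as [b [Lb Wb]].
    apply (light_on_line c m b Hm Hc) in Lb. destruct Lb as [d [Hd D]].
    destruct Wb as [Wb|Wb]; [exists (true, d)|exists (false, d)]; (split; [|exists b; split; auto]);
      unfold L; apply in_app_iff; [left|right]; apply in_map_iff; exists d; auto.
  - intros n n' [t d] Hn Hn' [b [[k Hk] B]] [b' [[k' Hk'] B']]. cbn [fst snd] in *.
    apply filter_In in Hn, Hn'. destruct Hn as [Hn _], Hn' as [Hn' _].
    apply in_Zrange in Hn, Hn'.
    set (a := if t then p else q) in *.
    (* No crossing has integral height, so none is shared by two edges or lies on the border of the
       block. *)
    assert (NE : forall i, 2 * a * m <> i * W).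
    { intros i E. apply ND. apply divide_2p. destruct t; cbn in a; subst a.
      - exists i. lia.
      - exists (2 * m - i). replace (2 * p * m) with (2 * W * m - 2 * q * m) by lia. lia. }
    assert (Eb : b - b' = (k - k') * W) by lia.
    assert (k = k').
    { destruct (Z.lt_total k k') as [Lt|[Eq|Lt]]; auto; exfalso.
      - assert (b + W <= b') by nia. apply (NE b). nia.
      - assert (b' + W <= b) by nia. apply (NE b'). nia. }
    subst k'. assert (b = b') by lia. subst b'.
    destruct (Z.lt_total n n') as [Lt|[Eq|Lt]]; auto; exfalso.
    + apply (NE (b - n')). nia.
    + apply (NE (b - n)). nia.
Qed.

End Capacity.

(** * Invariance under the block lattice *)

Section Translation.
Local Open Scope Z_scope.
Variables p q : Z.
Hypothesis Hpar : param p q.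
Let W := p + q.

Lemma slack_block (m a : Z) : slack p q (m + a * (p + q)) = slack p q m.
Proof.
  unfold slack. replace (- (2 * p * (m + a * (p + q)))) with
    (- (2 * p * m) + (- (2 * p * a)) * (p + q)) by ring.
  apply Z_mod_plus_full.
Qed.

Lemma ceilP_block (m a : Z) : ceilP p q (m + a * (p + q)) = ceilP p q m + 2 * p * a.
Proof.
  destruct Hpar as [[Hp Hpq] _].
  unfold ceilP. replace (- (2 * p * (m + a * (p + q)))) with
    (- (2 * p * m) + (- (2 * p * a)) * (p + q)) by ring.
  rewrite Z_div_plus_full by lia. lia.
Qed.

Lemma light_block (h h' b b' i j : Z) : h' = h + 2 * W * i -> p * b' = p * b + W * j ->
  light W (mass p q b') h' = light W (mass p q b) h.
Proof.
  intros -> E. destruct Hpar as [[Hp Hpq] _].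
  replace (mass p q b') with (mass p q b + 2 * W * j) by (unfold mass; lia).
  apply light_shift. unfold W. lia.
Qed.

(** A horizontal shift by a W moves P-intercepts by 2pa and masses by 4p^2 a, a multiple of 2W only
    if W divides a; hence the horizontal step W^2. Vertically W suffices, since it changes masses by
    2pW. *)
Lemma goodH_block (m n a b : Z) :
  goodH p q (m + a * (p + q) * (p + q)) (n + b * (p + q)) = goodH p q m n.
Proof.
  unfold goodH, lineP, lineQ. rewrite slack_block, ceilP_block.
  destruct (_ <? _); f_equal;
    first [ apply light_block with (i := 2 * p * b) (j := p * (b + 2 * p * a)); unfold W; ring
          | apply light_block with (i := 2 * p * b) (j := p * (b + 2 * q * a)); unfold W; ring ].
Qed.

Lemma goodV_block (m n a b : Z) :
  goodV p q (m + a * (p + q) * (p + q)) (n + b * (p + q)) = goodV p q m n.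
Proof.
  unfold goodV, lineP, lineQ. rewrite ceilP_block.
  f_equal; [apply light_block with (i := 2 * p * a * (p + q)) (j := p * (b + 2 * p * a))
   | apply light_block with (i := 2 * p * a * (p + q)) (j := p * (b + 2 * q * a))]; unfold W; ring.
Qed.
End Translation.

(** * Rooms and components *)

Section Parity.
Local Open Scope Z_scope.

Fixpoint count (g : Z -> bool) (x : Z) (n : nat) : nat :=
  match n with O => O | S n => (Nat.b2n (g x) + count g (x + 1) n)%nat end.

Lemma count_ext (g g' : Z -> bool) (x : Z) (n : nat) :
  (forall y, x <= y < x + Z.of_nat n -> g y = g' y) -> count g x n = count g' x n.
Proof.
  revert x. induction n as [|n IH]; intros x H; cbn [count]; auto.
  rewrite H by lia. rewrite (IH (x + 1)); auto. intros y Hy. apply H. lia.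
Qed.

Lemma count_false (g : Z -> bool) (x : Z) (n : nat) :
  (forall y, x <= y < x + Z.of_nat n -> g y = false) -> count g x n = 0%nat.
Proof.
  intros H. rewrite (count_ext g (fun _ => false)); auto.
  clear. revert x. induction n as [|n IH]; intros x; cbn [count]; auto. cbn. apply IH.
Qed.

Lemma count_zero (g : Z -> bool) (x : Z) (n : nat) :
  count g x n = 0%nat -> forall y, x <= y < x + Z.of_nat n -> g y = false.
Proof.
  revert x. induction n as [|n IH]; intros x H y Hy; [lia|]. cbn [count] in H.
  destruct (Z.eq_dec y x) as [->|Ne].
  - destruct (g x); [cbn in H; lia|reflexivity].
  - apply (IH (x + 1)); lia.
Qed.

Lemma count_app (g : Z -> bool) (x : Z) (n n' : nat) :
  count g x (n + n') = (count g x n + count g (x + Z.of_nat n) n')%nat.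
Proof.
  revert x. induction n as [|n IH]; intros x; cbn [count Nat.add].
  - f_equal. lia.
  - rewrite IH. replace (x + 1 + Z.of_nat n) with (x + Z.of_nat (S n)) by lia. lia.
Qed.

Lemma count_filter (g : Z -> bool) (n : Z) :
  length (filter g (Zrange n)) = count g 0 (Z.to_nat n).
Proof.
  unfold Zrange. generalize (Z.to_nat n) as k. intros k.
  change 0 with (Z.of_nat 0). generalize 0%nat as s.
  induction k as [|k IH]; intros s; cbn [seq map filter count]; auto.
  replace (Z.of_nat s + 1) with (Z.of_nat (S s)) by lia.
  rewrite <- IH. destruct (g (Z.of_nat s)); reflexivity.
Qed.

Lemma count_even_pair (g : Z -> bool) (x y : Z) (n k : nat) :
  count g x n = (2 * k)%nat -> x <= y < x + Z.of_nat n -> g y = true ->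
  exists y', x <= y' < x + Z.of_nat n /\ y' <> y /\ g y' = true.
Proof.
  intros E Hy Gy. apply NNPP. intros NE.
  assert (U : forall y', x <= y' < x + Z.of_nat n -> y' <> y -> g y' = false).
  { intros y' H1 H2. destruct (g y') eqn:G; auto. exfalso. apply NE. exists y'. auto. }
  set (i := Z.to_nat (y - x)).
  replace n with (i + S (n - i - 1))%nat in E by lia.
  rewrite count_app in E. cbn [count] in E.
  replace (x + Z.of_nat i) with y in E by lia.
  rewrite Gy, !count_false in E; cbn [Nat.b2n] in E; [lia| |].
  - intros z Hz. apply U; lia.
  - intros z Hz. apply U; lia.
Qed.

(** * Parity on the boundary of a rectangle *)

Section Stokes.
Variables gH gV : Z -> Z -> bool.
Definition square_even (m n : Z) : Prop :=
  xorb (xorb (gH m n) (gH m (n + 1))) (xorb (gV m n) (gV (m + 1) n)) = false.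

Lemma column_boundary_even (m n : Z) (h : nat) :
  (forall j, n <= j < n + Z.of_nat h -> square_even m j) ->
  exists k, (Nat.b2n (gH m n) + Nat.b2n (gH m (n + Z.of_nat h)) +
             count (gV m) n h + count (gV (m + 1)) n h = 2 * k)%nat.
Proof.
  revert n. induction h as [|h IH]; intros n H; cbn [count].
  - replace (n + Z.of_nat 0) with n by lia. exists (Nat.b2n (gH m n)). lia.
  - destruct (IH (n + 1)) as [k Hk]; [intros j Hj; apply H; lia|].
    replace (n + 1 + Z.of_nat h) with (n + Z.of_nat (S h)) in Hk by lia.
    pose proof (H n ltac:(lia)) as Sq. unfold square_even in Sq.
    assert (E : exists i, (Nat.b2n (gH m n) + Nat.b2n (gH m (n + 1)) + Nat.b2n (gV m n)
        + Nat.b2n (gV (m + 1) n) = 2 * i)%nat).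
    { destruct (gH m n), (gH m (n + 1)), (gV m n), (gV (m + 1) n); try discriminate;
        cbn; [exists 2%nat | exists 1%nat | exists 1%nat | exists 1%nat | exists 1%nat
              | exists 1%nat | exists 1%nat | exists 0%nat]; reflexivity. }
    destruct E as [i Hi]. exists (i + k - Nat.b2n (gH m (n + 1)))%nat. lia.
Qed.

(** Stokes modulo 2: summing the parity of all unit squares counts every interior edge twice. *)
Lemma rect_boundary_even (m n : Z) (w h : nat) :
  (forall i j, m <= i < m + Z.of_nat w -> n <= j < n + Z.of_nat h -> square_even i j) ->
  exists k, (count (fun i => gH i n) m w + count (fun i => gH i (n + Z.of_nat h)) m w +
             count (gV m) n h + count (gV (m + Z.of_nat w)) n h = 2 * k)%nat.
Proof.
  revert m. induction w as [|w IH]; intros m H; cbn [count].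
  - replace (m + Z.of_nat 0) with m by lia. exists (count (gV m) n h). lia.
  - destruct (IH (m + 1)) as [k Hk]; [intros i j Hi Hj; apply H; lia|].
    replace (m + 1 + Z.of_nat w) with (m + Z.of_nat (S w)) in Hk by lia.
    destruct (column_boundary_even m n h) as [i Hi]; [intros j Hj; apply H; lia|].
    exists (i + k - count (gV (m + 1)) n h)%nat. lia.
Qed.
End Stokes.

Fixpoint nsum (f : nat -> nat) (n : nat) : nat :=
  match n with O => O | S n => (nsum f n + f n)%nat end.

Lemma nsum_ext (f g : nat -> nat) (n : nat) :
  (forall i, (i < n)%nat -> f i = g i) -> nsum f n = nsum g n.
Proof. induction n; cbn; intros H; auto. rewrite IHn, H; auto. Qed.

Lemma nsum_plus (f g : nat -> nat) (n : nat) :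
  nsum (fun i => f i + g i)%nat n = (nsum f n + nsum g n)%nat.
Proof. induction n; cbn; lia. Qed.

Lemma nsum_zero (n : nat) : nsum (fun _ => 0%nat) n = 0%nat.
Proof. induction n; cbn; lia. Qed.

Lemma nsum_swap (f : nat -> nat -> nat) (n n' : nat) :
  nsum (fun i => nsum (f i) n') n = nsum (fun j => nsum (fun i => f i j) n) n'.
Proof.
  induction n; cbn.
  - symmetry. apply nsum_zero.
  - rewrite IHn. symmetry. apply nsum_plus.
Qed.

Lemma nsum_ge (f : nat -> nat) (c n : nat) :
  (forall i, (i < n)%nat -> (c <= f i)%nat) -> (n * c <= nsum f n)%nat.
Proof.
  induction n; cbn; intros H; [lia|]. specialize (IHn ltac:(auto)).
  specialize (H n ltac:(lia)). lia.
Qed.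

Lemma nsum_shift (f : nat -> nat) (n : nat) :
  (nsum (fun i => f (S i)) n + f 0 = nsum f n + f n)%nat.
Proof. induction n; cbn; lia. Qed.

Section Rooms.
Variables (gH gV : Z -> Z -> bool) (x : nat -> Z) (R : nat).
Hypothesis x_incr : forall i, (i < R)%nat -> x i < x (S i).
Hypothesis x_first : x 0%nat = 0.
Hypothesis even_squares : forall m n, square_even gH gV m n.
Hypothesis wallH : forall m, gH m 0 = false /\ gH m (x R) = false.
Hypothesis wallV : forall n, gV 0 n = false /\ gV (x R) n = false.

Let len i := Z.to_nat (x (S i) - x i).
Let TH y := count (fun m => gH m y) 0 (Z.to_nat (x R)).
Let TV y := count (gV y) 0 (Z.to_nat (x R)).

Lemma count_subdivide (g : Z -> bool) (k : nat) : (k <= R)%nat ->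
  0 <= x k /\ nsum (fun i => count g (x i) (len i)) k = count g 0 (Z.to_nat (x k)).
Proof.
  induction k as [|k IH]; intros Hk; cbn [nsum].
  - rewrite x_first. split; [lia|reflexivity].
  - destruct IH as [P E]; [lia|]. pose proof (x_incr k ltac:(lia)).
    split; [lia|]. rewrite E.
    replace (Z.to_nat (x (S k))) with (Z.to_nat (x k) + len k)%nat by (unfold len; lia).
    rewrite count_app. do 2 f_equal. lia.
Qed.

Let room i j := (count (fun m => gH m (x j)) (x i) (len i) +
  count (fun m => gH m (x (S j))) (x i) (len i) +
  count (gV (x i)) (x j) (len j) + count (gV (x (S i))) (x j) (len j))%nat.

(* Every segment on a dividing line bounds two of the [R * R] rooms, so if there
   are fewer than [R * R] good ones some room has fewer than two good boundary
   segments, hence none by parity. *)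
Lemma exists_empty_room :
  (nsum (fun j => TH (x j)) R + nsum (fun j => TV (x j)) R < R * R)%nat ->
  exists i j, (i < R)%nat /\ (j < R)%nat /\
    (forall m, x i <= m < x (S i) -> gH m (x j) = false /\ gH m (x (S j)) = false) /\
    (forall n, x j <= n < x (S j) -> gV (x i) n = false /\ gV (x (S i)) n = false).
Proof.
  intros Few.
  assert (Small : exists i j, (i < R)%nat /\ (j < R)%nat /\ (room i j < 2)%nat).
  { apply NNPP. intros N.
    assert (Big : forall i j, (i < R)%nat -> (j < R)%nat -> (2 <= room i j)%nat).
    { intros i j Hi Hj. apply Nat.nlt_ge. intros L. apply N. exists i, j. auto. }
    assert (Tot : (R * (R * 2) <= nsum (fun i => nsum (room i) R) R)%nat).
    { apply nsum_ge. intros i Hi. apply nsum_ge. intros j Hj. auto. }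
    assert (EH : nsum (fun i => nsum (fun j => count (fun m => gH m (x j)) (x i) (len i)) R) R
              = nsum (fun j => TH (x j)) R).
    { rewrite nsum_swap. apply nsum_ext. intros j Hj. apply count_subdivide. lia. }
    assert (EH' : nsum (fun i => nsum (fun j => count (fun m => gH m (x (S j))) (x i) (len i)) R) R
              = nsum (fun j => TH (x (S j))) R).
    { rewrite nsum_swap. apply nsum_ext. intros j Hj. apply count_subdivide. lia. }
    assert (EV : nsum (fun i => nsum (fun j => count (gV (x i)) (x j) (len j)) R) R
              = nsum (fun j => TV (x j)) R).
    { apply nsum_ext. intros j Hj. apply count_subdivide. lia. }
    assert (EV' : nsum (fun i => nsum (fun j => count (gV (x (S i))) (x j) (len j)) R) R
              = nsum (fun j => TV (x (S j))) R).
    { apply nsum_ext. intros j Hj. apply count_subdivide. lia. }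
    assert (Sum : nsum (fun i => nsum (room i) R) R =
      (nsum (fun j => TH (x j)) R + nsum (fun j => TH (x (S j))) R +
       nsum (fun j => TV (x j)) R + nsum (fun j => TV (x (S j))) R)%nat).
    { rewrite <- EH, <- EH', <- EV, <- EV', <- !nsum_plus. apply nsum_ext. intros i Hi.
      rewrite <- !nsum_plus. reflexivity. }
    (* The first and last lines carry nothing, so replacing x j by x (S j) leaves the sums
       unchanged. The rooms together then count each total exactly twice, against at least 2 per
       room. *)
    pose proof (nsum_shift (fun j => TH (x j)) R) as SH.
    pose proof (nsum_shift (fun j => TV (x j)) R) as SV. cbn beta in SH, SV.
    assert (Z0 : TH (x 0%nat) = 0%nat /\ TH (x R) = 0%nat /\ TV (x 0%nat) = 0%nat /\ TV (x R) = 0%nat).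
    { rewrite x_first. unfold TH, TV.
      repeat split; apply count_false; intros; first [apply wallH | apply wallV]. }
    lia. }
  destruct Small as (i & j & Hi & Hj & L). exists i, j. do 2 (split; auto).
  pose proof (x_incr i Hi). pose proof (x_incr j Hj).
  destruct (rect_boundary_even gH gV (x i) (x j) (len i) (len j)) as [k Hk].
  { intros; apply even_squares. }
  assert (Ei : x i + Z.of_nat (len i) = x (S i)) by (unfold len; lia).
  assert (Ej : x j + Z.of_nat (len j) = x (S j)) by (unfold len; lia).
  rewrite Ei, Ej in Hk. unfold room in L.
  split; intros y Hy; split.
  - apply (count_zero (fun m => gH m (x j)) (x i) (len i)); lia.
  - apply (count_zero (fun m => gH m (x (S j))) (x i) (len i)); lia.
  - apply (count_zero (gV (x i)) (x j) (len j)); lia.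
  - apply (count_zero (gV (x (S i))) (x j) (len j)); lia.
Qed.
End Rooms.

Lemma exists_sorted (l : list Z) : exists l', Permutation l l' /\ StronglySorted Z.le l'.
Proof.
  induction l as [|a l [l' [P S]]].
  - exists nil. split; constructor.
  - assert (Ins : exists l'', Permutation (a :: l') l'' /\ StronglySorted Z.le l'').
    { clear P. induction S as [|b l' S IH F].
      - exists (a :: nil). split; auto. repeat constructor.
      - destruct (Z_le_gt_dec a b).
        + exists (a :: b :: l'). split; auto. constructor; [constructor; auto|].
          constructor; auto. eapply Forall_impl; [|exact F]. cbn. intros; lia.
        + destruct IH as [l'' [P' S']]. exists (b :: l''). split.
          * rewrite perm_swap. constructor. exact P'.
          * constructor; auto. apply (Permutation_Forall P'). constructor; auto. lia. }
    destruct Ins as [l'' [P' S']]. exists l''. split; auto. rewrite <- P'. constructor. exact P.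
Qed.

Lemma sorted_nth (l : list Z) (d : Z) : StronglySorted Z.le l ->
  forall i j, (i <= j < length l)%nat -> nth i l d <= nth j l d.
Proof.
  induction 1 as [|a l S IH F]; intros i j H; cbn in H; [lia|].
  destruct i, j; cbn; try lia.
  - apply (proj1 (Forall_forall _ _) F). apply nth_In. lia.
  - apply IH. lia.
Qed.

Lemma nsum_list (f : Z -> nat) (l : list Z) (d : Z) :
  nsum (fun i => f (nth i l d)) (length l) = list_sum (map f l).
Proof.
  induction l as [|a l IH] using rev_ind; auto.
  rewrite length_app, map_app, list_sum_app, <- IH, Nat.add_1_r. cbn [nsum map list_sum fold_right].
  rewrite nth_middle with (l' := nil). f_equal; [|lia].
  apply nsum_ext. intros i Hi. rewrite app_nth1; auto.
Qed.
End Parity.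

Section Rooms_of_lines.
Local Open Scope Z_scope.
Variables p q al : Z.
Hypothesis Hpar : param p q.
Hypothesis Htune : tune p q al.
Let W := p + q.

(** This is the class c = 0, whose list of offsets is empty. *)
Lemma goodH_wall (m n : Z) : (W | n) -> goodH p q m n = false.
Proof.
  intros D. destruct (goodH p q m n) eqn:G; auto.
  destruct (goodH_light p q Hpar m n G) as [b [L _]].
  apply (light_on_line p q al Hpar Htune 0 n b) in L.
  - destruct L as [d [[] _]].
  - replace (n - 0 * al) with n by ring. exact D.
  - pose proof (W_pos_Z p q Hpar). lia.
Qed.

Lemma goodV_wall (m n : Z) : (W | m) -> goodV p q m n = false.
Proof.
  intros D. destruct (goodV p q m n) eqn:G; auto.
  destruct (goodV_light p q Hpar m n G) as [b [L _]].
  apply (light_on_line p q al Hpar Htune 0 m b) in L.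
  - destruct L as [d [[] _]].
  - replace (m - 0 * al) with m by ring. exact D.
  - pose proof (W_pos_Z p q Hpar). lia.
Qed.

Lemma squares_even (m n : Z) : square_even (goodH p q) (goodV p q) m n.
Proof.
  destruct Hpar as [[Hp Hpq] [Hodd _]]. apply degree_even; auto.
Qed.

Definition classes (K : nat) : list Z := map (fun i => i - Z.of_nat K) (Zrange (2 * Z.of_nat K + 1)).

Lemma in_classes (K : nat) (c : Z) : In c (classes K) <-> Z.abs c <= Z.of_nat K.
Proof.
  unfold classes. rewrite in_map_iff. split.
  - intros [i [<- H]]. apply in_Zrange in H. lia.
  - intros H. exists (c + Z.of_nat K). rewrite in_Zrange. lia.
Qed.

Lemma sum_classes (K : nat) :
  list_sum (map (fun c => 2 * Z.to_nat (Z.abs c))%nat (classes K)) = (2 * K * (K + 1))%nat.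
Proof.
  unfold classes. rewrite map_map.
  unfold Zrange. rewrite map_map.
  replace (Z.to_nat (2 * Z.of_nat K + 1)) with (K + S K)%nat by lia.
  rewrite seq_app, map_app, list_sum_app.
  assert (A : forall n, (n <= K)%nat -> (list_sum (map (fun i => 2 * Z.to_nat (Z.abs (Z.of_nat i - Z.of_nat K))) (seq 0 n)) + n * n = n * (2 * K + 1))%nat).
  { induction n as [|n IH]; intros Hn; [reflexivity|].
    rewrite seq_S, map_app, list_sum_app. cbn [map list_sum fold_right Nat.add].
    specialize (IH ltac:(lia)). nia. }
  assert (B : forall n, list_sum (map (fun i => 2 * Z.to_nat (Z.abs (Z.of_nat i - Z.of_nat K)))%nat (seq (0 + K) (S n))) = (n * (n + 1))%nat).
  { induction n as [|n IH]; [cbn; rewrite Z.sub_diag; reflexivity|].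
    rewrite seq_S, map_app, list_sum_app, IH. cbn [map list_sum fold_right Nat.add]. nia. }
  rewrite B. specialize (A K ltac:(lia)). nia.
Qed.

(** The capacities 2|c| over |c| <= K add up to 2K(K + 1) in each direction, together 4K(K + 1) =
    (2K + 1)^2 - 1, one less than the number of rooms. The gap clauses say that no further dividing
    line runs through the room, which later bounds its size. *)
Lemma empty_room (K : nat) : 2 * Z.of_nat K < W ->
  exists x1 x2 y1 y2,
    (forall z, In z (x1 :: x2 :: y1 :: y2 :: nil) -> 0 <= z <= W /\
       exists c, Z.abs c <= Z.of_nat K /\ (W | z - c * al)) /\
    x1 < x2 /\ y1 < y2 /\
    (forall c z, Z.abs c <= Z.of_nat K -> (W | z - c * al) -> ~ x1 < z < x2) /\
    (forall c z, Z.abs c <= Z.of_nat K -> (W | z - c * al) -> ~ y1 < z < y2) /\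
    (forall m, x1 <= m < x2 -> goodH p q m y1 = false /\ goodH p q m y2 = false) /\
    (forall n, y1 <= n < y2 -> goodV p q x1 n = false /\ goodV p q x2 n = false).
Proof.
  intros HK. assert (HW : 0 < W) by lia.
  set (pos := fun c => (c * al) mod W).
  assert (Pos : forall c, 0 <= pos c < W /\ (W | pos c - c * al)).
  { intros c. split; [apply Z.mod_pos_bound; lia|].
    exists (- (c * al / W)). unfold pos. pose proof (Z.div_mod (c * al) W ltac:(lia)). lia. }
  assert (PosU : forall c z, (W | z - c * al) -> 0 <= z < W -> z = pos c).
  { intros c z [k Hk] Hz. unfold pos. apply Z.mod_unique with (- k); lia. }
  assert (ND : NoDup (map pos (classes K))).
  { apply NoDup_map_NoDup_ForallPairs.
    - intros c c' Hc Hc' E. apply in_classes in Hc, Hc'.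
      destruct (Pos c) as [_ [k Hk]], (Pos c') as [_ [k' Hk']].
      assert (D : (W | c - c')).
      { apply (divide_al p q al Htune). exists (k' - k). unfold W in *. nia. }
      destruct D as [i Hi]. assert (i = 0) by nia. lia.
    - apply FinFun.Injective_map_NoDup; [|apply NoDup_Zrange]. intros u v. lia. }
  destruct (exists_sorted (map pos (classes K))) as [l [Pl Sl]].
  set (R := length l).
  assert (ER : R = (2 * K + 1)%nat).
  { unfold R. rewrite <- (Permutation_length Pl), length_map. unfold classes.
    rewrite length_map, length_Zrange. lia. }
  (* The default W supplies the last dividing line: x R is the far wall, which is not in the list
     because positions are residues below W. *)
  set (x := fun i => nth i l W).
  assert (xIn : forall i, (i < R)%nat -> exists c, Z.abs c <= Z.of_nat K /\ x i = pos c).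
  { intros i Hi. assert (I : In (x i) l) by (apply nth_In; exact Hi).
    apply (Permutation_in _ (Permutation_sym Pl)), in_map_iff in I.
    destruct I as [c [E I]]. exists c. apply in_classes in I. auto. }
  assert (xR : x R = W) by (apply nth_overflow; lia).
  assert (xBound : forall i, (i <= R)%nat -> 0 <= x i <= W /\
       exists c, Z.abs c <= Z.of_nat K /\ (W | x i - c * al)).
  { intros i Hi. destruct (Nat.eq_dec i R) as [->|Ne].
    - rewrite xR. split; [lia|]. exists 0. split; [lia|]. exists 1. lia.
    - destruct (xIn i) as [c [Hc ->]]; [lia|]. destruct (Pos c). split; [lia|]. exists c. auto. }
  assert (xIdx : forall c, Z.abs c <= Z.of_nat K -> exists i, (i < R)%nat /\ x i = pos c).
  { intros c Hc. assert (I : In (pos c) l).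
    { apply (Permutation_in _ Pl), in_map, in_classes, Hc. }
    destruct (In_nth l (pos c) W I) as [i [Hi E]]. exists i. auto. }
  assert (xIncr : forall i, (i < R)%nat -> x i < x (S i)).
  { intros i Hi. destruct (Nat.eq_dec (S i) R) as [E|Ne].
    - rewrite E, xR. destruct (xIn i Hi) as [c [_ ->]]. apply Pos.
    - assert (x i <= x (S i)) by (apply sorted_nth; auto; unfold R in *; lia).
      assert (x i <> x (S i)); [|lia]. intros E.
      assert (i = S i); [|lia].
      apply (proj1 (NoDup_nth l W) (Permutation_NoDup Pl ND)); auto; unfold R in *; lia. }
  assert (xMono : forall i j, (i <= j <= R)%nat -> x i <= x j).
  { intros i j [Hij Hj]. induction Hij as [|j Hij IH]; [lia|].
    specialize (IH ltac:(lia)). specialize (xIncr j ltac:(lia)). lia. }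
  assert (pos0 : pos 0 = 0) by (symmetry; apply PosU; [exists 0; lia | lia]).
  assert (x0 : x 0%nat = 0).
  { destruct (xIdx 0 ltac:(lia)) as [i [Hi Ei]]. rewrite pos0 in Ei.
    pose proof (xMono 0%nat i ltac:(lia)). pose proof (xBound 0%nat ltac:(lia)). lia. }
  assert (xGap : forall i c z, (i < R)%nat -> Z.abs c <= Z.of_nat K -> (W | z - c * al) ->
      ~ x i < z < x (S i)).
  { intros i c z Hi Hc D Hz.
    pose proof (xBound i ltac:(lia)) as [Bi _]. pose proof (xBound (S i) ltac:(lia)) as [Bi' _].
    rewrite (PosU c z D) in Hz by lia.
    destruct (xIdx c Hc) as [j [Hj Ej]]. rewrite <- Ej in Hz.
    destruct (Nat.le_gt_cases j i) as [L|L].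
    - pose proof (xMono j i ltac:(lia)). lia.
    - pose proof (xMono (S i) j ltac:(lia)). lia. }
  destruct (exists_empty_room (goodH p q) (goodV p q) x R) as (i & j & Hi & Hj & EH & EV); auto.
  - intros; apply squares_even.
  - intros m. rewrite xR. split; apply goodH_wall; [exists 0 | exists 1]; lia.
  - intros n. rewrite xR. split; apply goodV_wall; [exists 0 | exists 1]; lia.
  - rewrite xR.
    assert (TotH : (nsum (fun j => count (fun m => goodH p q m (x j)) 0 (Z.to_nat W)) R <= 2 * K * (K + 1))%nat).
    { unfold x, R. rewrite (nsum_list (fun y => count (fun m => goodH p q m y) 0 (Z.to_nat W))).
      rewrite <- (Permutation_list_sum (Permutation_map _ Pl)), map_map, <- sum_classes.
      clear - Pos Hpar Htune HK. assert (Hc : forall c, In c (classes K) -> Z.abs c <= Z.of_nat K) by (intros; apply in_classes; auto).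
      induction (classes K) as [|c cs IH]; cbn [map list_sum fold_right]; [lia|].
      apply Nat.add_le_mono; [|apply IH; intros; apply Hc; cbn; auto].
      rewrite <- count_filter. apply (countH_le p q al Hpar Htune c); [apply Pos|].
      specialize (Hc c (or_introl eq_refl)). fold W. lia. }
    assert (TotV : (nsum (fun j => count (goodV p q (x j)) 0 (Z.to_nat W)) R <= 2 * K * (K + 1))%nat).
    { unfold x, R. rewrite (nsum_list (fun y => count (goodV p q y) 0 (Z.to_nat W))).
      rewrite <- (Permutation_list_sum (Permutation_map _ Pl)), map_map, <- sum_classes.
      clear - Pos Hpar Htune HK. assert (Hc : forall c, In c (classes K) -> Z.abs c <= Z.of_nat K) by (intros; apply in_classes; auto).
      induction (classes K) as [|c cs IH]; cbn [map list_sum fold_right]; [lia|].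
      apply Nat.add_le_mono; [|apply IH; intros; apply Hc; cbn; auto].
      rewrite <- (count_filter (goodV p q (pos c))). apply (countV_le p q al Hpar Htune c); [apply Pos|].
      specialize (Hc c (or_introl eq_refl)). fold W. lia. }
    nia.
  - exists (x i), (x (S i)), (x j), (x (S j)). split; [|split; [|split; [|split; [|split]]]]; auto.
    + intros z [<-|[<-|[<-|[<-|[]]]]]; apply xBound; lia.
    + intros c z; apply xGap; auto.
    + intros c z; apply xGap; auto.
Qed.
End Rooms_of_lines.

(** * Combinatorial components of squares *)

Section Components.
Local Open Scope Z_scope.
Variables p q : Z.

(** Squares are named by their lower left corners, so a shared edge carries the indices of the right
    or upper square. *)
Definition adj (s t : Z * Z) : Prop :=
  (snd t = snd s /\ fst t = fst s + 1 /\ goodV p q (fst t) (snd t) = true) \/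
  (snd t = snd s /\ fst s = fst t + 1 /\ goodV p q (fst s) (snd s) = true) \/
  (fst t = fst s /\ snd t = snd s + 1 /\ goodH p q (fst t) (snd t) = true) \/
  (fst t = fst s /\ snd s = snd t + 1 /\ goodH p q (fst s) (snd s) = true).

Definition conn : Z * Z -> Z * Z -> Prop := clos_refl_trans _ adj.

Lemma adj_sym (s t : Z * Z) : adj s t -> adj t s.
Proof. unfold adj. intuition auto. Qed.

Lemma conn_sym (s t : Z * Z) : conn s t -> conn t s.
Proof.
  induction 1; [apply rt_step, adj_sym; auto | apply rt_refl | eapply rt_trans; eauto].
Qed.

Definition in_rect (x1 x2 y1 y2 : Z) (s : Z * Z) : Prop :=
  x1 <= fst s < x2 /\ y1 <= snd s < y2.

Definition empty_boundary (x1 x2 y1 y2 : Z) : Prop :=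
  (forall m, x1 <= m < x2 -> goodH p q m y1 = false /\ goodH p q m y2 = false) /\
  (forall n, y1 <= n < y2 -> goodV p q x1 n = false /\ goodV p q x2 n = false).

Lemma conn_in_rect (x1 x2 y1 y2 : Z) (s t : Z * Z) : empty_boundary x1 x2 y1 y2 ->
  conn s t -> in_rect x1 x2 y1 y2 s -> in_rect x1 x2 y1 y2 t.
Proof.
  intros [EH EV]. induction 1 as [s t A| |]; auto.
  destruct s as [m n], t as [m' n']. unfold in_rect. cbn [fst snd]. intros [Hm Hn].
  destruct A as [(E1 & E2 & G)|[(E1 & E2 & G)|[(E1 & E2 & G)|(E1 & E2 & G)]]]; cbn [fst snd] in *; subst.
  - destruct (Z.eq_dec (m + 1) x2) as [E|E]; [|lia].
    rewrite E, (proj2 (EV n Hn)) in G. discriminate.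
  - destruct (Z.eq_dec (m' + 1) x1) as [E|E]; [|lia].
    rewrite E, (proj1 (EV n Hn)) in G. discriminate.
  - destruct (Z.eq_dec (n + 1) y2) as [E|E]; [|lia].
    rewrite E, (proj2 (EH m Hm)) in G. discriminate.
  - destruct (Z.eq_dec (n' + 1) y1) as [E|E]; [|lia].
    rewrite E, (proj1 (EH m Hm)) in G. discriminate.
Qed.

Lemma adj_block (a b : Z) (s t : Z * Z) : param p q -> adj s t ->
  adj (fst s + a * (p + q) * (p + q), snd s + b * (p + q))
      (fst t + a * (p + q) * (p + q), snd t + b * (p + q)).
Proof.
  intros Hpar. unfold adj. cbn [fst snd]. rewrite !goodH_block, !goodV_block by exact Hpar.
  intuition (try lia).
Qed.

Lemma conn_block (a b : Z) (s t : Z * Z) : param p q -> conn s t ->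
  conn (fst s + a * (p + q) * (p + q), snd s + b * (p + q))
       (fst t + a * (p + q) * (p + q), snd t + b * (p + q)).
Proof.
  intros Hpar. induction 1; [apply rt_step, adj_block; auto | apply rt_refl | eapply rt_trans; eauto].
Qed.

Variable al : Z.
Hypothesis Hpar : param p q.
Hypothesis Htune : tune p q al.
Let W := p + q.

Lemma block_empty_boundary : empty_boundary 0 W 0 W.
Proof.
  split; intros; split;
    first [apply (goodH_wall p q al Hpar Htune) | apply (goodV_wall p q al Hpar Htune)];
    first [exists 0; unfold W; lia | exists 1; unfold W; lia].
Qed.

(* Apply [rect_boundary_even] above the line to the component's own segments. *)
Lemma second_crossing (m n : Z) : 0 <= m < W -> 0 <= n < W -> goodH p q m n = true ->
  exists m', 0 <= m' < W /\ m' <> m /\ goodH p q m' n = true /\ conn (m, n) (m', n).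
Proof.
  intros Hm Hn G.
  set (chi := fun i j => if excluded_middle_informative (conn (m, n) (i, j)) then true else false).
  assert (Chi : forall i j, chi i j = true <-> conn (m, n) (i, j)).
  { intros i j. unfold chi. destruct (excluded_middle_informative _); intuition discriminate. }
  assert (Step : forall i j i' j', adj (i, j) (i', j') -> chi i j = chi i' j').
  { intros i j i' j' A. apply eq_true_iff_eq. rewrite !Chi. split; intros C.
    - eapply rt_trans; [exact C | apply rt_step, A].
    - eapply rt_trans; [exact C | apply rt_step, adj_sym, A]. }
  (* Only the segments of the component are kept. A good edge has both or neither of its squares in
     the component, so weighting it by its upper or right square is unambiguous and keeps every
     square even. *)
  set (gH := fun i j => chi i j && goodH p q i j).
  set (gV := fun i j => chi i j && goodV p q i j).
  destruct (rect_boundary_even gH gV 0 n (Z.to_nat W) (Z.to_nat (W - n))) as [k Hk].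
  { intros i j _ _. unfold square_even, gH, gV.
    assert (EH : chi i (j + 1) && goodH p q i (j + 1) = chi i j && goodH p q i (j + 1)).
    { destruct (goodH p q i (j + 1)) eqn:E; [|rewrite !andb_false_r; auto].
      rewrite (Step i j i (j + 1)); auto. right; right; left. cbn. auto. }
    assert (EV : chi (i + 1) j && goodV p q (i + 1) j = chi i j && goodV p q (i + 1) j).
    { destruct (goodV p q (i + 1) j) eqn:E; [|rewrite !andb_false_r; auto].
      rewrite (Step i j (i + 1) j); auto. left. cbn. auto. }
    rewrite EH, EV. destruct (chi i j); cbn [andb]; auto.
    apply squares_even; auto. }
  assert (EW : Z.of_nat (Z.to_nat W) = W) by lia.
  replace (n + Z.of_nat (Z.to_nat (W - n))) with W in Hk by lia.
  replace (0 + Z.of_nat (Z.to_nat W)) with W in Hk by lia.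
  (* The other three sides of the rectangle lie on block walls, so the count on the line itself is
     even. *)
  rewrite (count_false (fun i => gH i W)), (count_false (gV 0)), (count_false (gV W)) in Hk.
  - destruct (count_even_pair (fun i => gH i n) 0 m (Z.to_nat W) k) as (m' & Hm' & Ne & G').
    + lia.
    + lia.
    + unfold gH. rewrite G. replace (chi m n) with true; auto.
      symmetry. apply Chi, rt_refl.
    + unfold gH in G'. apply andb_true_iff in G'. destruct G' as [C G'].
      exists m'. split; [lia|]. split; auto. split; auto. apply Chi, C.
  - intros y _. unfold gV. rewrite (goodV_wall p q al Hpar Htune); [apply andb_false_r|].
    exists 1. unfold W. lia.
  - intros y _. unfold gV. rewrite (goodV_wall p q al Hpar Htune); [apply andb_false_r|].
    exists 0. lia.
  - intros y _. unfold gH. rewrite (goodH_wall p q al Hpar Htune); [apply andb_false_r|].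
    exists 1. unfold W. lia.
Qed.
End Components.

(** * Irrational rotations *)

Section Rotation.
Variable th : R.
Hypothesis th_irr : irrational th.

Lemma irrational_comb (e i : Z) : e <> 0%Z -> IZR e * th + IZR i <> 0.
Proof.
  intros He E. apply (th_irr (- i)%Z e He). rewrite opp_IZR.
  apply Rmult_eq_reg_l with (IZR e); [|apply not_0_IZR, He].
  unfold Rdiv. rewrite (Rmult_comm (- IZR i)), <- Rmult_assoc, Rinv_r, Rmult_1_l; [lra|].
  apply not_0_IZR, He.
Qed.

(** Halving step: for a combination x in (0, 1] let N be the least integer above 1/x. Then y = N x -
    1 lies in (0, x], and one of y, x - y is at most x/2. Irrationality keeps x - y from
    vanishing. *)
Lemma small_comb_pow (n : nat) :
  exists e i, e <> 0%Z /\ 0 < IZR e * th + IZR i <= (/ 2) ^ n.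
Proof.
  induction n as [|n (e & i & He & P & B)].
  - exists (-1)%Z, (up th). split; [lia|]. pose proof (archimed th). cbn [pow]. lra.
  - set (x := IZR e * th + IZR i) in *.
    assert (B1 : x <= 1).
    { apply Rle_trans with ((/ 2) ^ n); auto. rewrite <- (pow1 n). apply pow_incr. lra. }
    destruct (archimed (/ x)) as [U1 U2]. set (N := up (/ x)) in *.
    assert (Ix : / x * x = 1) by (apply Rinv_l; lra).
    assert (HN : (1 < N)%Z).
    { apply lt_IZR. apply Rle_lt_trans with (/ x); [|lra].
      rewrite <- Rinv_1. apply Rinv_le_contravar; lra. }
    assert (Y : 0 < IZR N * x - 1 <= x) by nra.
    cbn [pow].
    destruct (Rle_dec (IZR N * x - 1) (x / 2)) as [L|L].
    + exists (N * e)%Z, (N * i - 1)%Z. split; [nia|].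
      rewrite minus_IZR, !mult_IZR.
      replace (IZR N * IZR e * th + (IZR N * IZR i - 1)) with (IZR N * x - 1) by (unfold x; ring).
      lra.
    + exists ((1 - N) * e)%Z, ((1 - N) * i + 1)%Z. split; [nia|].
      pose proof (irrational_comb ((1 - N) * e) ((1 - N) * i + 1) ltac:(nia)) as NZ.
      replace (IZR ((1 - N) * e) * th + IZR ((1 - N) * i + 1)) with (x - (IZR N * x - 1)) in *
        by (rewrite plus_IZR, !mult_IZR, minus_IZR; unfold x; ring).
      lra.
Qed.

Lemma small_comb (eps : R) : 0 < eps -> exists e i, 0 < IZR e * th + IZR i < eps.
Proof.
  intros He. destruct (pow_lt_1_zero (/ 2) ltac:(rewrite Rabs_pos_eq; lra) eps He) as [n Hn].
  specialize (Hn n (Nat.le_refl n)).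
  destruct (small_comb_pow n) as (e & i & _ & P & B). exists e, i.
  pose proof (Rle_abs ((/ 2) ^ n)). lra.
Qed.

(** A combination x smaller than half the window is used in even multiples, so that steps are
    shorter than the window and preserve the parity of d. The sign of the coefficient e decides
    whether the window is approached from below or from above; in both cases d only grows from a
    start of parity r that is at least D. *)
Lemma rotation_dense (s t : R) (D r : Z) : s < t ->
  exists d i, (D <= d)%Z /\ (exists y, d = r + 2 * y)%Z /\ s < IZR d * th - IZR i < t.
Proof.
  intros Hst. destruct (small_comb ((t - s) / 2) ltac:(lra)) as (e & i & P & B).
  set (x := IZR e * th + IZR i) in *.
  set (d0 := (r + 2 * (Z.abs r + Z.abs D))%Z).
  assert (Steps : forall v, 0 <= v -> exists k, (0 <= k)%Z /\ v < IZR k * (2 * x) <= v + 2 * x).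
  { intros v Hv. destruct (archimed (v / (2 * x))) as [U1 U2]. exists (up (v / (2 * x))).
    assert (E : v / (2 * x) * (2 * x) = v) by (field; lra).
    assert (V : 0 <= v / (2 * x)) by (apply Rmult_le_pos; [lra | left; apply Rinv_0_lt_compat; lra]).
    split; [apply le_IZR; lra|]. nra. }
  destruct (Z_le_gt_dec 0 e) as [E|E].
  - destruct (archimed (IZR d0 * th - s)) as [U1 U2]. set (j := up (IZR d0 * th - s)) in *.
    destruct (Steps (s - (IZR d0 * th - IZR j)) ltac:(lra)) as (k & Hk & K1 & K2).
    exists (d0 + 2 * e * k)%Z, (j - 2 * i * k)%Z. split; [unfold d0; nia|].
    split; [exists (Z.abs r + Z.abs D + e * k)%Z; unfold d0; ring|].
    replace (IZR (d0 + 2 * e * k) * th - IZR (j - 2 * i * k)) with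
      (IZR d0 * th - IZR j + IZR k * (2 * x))
      by (rewrite plus_IZR, minus_IZR, !mult_IZR; unfold x; ring).
    lra.
  - destruct (archimed (t - IZR d0 * th)) as [U1 U2]. set (j := up (t - IZR d0 * th)) in *.
    destruct (Steps (IZR d0 * th + IZR j - t) ltac:(lra)) as (k & Hk & K1 & K2).
    exists (d0 - 2 * e * k)%Z, (- j + 2 * i * k)%Z. split; [unfold d0; nia|].
    split; [exists (Z.abs r + Z.abs D - e * k)%Z; unfold d0; ring|].
    replace (IZR (d0 - 2 * e * k) * th - IZR (- j + 2 * i * k)) with
      (IZR d0 * th + IZR j - IZR k * (2 * x))
      by (rewrite plus_IZR, minus_IZR, opp_IZR, !mult_IZR; unfold x; ring).
    lra.
Qed.

Lemma rotation_many (s t : R) (r : Z) (M : nat) : s < t ->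
  exists l, NoDup l /\ length l = M /\ forall d, In d l ->
    (0 <= d)%Z /\ (exists y, d = r + 2 * y)%Z /\ exists i, s < IZR d * th - IZR i < t.
Proof.
  intros Hst.
  assert (X : exists l D, NoDup l /\ length l = M /\ forall d, In d l ->
    (0 <= d < D)%Z /\ (exists y, d = r + 2 * y)%Z /\ exists i, s < IZR d * th - IZR i < t).
  { induction M as [|M (l & D & ND & L & H)].
    - exists nil, 0%Z. split; [constructor|]. split; auto. intros d [].
    - destruct (rotation_dense s t (Z.max 0 D) r Hst) as (d & i & Hd & Hy & Hi).
      exists (d :: l), (d + 1)%Z. split; [|split].
      + constructor; auto. intros I. specialize (H d I). lia.
      + cbn. lia.
      + intros x [<-|I].
        * split; [lia|]. split; auto. exists i. auto.
        * destruct (H x I) as [Bx R]. split; [lia|exact R]. }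
  destruct X as (l & D & ND & L & H). exists l. do 2 (split; auto).
  intros d I. destruct (H d I) as [B R]. split; [lia|exact R].
Qed.

Lemma window_unique (a b x : R) (i j : Z) : b - a <= 1 ->
  a < x - IZR i < b -> a < x - IZR j < b -> i = j.
Proof.
  intros L H1 H2.
  assert (i < j + 1)%Z by (apply lt_IZR; rewrite plus_IZR; lra).
  assert (j < i + 1)%Z by (apply lt_IZR; rewrite plus_IZR; lra). lia.
Qed.

(* In the window (u,v) there are asymptotically B/A > 1 times as many Q-points
   as P-points, so not every Q-point can coincide with a P-point.  The
   comparison of the two counts is made exact up to a bounded error by
   translating the P-window into the Q-window by an element of Z + 2 th Z. *)
Lemma unpaired (A B u v : R) : 0 < A < B -> u < v -> B * (v - u) <= 1 ->
  exists c0, forall c, (c0 <= c)%Z -> exists d i,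
    In d (offsets c) /\ B * u < IZR d * th - IZR i < B * v /\
    forall d' i', In d' (offsets c) ->
      (IZR d * th - IZR i) * A <> (IZR d' * th - IZR i') * B.
Proof.
  intros HAB Huv HB.
  (* g is half the excess of the Q-window over the P-window. The translation by h moves the P-window
     into the Q-window and leaves its last stretch of length g, beyond w, free. *)
  set (g := (B - A) * (v - u) / 2). assert (Hg : 0 < g) by (unfold g; nra).
  assert (Eg : B * v = B * u + A * (v - u) + 2 * g) by (unfold g; field).
  destruct (rotation_dense (B * u - A * u) (B * u - A * u + g) 0 0 ltac:(lra))
    as (h & k & Hh & [h2 Hh2] & Hk).
  set (w := B * v - g).
  (* Translation by h can lose only offsets with |d| >= c - h, at most 2(h + 1) of them. One Q-point
     more than that in the free stretch contradicts a complete pairing. *)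
  set (M := Z.to_nat (2 * h + 3)).
  (* The threshold precedes c, so extra points of both parities are prepared; those with d + c odd
     are used. *)
  destruct (rotation_many w (B * v) 0 M ltac:(unfold w; lra)) as (E0 & ND0 & L0 & H0).
  destruct (rotation_many w (B * v) 1 M ltac:(unfold w; lra)) as (E1 & ND1 & L1 & H1).
  assert (Bd : exists D, forall d, In d (E0 ++ E1) -> (d < D)%Z).
  { generalize (E0 ++ E1) as l. intros l. induction l as [|a l [D HD]].
    - exists 0%Z. intros d [].
    - exists (Z.max D (a + 1))%Z. intros d [<-|I]; [lia|]. specialize (HD d I). lia. }
  destruct Bd as [D HD].
  exists (Z.max D (h + 1)). intros c Hc. apply NNPP. intros None.
  assert (Paired : forall d i, In d (offsets c) -> B * u < IZR d * th - IZR i < B * v ->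
    exists d' i', In d' (offsets c) /\ (IZR d * th - IZR i) * A = (IZR d' * th - IZR i') * B).
  { intros d i Hd Hi. apply NNPP. intros N. apply None. exists d, i. do 2 (split; auto).
    intros d' i' Hd' E. apply N. exists d', i'. auto. }
  assert (XE : exists E, NoDup E /\ length E = M /\ forall d, In d E -> In d (offsets c) /\
     exists i, w < IZR d * th - IZR i < B * v).
  { destruct (Z.Even_or_Odd c) as [[y Hy]|[y Hy]].
    - exists E1. do 2 (split; auto). intros d Hd. destruct (H1 d Hd) as (P & [z Hz] & I).
      split; auto. specialize (HD d (in_or_app _ _ _ (or_intror Hd))).
      apply in_offsets. split; [lia|]. exists (y + z)%Z. lia.
    - exists E0. do 2 (split; auto). intros d Hd. destruct (H0 d Hd) as (P & [z Hz] & I).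
      split; auto. specialize (HD d (in_or_app _ _ _ (or_introl Hd))).
      apply in_offsets. split; [lia|]. exists (y + z)%Z. lia. }
  destruct XE as (E & NDE & LE & HE).
  set (PW := fun d => if excluded_middle_informative
      (exists i, A * u < IZR d * th - IZR i < A * v) then true else false).
  assert (PWs : forall d, PW d = true <-> exists i, A * u < IZR d * th - IZR i < A * v).
  { intros d. unfold PW. destruct (excluded_middle_informative _); intuition discriminate. }
  set (F := filter PW (offsets (c - h))).
  assert (HF : forall d, In d F -> In (d + h)%Z (offsets c) /\
     exists i, B * u < IZR (d + h) * th - IZR i < w).
  { intros d Hd. apply filter_In in Hd. destruct Hd as [Hd Pd].
    apply in_offsets in Hd. destruct Hd as [Bd' [y Hy]]. apply PWs in Pd. destruct Pd as [i Hi].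
    split; [apply in_offsets; split; [lia | exists (y + 2 * h2)%Z; lia]|].
    exists (i + k)%Z. rewrite !plus_IZR. unfold w. nra. }
  assert (Len : (length (map (fun d => d + h)%Z F ++ E) <= length (filter PW (offsets c)))%nat).
  { apply pigeonhole_rel with (R := fun d d' => exists i i',
      B * u < IZR d * th - IZR i < B * v /\ (IZR d * th - IZR i) * A = (IZR d' * th - IZR i') * B).
    - apply NoDup_app.
      + apply FinFun.Injective_map_NoDup; [intros x y; lia|]. apply NoDup_filter, NoDup_offsets.
      + exact NDE.
      + intros d I1 I2. apply in_map_iff in I1. destruct I1 as [d1 [<- I1]].
        destruct (HF d1 I1) as [_ [i Hi]]. destruct (HE _ I2) as [_ [j Hj]].
        (* The Q-window has length at most 1, so d determines its integer translate; hence the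
           translated points and the extra ones are disjoint. *)
        assert (i = j) by (apply (window_unique (B * u) (B * v) (IZR (d1 + h) * th)); unfold w in *; lra).
        subst j. lra.
    - intros d I.
      assert (Q : In d (offsets c) /\ exists i, B * u < IZR d * th - IZR i < B * v).
      { apply in_app_iff in I. destruct I as [I|I].
        - apply in_map_iff in I. destruct I as [d1 [<- I1]].
          destruct (HF d1 I1) as [Hd [i Hi]]. split; auto. exists i. unfold w in *. lra.
        - destruct (HE d I) as [Hd [i Hi]]. split; auto. exists i. unfold w in *. nra. }
      destruct Q as [Hd [i Hi]]. destruct (Paired d i Hd Hi) as (d' & i' & Hd' & Eq).
      exists d'. split; [|exists i, i'; auto]. apply filter_In. split; auto. apply PWs.
      exists i'. split; apply Rmult_lt_reg_r with B; try lra; rewrite <- Eq; nra.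
    - intros d1 d2 d' _ _ (i1 & j1 & W1 & Q1) (i2 & j2 & W2 & Q2).
      assert (j1 = j2).
      { apply (window_unique (A * u) (A * v) (IZR d' * th)); [nra| |];
          split; apply Rmult_lt_reg_r with B; try lra; rewrite <- ?Q1, <- ?Q2; nra. }
      subst j2. rewrite <- Q1 in Q2. apply Rmult_eq_reg_r in Q2; [|lra].
      destruct (Z.eq_dec d1 d2) as [|Ne]; auto. exfalso.
      apply (irrational_comb (d2 - d1) (i1 - i2)); [lia|]. rewrite !minus_IZR. lra. }
  assert (Up : (length (filter PW (offsets c)) <= length (F ++
     (map (fun i => c - i)%Z (Zrange (h + 1)) ++ map (fun i => i - c)%Z (Zrange (h + 1)))))%nat).
  { apply NoDup_incl_length; [apply NoDup_filter, NoDup_offsets|].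
    intros d I. apply filter_In in I. destruct I as [Hd Pd].
    apply in_offsets in Hd. destruct Hd as [Bd' [y Hy]].
    apply in_app_iff.
    destruct (Z_lt_le_dec (Z.abs d) (c - h)) as [S|S].
    - left. apply filter_In. split; auto. apply in_offsets. split; [lia|].
      exists (y - h2)%Z. lia.
    - right. apply in_app_iff. destruct (Z_le_gt_dec 0 d).
      + left. apply in_map_iff. exists (c - d)%Z. rewrite in_Zrange. lia.
      + right. apply in_map_iff. exists (d + c)%Z. rewrite in_Zrange. lia. }
  rewrite !length_app, !length_map, !length_Zrange in *. unfold M in LE. lia.
Qed.
End Rotation.

(** * Limits *)

Definition for_large (A : nat -> Prop) : Prop := exists K, forall k, (K <= k)%nat -> A k.

Lemma for_large_and (A B : nat -> Prop) :
  for_large A -> for_large B -> for_large (fun k => A k /\ B k).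
Proof.
  intros [K HK] [L HL]. exists (K + L)%nat. intros k Hk. split; [apply HK|apply HL]; lia.
Qed.

Lemma for_large_impl (A B : nat -> Prop) :
  (forall k, A k -> B k) -> for_large A -> for_large B.
Proof. intros H [K HK]. exists K. auto. Qed.

Lemma for_large_list {X : Type} (A : X -> nat -> Prop) (l : list X) :
  (forall x, In x l -> for_large (A x)) -> for_large (fun k => forall x, In x l -> A x k).
Proof.
  induction l as [|a l IH]; intros H.
  - exists 0%nat. intros k _ x [].
  - apply (for_large_impl (fun k => A a k /\ forall x, In x l -> A x k)).
    + intros k [Ha Hl] x [<-|I]; auto.
    + apply for_large_and; [apply H; cbn; auto | apply IH; intros; apply H; cbn; auto].
Qed.

(** Uniformity: finitely many positive constants, each valid from some index on, are replaced by
    their minimum. *)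
Lemma for_large_list_bound {X : Type} (A : X -> R -> nat -> Prop) (l : list X) :
  (forall x d d' k, 0 < d' <= d -> A x d k -> A x d' k) ->
  (forall x, In x l -> exists d, 0 < d /\ for_large (A x d)) ->
  exists d, 0 < d /\ for_large (fun k => forall x, In x l -> A x d k).
Proof.
  intros Mono. induction l as [|a l IH]; intros H.
  - exists 1. split; [lra|]. exists 0%nat. intros k _ x [].
  - destruct IH as (d & Hd & Ed); [intros; apply H; cbn; auto|].
    destruct (H a (or_introl eq_refl)) as (d' & Hd' & Ed').
    exists (Rmin d d'). split; [apply Rmin_glb_lt; auto|].
    pose proof (Rmin_l d d'). pose proof (Rmin_r d d').
    pose proof (Rmin_glb_lt d d' 0 Hd Hd').
    eapply for_large_impl; [|apply (for_large_and _ _ Ed Ed')].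
    intros k [Hl Ha] x [<-|I]; [apply Mono with d'|apply Mono with d]; auto; lra.
Qed.

Lemma cv_between (u : nat -> R) (l a b : R) : Un_cv u l -> a < l < b ->
  for_large (fun k => a < u k < b).
Proof.
  intros H L. destruct (H (Rmin (l - a) (b - l))) as [K HK]; [apply Rmin_glb_lt; lra|].
  exists K. intros k Hk. specialize (HK k Hk). unfold Rdist in HK.
  pose proof (Rmin_l (l - a) (b - l)). pose proof (Rmin_r (l - a) (b - l)).
  apply Rabs_def2 in HK. lra.
Qed.

Lemma cv_away (u : nat -> R) (l : R) : Un_cv u l -> l <> 0 ->
  exists d, 0 < d /\ for_large (fun k => d <= Rabs (u k)).
Proof.
  intros H L. pose proof (Rabs_pos_lt l L) as P. exists (Rabs l / 2). split; [lra|].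
  eapply for_large_impl; [|apply (cv_between u l (l - Rabs l / 2) (l + Rabs l / 2) H)]; [|lra].
  intros k. cbn. unfold Rabs. destruct (Rcase_abs l), (Rcase_abs (u k)); lra.
Qed.

Lemma cv_const (x : R) : Un_cv (fun _ => x) x.
Proof. intros e He. exists 0%nat. intros. unfold Rdist. rewrite Rminus_diag, Rabs_R0. exact He. Qed.

(** Compares two crossings through the edges containing them: X w and Y w lie in the cells x and m
    of width a, hence at most |x - m| + 1 cells apart. *)
Lemma cell_distance (a w x m X Y : Z) : (0 <= a)%Z ->
  (a * x <= X * w <= a * (x + 1))%Z -> (a * m <= Y * w <= a * (m + 1))%Z ->
  (Z.abs (Y - X) * Z.abs w <= a * (Z.abs (x - m) + 1))%Z.
Proof.
  intros Ha HX HY. rewrite <- Z.abs_mul, Z.mul_sub_distr_r.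
  destruct (Z.abs_spec (x - m)) as [[S ->]|[S ->]], (Z.abs_spec (Y * w - X * w)) as [[T ->]|[T ->]]; nia.
Qed.

Lemma cancel_scale (z w a c v : Z) : (0 < w)%Z -> (0 <= v)%Z -> (z * w <= a * v)%Z ->
  (a <= c * w)%Z -> (z <= c * v)%Z.
Proof.
  intros Hw Hv H1 H2. apply Z.mul_le_mono_pos_r with w; [exact Hw|].
  apply Z.le_trans with (a * v)%Z; [exact H1|].
  replace (c * v * w)%Z with (c * w * v)%Z by ring. apply Z.mul_le_mono_nonneg_r; auto.
Qed.

Section Limits.
Variables (p q al : nat -> Z) (th rho : R).
Hypothesis Hpar : forall k, param (p k) (q k).
Hypothesis Htune : forall k, tune (p k) (q k) (al k).
Let W k := (p k + q k)%Z.
Hypothesis th_irr : irrational th.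
Hypothesis th_lim : Un_cv (fun k => IZR (al k) / IZR (W k)) th.
Hypothesis rho_lim : Un_cv (fun k => IZR (p k) / IZR (W k)) rho.
Hypothesis rho_range : 0 < rho < / 2.

Lemma WR_pos (k : nat) : 0 < IZR (W k).
Proof. apply IZR_lt. destruct (Hpar k). unfold W. lia. Qed.

Lemma q_lim : Un_cv (fun k => IZR (q k) / IZR (W k)) (1 - rho).
Proof.
  assert (X : Un_cv (fun k => 1 - IZR (p k) / IZR (W k)) (1 - rho)).
  { apply CV_minus; [apply cv_const | exact rho_lim]. }
  intros e He. destruct (X e He) as [K HK]. exists K. intros k Hk. specialize (HK k Hk).
  replace (IZR (q k) / IZR (W k)) with (1 - IZR (p k) / IZR (W k)); [exact HK|].
  pose proof (WR_pos k). unfold W in *. rewrite plus_IZR in *. field. lra.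
Qed.

Lemma orbit_lim (d i : Z) :
  Un_cv (fun k => IZR (d * al k - i * W k) / IZR (W k)) (IZR d * th - IZR i).
Proof.
  assert (X : Un_cv (fun k => IZR d * (IZR (al k) / IZR (W k)) - IZR i) (IZR d * th - IZR i)).
  { apply CV_minus; [|apply cv_const]. apply CV_mult; [apply cv_const | exact th_lim]. }
  intros e He. destruct (X e He) as [K HK]. exists K. intros k Hk. specialize (HK k Hk).
  replace (IZR (d * al k - i * W k) / IZR (W k)) with (IZR d * (IZR (al k) / IZR (W k)) - IZR i);
    [exact HK|].
  pose proof (WR_pos k). rewrite minus_IZR, !mult_IZR. field. lra.
Qed.

Definition box (a b : Z) : list (Z * Z) :=
  list_prod (map (fun x => x - a)%Z (Zrange (2 * a + 1))) (map (fun x => x - b)%Z (Zrange (2 * b + 1))).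

Lemma in_box (a b x y : Z) : In (x, y) (box a b) <-> (Z.abs x <= a /\ Z.abs y <= b)%Z.
Proof.
  unfold box. rewrite in_prod_iff, !in_map_iff. split.
  - intros [[i [<- Hi]] [j [<- Hj]]]. apply in_Zrange in Hi, Hj. lia.
  - intros [Hx Hy]. split; [exists (x + a)%Z | exists (y + b)%Z]; rewrite in_Zrange; lia.
Qed.

(** Divided by W, each of the finitely many combinations tends to e th - j, which is nonzero by
    irrationality. *)
Lemma orbit_away (E : Z) : exists d, 0 < d /\ for_large (fun k => forall e j,
  (Z.abs e <= E)%Z -> (Z.abs j <= E)%Z -> (e <> 0 \/ j <> 0)%Z ->
  d * IZR (W k) <= Rabs (IZR (e * al k - j * W k))).
Proof.
  destruct (for_large_list_bound (fun (x : Z * Z) d k => (fst x <> 0 \/ snd x <> 0)%Z ->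
     d <= Rabs (IZR (fst x * al k - snd x * W k) / IZR (W k))) (box E E)) as (d & Hd & Ev).
  - intros x d d' k Hd H N. specialize (H N). lra.
  - intros [e j] I. cbn [fst snd].
    destruct (classic (e <> 0 \/ j <> 0)%Z) as [N|N].
    + destruct (cv_away _ _ (orbit_lim e j)) as (d & Hd & Ev).
      * destruct (Z.eq_dec e 0) as [->|E0].
        -- rewrite Rmult_0_l. assert (Hj : j <> 0%Z) by lia.
           apply not_0_IZR in Hj. lra.
        -- pose proof (irrational_comb th th_irr e (- j) E0) as X. rewrite opp_IZR in X. lra.
      * exists d. split; auto. eapply for_large_impl; [|exact Ev]. cbn. auto.
    + exists 1. split; [lra|]. exists 0%nat. intros k _ N'. contradiction.
  - exists d. split; auto. eapply for_large_impl; [|exact Ev]. cbn beta.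
    intros k H e j He Hj N. specialize (H (e, j) (proj2 (in_box E E e j) (conj He Hj)) N).
    cbn [fst snd] in H. pose proof (WR_pos k) as HW.
    unfold Rdiv in H. rewrite Rabs_mult, (Rabs_pos_eq (/ IZR (W k))) in H
      by (left; apply Rinv_0_lt_compat; lra).
    apply Rmult_le_reg_r with (/ IZR (W k)); [apply Rinv_0_lt_compat; lra|].
    rewrite Rmult_assoc, Rinv_r by lra. lra.
Qed.

(** Only finitely many fractions al/W have W <= M, and each keeps a positive distance from the
    irrational limit. *)
Lemma W_unbounded (M : Z) : for_large (fun k => (M < W k)%Z).
Proof.
  destruct (for_large_list_bound (fun (x : Z * Z) d (k : nat) => (snd x <> 0)%Z ->
      d <= Rabs (th - IZR (fst x) / IZR (snd x))) (box M M)) as (d & Hd & [K Ev]).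
  - intros x d d' k Hd H N. specialize (H N). lra.
  - intros [a w] _. cbn [fst snd]. destruct (Z.eq_dec w 0) as [->|N].
    + exists 1. split; [lra|]. exists 0%nat. intros k _ N. contradiction.
    + exists (Rabs (th - IZR a / IZR w)). split.
      * apply Rabs_pos_lt. intros E. apply (th_irr a w N). lra.
      * exists 0%nat. intros. lra.
  - specialize (Ev K (Nat.le_refl K)).
    destruct (th_lim d Hd) as [K' HK']. exists K'. intros k Hk. specialize (HK' k Hk).
    apply Z.lt_nge. intros B. destruct (Htune k) as (T1 & T2 & _). fold (W k) in T2.
    assert (I : In (al k, W k) (box M M)) by (apply in_box; lia).
    specialize (Ev _ I ltac:(cbn [snd]; lia)). cbn [fst snd] in Ev.
    unfold Rdist in HK'. rewrite Rabs_minus_sym in HK'. lra.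
Qed.

(** Combinatorial form of a large x-diameter, witnessed by two squares of one row; the good lower
    edge puts the centre of the first on a polygon. *)
Definition wide (d : R) (k : nat) (m n : Z) : Prop :=
  (0 <= m < W k)%Z /\ (0 <= n < W k)%Z /\ goodH (p k) (q k) m n = true /\
  exists m', conn (p k) (q k) (m, n) (m', n) /\ d * IZR (W k) <= Rabs (IZR (m' - m)).

Lemma wide_mono (d d' : R) (k : nat) (m n : Z) : d' <= d -> wide d k m n -> wide d' k m n.
Proof.
  intros L (Hm & Hn & G & m' & C & D). do 3 (split; auto). exists m'. split; auto.
  pose proof (WR_pos k). nra.
Qed.

(** [unpaired] gives a threshold for c that depends on the horizontal window only; a line above it
    is then found in the vertical window by density. The loss of 1 in the bound on m is the rounding
    of the crossing to its edge. *)
Lemma wide_in_window (u v y1 y2 : R) : 0 <= u < v -> v <= 1 -> v - u <= / 2 ->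
  0 <= y1 < y2 -> y2 <= 1 ->
  exists d, 0 < d /\ for_large (fun k => exists m n, wide d k m n /\
    u * IZR (W k) - 1 <= IZR m <= v * IZR (W k) /\ y1 * IZR (W k) <= IZR n <= y2 * IZR (W k)).
Proof.
  intros Hu Hv Huv Hy Hy2.
  (* In units of W, the crossings with light lines tend to (d th - i) / (2(1 - rho)) for Q-lines and
     to (d' th - i') / (2 rho) for P-lines. The bound 1/2 on the window serves B (v - u) <= 1. *)
  destruct (unpaired th th_irr (2 * rho) (2 * (1 - rho)) u v) as [c0 Hc0]; [lra|lra|nra|].
  destruct (rotation_dense th th_irr y1 y2 (Z.max c0 1) 0 ltac:(lra)) as (c & ic & Hc & _ & Wc).
  destruct (Hc0 c ltac:(lia)) as (d & i & Hd & Wd & Un). clear Hc0.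
  (* Relative intercepts that occur in the block lie between 0 and 2W, and |d'| <= c; this confines
     the multiples i' of W, leaving a finite list of limits to separate. *)
  set (I := (c + Z.abs i + 2)%Z).
  destruct (for_large_list_bound (fun (x : Z * Z) dl k => In (fst x) (offsets c) ->
     dl <= Rabs (IZR (d * al k - i * W k) / IZR (W k) * (IZR (p k) / IZR (W k)) -
      IZR (fst x * al k - snd x * W k) / IZR (W k) * (IZR (q k) / IZR (W k)))) (box I I))
    as (d1 & Hd1 & Ev1).
  { intros x e e' k He H N. specialize (H N). lra. }
  { intros [d' i'] _. cbn [fst snd]. destruct (classic (In d' (offsets c))) as [N|N].
    - destruct (cv_away (fun k => IZR (d * al k - i * W k) / IZR (W k) * (IZR (p k) / IZR (W k)) -
        IZR (d' * al k - i' * W k) / IZR (W k) * (IZR (q k) / IZR (W k)))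
        ((IZR d * th - IZR i) * rho - (IZR d' * th - IZR i') * (1 - rho))) as (e & He & Ev).
      + apply CV_minus; apply CV_mult; try apply orbit_lim; [exact rho_lim | exact q_lim].
      + intros E. apply (Un d' i' N). lra.
      + exists e. split; auto. eapply for_large_impl; [|exact Ev]. cbn. auto.
    - exists 1. split; [lra|]. exists 0%nat. intros k _ N'. contradiction. }
  destruct (orbit_away (2 * I)) as (d2 & Hd2 & Ev2).
  set (e := Rmin d1 d2). assert (He : 0 < e) by (apply Rmin_glb_lt; auto).
  assert (He1 : e <= d1) by apply Rmin_l. assert (He2 : e <= d2) by apply Rmin_r.
  (* The separation will give e W <= 2 (|m' - m| + 1) at the second crossing, and e W > 4 turns this
     into |m' - m| >= e W / 4. *)
  exists (e / 4). split; [lra|].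
  assert (EvY := cv_between _ _ _ _ (orbit_lim c ic) Wc).
  assert (EvX : for_large (fun k => 0 < IZR (d * al k - i * W k) / IZR (W k) - 2 * u * (IZR (q k) / IZR (W k))
       /\ IZR (d * al k - i * W k) / IZR (W k) - 2 * v * (IZR (q k) / IZR (W k)) < 0)).
  { apply for_large_and.
    - eapply for_large_impl; [|apply (cv_between (fun k => IZR (d * al k - i * W k) / IZR (W k) - 2 * u * (IZR (q k) / IZR (W k)))
        (IZR d * th - IZR i - 2 * u * (1 - rho)) 0 (IZR d * th - IZR i - 2 * u * (1 - rho) + 1))].
      + cbn. intros; lra.
      + apply CV_minus; [apply orbit_lim|]. apply CV_mult; [apply cv_const | apply q_lim].
      + lra.
    - eapply for_large_impl; [|apply (cv_between (fun k => IZR (d * al k - i * W k) / IZR (W k) - 2 * v * (IZR (q k) / IZR (W k)))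
        (IZR d * th - IZR i - 2 * v * (1 - rho)) (IZR d * th - IZR i - 2 * v * (1 - rho) - 1) 0)].
      + cbn. intros; lra.
      + apply CV_minus; [apply orbit_lim|]. apply CV_mult; [apply cv_const | apply q_lim].
      + lra. }
  eapply for_large_impl;
    [|exact (for_large_and _ _ (for_large_and _ _ Ev1 Ev2) (for_large_and _ _ (for_large_and _ _ EvX EvY)
        (for_large_and _ _ (W_unbounded (2 * c)) (W_unbounded (up (4 / e))))))].
  cbn beta. intros k [[A1 A2] [[[X1 X2] [Y1 Y2]] [W1 W2]]].
  pose proof (WR_pos k) as HW. assert (HWz : (0 < W k)%Z) by (apply lt_IZR; lra).
  destruct (Hpar k) as [[Hp Hpq] _].
  assert (EW : (W k = p k + q k)%Z) by reflexivity.
  set (w := W k) in *.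
  assert (W3 : 4 < e * IZR w).
  { apply IZR_lt in W2. pose proof (proj1 (archimed (4 / e))).
    replace 4 with (4 / e * e) by (field; lra). nra. }
  set (n := (c * al k - ic * w)%Z) in *.
  set (be := (d * al k - i * w)%Z) in *.
  assert (Scale : forall a b, a < b / IZR w -> a * IZR w < b).
  { intros a b H. apply Rmult_lt_compat_r with (r := IZR w) in H; [|lra].
    unfold Rdiv in H. rewrite Rmult_assoc, Rinv_l in H; lra. }
  assert (Scale' : forall a b, b / IZR w < a -> b < a * IZR w).
  { intros a b H. apply Rmult_lt_compat_r with (r := IZR w) in H; [|lra].
    unfold Rdiv in H. rewrite Rmult_assoc, Rinv_l in H; lra. }
  apply Scale in Y1. apply Scale' in Y2.
  assert (X1' : 2 * u * IZR (q k) < IZR be).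
  { replace (2 * u * (IZR (q k) / IZR w)) with (2 * u * IZR (q k) / IZR w) in X1 by (field; lra).
    assert (H : 0 < (IZR be - 2 * u * IZR (q k)) / IZR w) by (unfold Rdiv in *; lra).
    apply Scale in H. lra. }
  assert (X2' : IZR be < 2 * v * IZR (q k)).
  { replace (2 * v * (IZR (q k) / IZR w)) with (2 * v * IZR (q k) / IZR w) in X2 by (field; lra).
    assert (H : (IZR be - 2 * v * IZR (q k)) / IZR w < 0) by (unfold Rdiv in *; lra).
    apply Scale' in H. lra. }
  assert (Rq : 0 < IZR (q k)) by (apply IZR_lt; lia).
  assert (Rp : 0 < IZR (p k)) by (apply IZR_lt; lia).
  assert (Bbe : (0 < be < 2 * q k)%Z).
  { split; apply lt_IZR; [|rewrite mult_IZR]; nra. }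
  assert (Bn : (0 <= n < w)%Z).
  { split; [apply le_IZR|apply lt_IZR]; nra. }
  set (m := (be * w / (2 * q k))%Z).
  assert (Bm : (2 * q k * m <= be * w < 2 * q k * (m + 1))%Z).
  { pose proof (Z.div_mod (be * w) (2 * q k) ltac:(lia)). fold m in H.
    pose proof (Z.mod_pos_bound (be * w) (2 * q k) ltac:(lia)). lia. }
  assert (Rm : (0 <= m < w)%Z) by nia.
  (* A crossing at a grid point would force W to divide m, hence m = 0 and be = 0. *)
  assert (Nc : (2 * q k * m <> be * w)%Z).
  { intros E.
    assert (D : (w | m)%Z).
    { apply (divide_2p (p k) (q k) (Hpar k)). fold w. exists (2 * m - be)%Z.
      replace (2 * p k * m)%Z with (2 * w * m - 2 * q k * m)%Z by (rewrite EW; ring). lia. }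
    destruct D as [x Hx]. assert (x = 0)%Z by nia. nia. }
  assert (OnLine : (w | n - c * al k)%Z) by (exists (- ic)%Z; unfold n; lia).
  assert (Cap : (2 * Z.abs c < p k + q k)%Z) by (rewrite <- EW; lia).
  assert (Light : forall b, light w (mass (p k) (q k) b) (4 * p k * n) = true <->
     exists d', In d' (offsets c) /\ (w | b - n - d' * al k)%Z)
    by (intros b; apply (light_on_line _ _ _ (Hpar k) (Htune k) c n b OnLine Cap)).
  assert (Inside : forall d' be', In d' (offsets c) -> (w | be' - d' * al k)%Z -> (0 <= be' <= 2 * w)%Z ->
     exists i', (be' = d' * al k - i' * w)%Z /\ (Z.abs d' <= c)%Z /\ (Z.abs i' <= I)%Z).
  { intros d' be' Hd' [x Hx] Hb. exists (- x)%Z. apply in_offsets in Hd'.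
    split; [lia|]. split; [lia|]. destruct (Htune k) as (T1 & T2 & _). rewrite <- EW in T2.
    unfold I. assert (- c * w <= d' * al k <= c * w)%Z by nia.
    assert (- c - 1 < x)%Z by nia. assert (x < c + 3)%Z by nia. lia. }
  (* The abscissas be W / (2q) and (b - n) W / (2p) differ by W / (2pq) times the integer estimated
     here, which is why the bound is of order W^2. *)
  assert (FarP : forall b, light w (mass (p k) (q k) b) (4 * p k * n) = true ->
     (0 <= b - n <= w)%Z ->
     e * (IZR w * IZR w) <= Rabs (IZR (be * p k - (b - n) * q k))).
  { intros b L Hb. apply Light in L. destruct L as [d' [Hd' D]].
    destruct (Inside d' (b - n)%Z Hd' D ltac:(lia)) as (i' & Ei & Bd & Bi).
    specialize (A1 (d', i')). cbn [fst snd] in A1. rewrite <- Ei in A1.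
    specialize (A1 (proj2 (in_box I I d' i') ltac:(unfold I in *; lia)) Hd').
    replace (IZR be / IZR w * (IZR (p k) / IZR w) - IZR (b - n) / IZR w * (IZR (q k) / IZR w)) with
      (IZR (be * p k - (b - n) * q k) * / (IZR w * IZR w)) in A1.
    2:{ rewrite (minus_IZR (be * p k)), !mult_IZR. field. lra. }
    assert (Hww : 0 < IZR w * IZR w) by nra.
    rewrite Rabs_mult, (Rabs_pos_eq (/ _)) in A1 by (left; apply Rinv_0_lt_compat, Hww).
    apply Rmult_le_reg_r with (/ (IZR w * IZR w)); [apply Rinv_0_lt_compat, Hww|].
    rewrite Rmult_assoc, Rinv_r by lra. lra. }
  assert (FarQ : forall b, light w (mass (p k) (q k) b) (4 * p k * n) = true ->
     (0 <= b - n <= 2 * w)%Z -> (b - n <> be)%Z ->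
     e * IZR w <= Rabs (IZR (b - n - be))).
  { intros b L Hb Ne. apply Light in L. destruct L as [d' [Hd' D]].
    destruct (Inside d' (b - n)%Z Hd' D Hb) as (i' & Ei & Bd & Bi).
    apply in_offsets in Hd.
    specialize (A2 (d' - d)%Z (i' - i)%Z ltac:(unfold I; lia) ltac:(unfold I in *; lia)).
    replace ((d' - d) * al k - (i' - i) * w)%Z with (b - n - be)%Z in A2 by (unfold be; lia).
    eapply Rle_trans; [|apply A2]; [nra|].
    destruct (Z.eq_dec d' d) as [->|]; [|lia]. right. intros E. apply Ne. unfold be.
    replace i' with i in Ei by lia. exact Ei. }
  assert (NearP : forall b x, (0 <= x < w)%Z -> (2 * p k * x <= (b - n) * w <= 2 * p k * (x + 1))%Z ->
     (0 <= b - n <= w)%Z /\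
     Rabs (IZR (be * p k - (b - n) * q k)) <= 2 * IZR w * (Rabs (IZR (x - m)) + 1)).
  { intros b x Hx Hb. split; [nia|].
    assert (X : (Z.abs (be * p k - (b - n) * q k) * w <= 2 * p k * q k * (Z.abs (x - m) + 1))%Z).
    { rewrite <- (Z.abs_eq w) at 1 by lia. apply cell_distance; [apply Z.mul_nonneg_nonneg; lia| |].
      - replace (2 * p k * q k * x)%Z with (q k * (2 * p k * x))%Z by ring.
        replace (2 * p k * q k * (x + 1))%Z with (q k * (2 * p k * (x + 1)))%Z by ring.
        replace ((b - n) * q k * w)%Z with (q k * ((b - n) * w))%Z by ring.
        split; apply Z.mul_le_mono_nonneg_l; lia.
      - replace (2 * p k * q k * m)%Z with (p k * (2 * q k * m))%Z by ring.
        replace (2 * p k * q k * (m + 1))%Z with (p k * (2 * q k * (m + 1)))%Z by ring.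
        replace (be * p k * w)%Z with (p k * (be * w))%Z by ring.
        split; apply Z.mul_le_mono_nonneg_l; lia. }
    assert (Y : (Z.abs (be * p k - (b - n) * q k) <= 2 * w * (Z.abs (x - m) + 1))%Z).
    { eapply cancel_scale; [exact HWz| |exact X|]; [lia|].
      apply Z.le_trans with (2 * w * q k)%Z; [apply Z.mul_le_mono_nonneg_r | apply Z.mul_le_mono_nonneg_l]; lia. }
    rewrite <- !abs_IZR, <- plus_IZR, <- !mult_IZR. apply IZR_le. exact Y. }
  assert (NearQ : forall b x, (0 <= x < w)%Z -> (2 * q k * x <= (b - n) * w <= 2 * q k * (x + 1))%Z ->
     (0 <= b - n <= 2 * w)%Z /\
     Rabs (IZR (b - n - be)) <= 2 * (Rabs (IZR (x - m)) + 1)).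
  { intros b x Hx Hb. split; [nia|].
    assert (X : (Z.abs (be - (b - n)) * w <= 2 * q k * (Z.abs (x - m) + 1))%Z).
    { rewrite <- (Z.abs_eq w) at 1 by lia. apply cell_distance; lia. }
    assert (Y : (Z.abs (b - n - be) <= 2 * (Z.abs (x - m) + 1))%Z).
    { replace (Z.abs (b - n - be)) with (Z.abs (be - (b - n))) by lia.
      eapply cancel_scale; [exact HWz| |exact X|]; [lia|]. lia. }
    rewrite <- !abs_IZR, <- plus_IZR, <- mult_IZR. apply IZR_le. exact Y. }
  assert (Self : Rabs (IZR (m - m)) = 0) by (rewrite Z.sub_diag; apply Rabs_R0).
  assert (G : goodH (p k) (q k) m n = true).
  { apply (goodH_isolated (p k) (q k) (Hpar k) m n (n + be)).
    - apply Light. exists d. split; auto. exists (- i)%Z. unfold be. lia.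
    - replace (n + be - n)%Z with be by lia. change (p k + q k)%Z with w. lia.
    - intros b Hb. apply not_true_is_false. intros L.
      destruct (NearP b m Rm Hb) as [B1 B2]. specialize (FarP b L B1).
      rewrite Self in B2. nra.
    - intros b Ne Hb. apply not_true_is_false. intros L.
      destruct (NearQ b m Rm Hb) as [B1 B2]. specialize (FarQ b L B1 ltac:(lia)).
      rewrite Self in B2. nra. }
  exists m, n. split; [|split].
  - do 3 (split; auto).
    destruct (second_crossing (p k) (q k) (al k) (Hpar k) (Htune k) m n Rm Bn G)
      as (m' & Hm' & Ne & G' & C). change (p k + q k)%Z with w in Hm'.
    exists m'. split; auto. change (W k) with w.
    destruct (goodH_light (p k) (q k) (Hpar k) m' n G') as (b & L & [Wb|Wb]).
    + destruct (NearP b m' Hm' Wb) as [B1 B2]. specialize (FarP b L B1).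
      assert (e * IZR w <= 2 * (Rabs (IZR (m' - m)) + 1)) by nra. lra.
    + destruct (NearQ b m' Hm' Wb) as [B1 B2].
      (* The original crossing is interior to edge m, so it cannot account for light on another
         edge. *)
      assert (N : (b - n <> be)%Z).
      { intros E. rewrite E in Wb. change (p k + q k)%Z with w in Wb. apply Ne.
        assert (m' < m + 1)%Z by nia. assert (m < m' + 1)%Z by nia. lia. }
      specialize (FarQ b L B1 N). lra.
  - assert (K1 : IZR be * IZR w <= 2 * IZR (q k) * (IZR m + 1)).
    { rewrite <- (plus_IZR m 1), <- !mult_IZR. apply IZR_le. lia. }
    assert (K2 : 2 * IZR (q k) * IZR m <= IZR be * IZR w).
    { rewrite <- !mult_IZR. apply IZR_le. lia. }
    split; nra.
  - lra.
Qed.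

Lemma wide_dense (eta : R) : 0 < eta ->
  exists d, 0 < d /\ for_large (fun k => forall x y,
    0 <= x <= IZR (W k) -> 0 <= y <= IZR (W k) -> exists m n, wide d k m n /\
    Rabs (IZR m - x) <= eta * IZR (W k) /\ Rabs (IZR n - y) <= eta * IZR (W k)).
Proof.
  intros He.
  (* Cells of width W/M: 2 keeps the windows within 1/2, and M > 2/eta leaves room for the rounding
     error 1 once W > M. *)
  set (M := Z.max 2 (up (2 / eta))).
  assert (HM : (2 <= M)%Z) by (unfold M; lia).
  assert (HMR : 2 <= IZR M) by (apply IZR_le; exact HM).
  assert (HMe : 2 < eta * IZR M).
  { assert (IZR (up (2 / eta)) <= IZR M) by (apply IZR_le; unfold M; lia).
    pose proof (proj1 (archimed (2 / eta))).
    replace 2 with (eta * (2 / eta)) by (field; lra).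
    apply Rmult_lt_compat_l; lra. }
  destruct (for_large_list_bound (fun (x : Z * Z) d k => exists m n, wide d k m n /\
    IZR (fst x) / IZR M * IZR (W k) - 1 <= IZR m <= (IZR (fst x) + 1) / IZR M * IZR (W k) /\
    IZR (snd x) / IZR M * IZR (W k) <= IZR n <= (IZR (snd x) + 1) / IZR M * IZR (W k))
    (list_prod (Zrange M) (Zrange M))) as (d & Hd & Ev).
  - intros x d d' k Hd (m & n & H & H'). exists m, n. split; auto. apply wide_mono with d; auto. lra.
  - intros [i j] I. apply in_prod_iff in I. rewrite !in_Zrange in I. destruct I as [Hi Hj]. cbn [fst snd].
    assert (S : forall t, (0 <= t < M)%Z -> 0 <= IZR t / IZR M < (IZR t + 1) / IZR M /\ (IZR t + 1) / IZR M <= 1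
        /\ (IZR t + 1) / IZR M - IZR t / IZR M = / IZR M).
    { intros t Ht. assert (0 <= IZR t) by (apply IZR_le; lia).
      assert (IZR t + 1 <= IZR M) by (rewrite <- (plus_IZR t 1); apply IZR_le; lia).
      assert (P : 0 < / IZR M) by (apply Rinv_0_lt_compat; lra).
      assert (IZR M * / IZR M = 1) by (apply Rinv_r; lra).
      unfold Rdiv. repeat split; nra. }
    destruct (S i Hi) as (A1 & A2 & A3), (S j Hj) as (B1 & B2 & B3).
    apply wide_in_window; auto. rewrite A3. apply Rinv_le_contravar; lra.
  - exists d. split; auto.
    eapply for_large_impl; [|exact (for_large_and _ _ Ev (W_unbounded M))].
    cbn beta. intros k [H HW] x y Hx Hy. pose proof (WR_pos k) as HWR.
    apply IZR_lt in HW.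
    assert (Cell : forall z, 0 <= z <= IZR (W k) -> exists t, (0 <= t < M)%Z /\
       IZR t / IZR M * IZR (W k) <= z <= (IZR t + 1) / IZR M * IZR (W k)).
    { intros z Hz. set (r := z * IZR M / IZR (W k)).
      assert (Er : z = r / IZR M * IZR (W k)) by (unfold r; field; lra).
      assert (Hr : 0 <= r <= IZR M).
      { unfold r. split.
        - apply Rmult_le_pos; [nra | left; apply Rinv_0_lt_compat; lra].
        - apply Rmult_le_reg_r with (IZR (W k)); [lra|]. unfold Rdiv.
          rewrite Rmult_assoc, Rinv_l; nra. }
      assert (Hc : exists t, (0 <= t < M)%Z /\ IZR t <= r <= IZR t + 1).
      { destruct (archimed r) as [U1 U2].
        destruct (Z_lt_le_dec (up r - 1) M) as [L|L].
        - exists (up r - 1)%Z. split; [|rewrite minus_IZR; lra].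
          split; [|lia]. assert (0 < up r)%Z by (apply lt_IZR; lra). lia.
        - exists (M - 1)%Z. split; [lia|]. apply IZR_le in L. rewrite minus_IZR in *. lra. }
      destruct Hc as (t & Ht & B). exists t. split; auto.
      assert (P : 0 < / IZR M) by (apply Rinv_0_lt_compat; lra).
      rewrite Er. unfold Rdiv. split; apply Rmult_le_compat_r; try lra; apply Rmult_le_compat_r; lra. }
    destruct (Cell x Hx) as (i & Hi & Bi), (Cell y Hy) as (j & Hj & Bj).
    destruct (H (i, j)) as (m & n & Hw & Hm & Hn).
    { apply in_prod_iff. rewrite !in_Zrange. auto. }
    cbn [fst snd] in *. exists m, n. split; auto.
    assert (E : forall t, (IZR t + 1) / IZR M * IZR (W k) = IZR t / IZR M * IZR (W k) + IZR (W k) / IZR M)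
      by (intros; field; lra).
    rewrite E in *.
    assert (S1 : IZR (W k) / IZR M + 1 <= eta * IZR (W k)).
    { apply Rmult_le_reg_r with (IZR M); [lra|].
      replace ((IZR (W k) / IZR M + 1) * IZR M) with (IZR (W k) + IZR M) by (field; lra). nra. }
    split; apply Rabs_le; lra.
Qed.

(** K is taken so large that the lines |c| <= K enter each of M equal strips, which makes every gap
    between neighbours narrow. K is fixed by the limit, so distinct dividing lines also stay at
    least g W apart. *)
Lemma small_rooms (eta : R) : 0 < eta ->
  exists g, 0 < g /\ for_large (fun k => exists x1 x2 y1 y2,
    (0 <= x1 /\ x2 <= W k /\ 0 <= y1 /\ y2 <= W k)%Z /\
    empty_boundary (p k) (q k) x1 x2 y1 y2 /\
    g * IZR (W k) <= IZR (x2 - x1) <= eta * IZR (W k) /\ g * IZR (W k) <= IZR (y2 - y1)).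
Proof.
  intros He.
  set (M := Z.max 2 (up (2 / eta))).
  assert (HM : (2 <= M)%Z) by (unfold M; lia).
  assert (HMR : 2 <= IZR M) by (apply IZR_le; exact HM).
  assert (HMe : 2 < eta * IZR M).
  { assert (IZR (up (2 / eta)) <= IZR M) by (apply IZR_le; unfold M; lia).
    pose proof (proj1 (archimed (2 / eta))).
    replace 2 with (eta * (2 / eta)) by (field; lra).
    apply Rmult_lt_compat_l; lra. }
  assert (XK : exists K : nat, forall t, In t (Zrange M) -> exists c i, (Z.abs c <= Z.of_nat K)%Z /\
     IZR t / IZR M < IZR c * th - IZR i < (IZR t + 1) / IZR M).
  { generalize (Zrange M) as l. intros l. induction l as [|t l [K HK]].
    - exists 0%nat. intros t [].
    - assert (P : 0 < / IZR M) by (apply Rinv_0_lt_compat; lra).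
      destruct (rotation_dense th th_irr (IZR t / IZR M) ((IZR t + 1) / IZR M) 0 0)
        as (c & i & _ & _ & H); [unfold Rdiv; nra|].
      exists (K + Z.to_nat (Z.abs c))%nat. intros t' [<-|I].
      + exists c, i. split; [lia|exact H].
      + destruct (HK t' I) as (c' & i' & B & H'). exists c', i'. split; [lia|exact H']. }
  destruct XK as [K HK].
  assert (EvC : for_large (fun k => forall t, In t (Zrange M) -> exists c z, (Z.abs c <= Z.of_nat K)%Z /\
     (W k | z - c * al k)%Z /\ IZR t / IZR M * IZR (W k) < IZR z < (IZR t + 1) / IZR M * IZR (W k))).
  { apply for_large_list. intros t I. destruct (HK t I) as (c & i & Bc & H).
    eapply for_large_impl; [|exact (cv_between _ _ _ _ (orbit_lim c i) H)].
    cbn beta. intros k [H1 H2]. exists c, (c * al k - i * W k)%Z. split; auto.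
    split; [exists (- i)%Z; lia|]. pose proof (WR_pos k).
    apply Rmult_lt_compat_r with (r := IZR (W k)) in H1, H2; try lra.
    unfold Rdiv in H1 at 2. rewrite Rmult_assoc, Rinv_l in H1 by lra.
    unfold Rdiv in H2 at 1. rewrite Rmult_assoc, Rinv_l in H2 by lra. lra. }
  (* Differences of two dividing lines: the coefficient of al is at most 2K, and al < W/2 then keeps
     that of W within 2K + 2. *)
  destruct (orbit_away (2 * Z.of_nat K + 2)) as (g & Hg & EvG).
  exists g. split; auto.
  eapply for_large_impl;
    [|exact (for_large_and _ _ (for_large_and _ _ EvC EvG) (W_unbounded (2 * Z.of_nat K)))].
  cbn beta. intros k [[HC HG] HW]. pose proof (WR_pos k) as HWR.
  destruct (empty_room (p k) (q k) (al k) (Hpar k) (Htune k) K HW)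
    as (x1 & x2 & y1 & y2 & HB & Hx & Hy & GapX & _ & EH & EV).
  change (p k + q k)%Z with (W k) in *.
  assert (Sep : forall a b, (0 <= a < b)%Z -> (b <= W k)%Z ->
     (exists c, (Z.abs c <= Z.of_nat K)%Z /\ (W k | a - c * al k)%Z) ->
     (exists c, (Z.abs c <= Z.of_nat K)%Z /\ (W k | b - c * al k)%Z) ->
     g * IZR (W k) <= IZR (b - a)).
  { intros a b Hab Hb (c & Hc & [i Hi]) (c' & Hc' & [i' Hi']).
    destruct (Htune k) as (T1 & T2 & _). change (p k + q k)%Z with (W k) in T2.
    assert (E : (b - a = (c' - c) * al k - (i - i') * W k)%Z) by lia.
    assert (- (2 * Z.of_nat K) * W k <= (c' - c) * al k <= 2 * Z.of_nat K * W k)%Z by nia.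
    assert (- (2 * Z.of_nat K + 2) <= i - i')%Z by nia.
    assert (i - i' <= 2 * Z.of_nat K + 2)%Z by nia.
    specialize (HG (c' - c) (i - i') ltac:(lia) ltac:(lia))%Z.
    rewrite <- E in HG. rewrite Rabs_pos_eq in HG by (apply IZR_le; lia).
    apply HG. destruct (Z.eq_dec (c' - c) 0); [right; nia | left; auto]. }
  destruct (HB x1) as [B1 C1]; [cbn; auto|].
  destruct (HB x2) as [B2 C2]; [cbn; auto|].
  destruct (HB y1) as [B3 C3]; [cbn; auto|].
  destruct (HB y2) as [B4 C4]; [cbn; auto|].
  exists x1, x2, y1, y2. split; [lia|]. split; [split; auto|].
  split; [split; [apply Sep; auto; lia|] | apply Sep; auto; lia].
  apply Rnot_lt_le. intros Big.
  (* A room wider than eta W > 2W/M would contain the whole strip that starts at the next multiple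
     of W/M after x1, and so a dividing line. *)
  set (r := IZR x1 * IZR M / IZR (W k)).
  assert (Er : IZR x1 = r / IZR M * IZR (W k)) by (unfold r; field; lra).
  assert (Hr : 0 <= r).
  { unfold r. assert (0 <= IZR x1) by (apply IZR_le; lia).
    apply Rmult_le_pos; [nra | left; apply Rinv_0_lt_compat; lra]. }
  destruct (archimed r) as [U1 U2].
  assert (P : 0 < / IZR M) by (apply Rinv_0_lt_compat; lra).
  assert (PM : / IZR M * IZR M = 1) by (apply Rinv_l; lra).
  assert (Lt : (IZR (up r) + 1) / IZR M * IZR (W k) < IZR x2).
  { rewrite minus_IZR, Er in Big.
    apply Rle_lt_trans with (r / IZR M * IZR (W k) + 2 / IZR M * IZR (W k)).
    - rewrite <- Rmult_plus_distr_r. apply Rmult_le_compat_r; [lra|]. unfold Rdiv. nra.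
    - assert (2 / IZR M < eta) by (unfold Rdiv; nra). nra. }
  assert (Hup : (0 <= up r < M)%Z).
  { split; [apply le_IZR; lra|]. apply lt_IZR.
    assert (X2 : IZR x2 <= IZR (W k)) by (apply IZR_le; lia).
    assert ((IZR (up r) + 1) / IZR M < 1) by nra.
    unfold Rdiv in H. nra. }
  destruct (HC (up r)) as (c & z & Hc & D & Z1 & Z2); [apply in_Zrange; auto|].
  apply (GapX c z Hc D). split; apply lt_IZR; [|lra].
  apply Rle_lt_trans with (IZR (up r) / IZR M * IZR (W k)); auto.
  rewrite Er. unfold Rdiv. apply Rmult_le_compat_r; [lra|]. apply Rmult_le_compat_r; lra.
Qed.

(** Density at scale g/4, applied to the centre of an empty room of sides at least g W, puts a long
    polygon inside the room, which it cannot leave. Only its upper width bound eta is prescribed; d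
    is whatever density yields. *)
Lemma wide_confined (eta : R) : 0 < eta ->
  exists d, 0 < d /\ for_large (fun k => exists m n, wide d k m n /\ exists x1 x2,
    IZR (x2 - x1) <= eta * IZR (W k) /\
    forall t, conn (p k) (q k) (m, n) t -> (x1 <= fst t < x2)%Z).
Proof.
  intros He. destruct (small_rooms eta He) as (g & Hg & EvR).
  destruct (wide_dense (g / 4) ltac:(lra)) as (d & Hd & EvD).
  exists d. split; auto.
  eapply for_large_impl; [|exact (for_large_and _ _ EvR EvD)].
  cbn beta. intros k [(x1 & x2 & y1 & y2 & B & Emp & [G1 G2] & G3) D].
  pose proof (WR_pos k) as HW.
  assert (R1 : 0 <= IZR x1 /\ IZR x2 <= IZR (W k) /\ 0 <= IZR y1 /\ IZR y2 <= IZR (W k))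
    by (repeat split; apply IZR_le; lia).
  rewrite minus_IZR in G1, G3.
  assert (0 < g * IZR (W k)) by nra.
  destruct (D ((IZR x1 + IZR x2) / 2) ((IZR y1 + IZR y2) / 2)) as (m & n & Hw & Hm & Hn); [lra|lra|].
  pose proof (Rle_abs (IZR m - (IZR x1 + IZR x2) / 2)). pose proof (Rle_abs (IZR n - (IZR y1 + IZR y2) / 2)).
  pose proof (Rle_abs (- (IZR m - (IZR x1 + IZR x2) / 2))) as Hm'. pose proof (Rle_abs (- (IZR n - (IZR y1 + IZR y2) / 2))) as Hn'.
  rewrite Rabs_Ropp in Hm', Hn'.
  exists m, n. split; auto. exists x1, x2. split; auto.
  intros t C. apply (conn_in_rect (p k) (q k) x1 x2 y1 y2 (m, n) t Emp C).
  unfold in_rect. cbn [fst snd].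
  split; split; first [apply le_IZR | apply lt_IZR]; lra.
Qed.
End Limits.

(** * Topology *)

Section Topology.
Import ssreflect ssrfun ssrbool order ssralg ssrnum interval boolp.
Import num_normedtype normed_module.

Lemma open_preimage_gt (f : pt2 -> R) (a : R) : continuous f ->
  open ([set z | a < f z]%classic : set pt2).
Proof.
move=> cf.
have -> : [set z | a < f z]%classic = (f @^-1` [set x | (a < x)%R])%classic.
  by apply/funext => z; apply/propext; split => /RltP.
apply: open_comp; last exact: open_gt.
by move=> z _; exact: cf.
Qed.

Lemma open_preimage_lt (f : pt2 -> R) (a : R) : continuous f ->
  open ([set z | f z < a]%classic : set pt2).
Proof.
move=> cf.
have -> : [set z | f z < a]%classic = (f @^-1` [set x | (x < a)%R])%classic.
  by apply/funext => z; apply/propext; split => /RltP.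
apply: open_comp; last exact: open_lt.
by move=> z _; exact: cf.
Qed.

Lemma segment_connected_pt2 (a b : pt2) : connected (in_closed_segment a b : set pt2).
Proof.
set f : R -> pt2 := fun t => (fst a + t * (fst b - fst a), snd a + t * (snd b - snd a)).
have -> : (in_closed_segment a b : set pt2) = (f @` [set t | 0 <= t <= 1])%classic.
  apply/funext => -[x y]; apply/propext; split.
    by move=> [t [ht [/= -> ->]]]; exists t.
  by move=> [t ht [<- <-]]; exists t.
apply: connected_continuous_connected.
  apply/connected_intervalP => x y /= [x0 x1] [y0 y1] z /andP[/RleP xz /RleP zy]; lra.
apply: continuous_subspaceT => t.
have c1 : continuity_pt (fun t => fst a + t * (fst b - fst a)) t by reg.
have c2 : continuity_pt (fun t => snd a + t * (snd b - snd a)) t by reg.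
exact: (cvg_pair (proj1 (continuity_pt_cvg _ t) c1) (proj1 (continuity_pt_cvg _ t) c2)).
Qed.

Lemma fst_continuous : continuous (fst : pt2 -> R).
Proof. by move=> z; exact: cvg_fst. Qed.
Lemma snd_continuous : continuous (snd : pt2 -> R).
Proof. by move=> z; exact: cvg_snd. Qed.

Lemma open_box (a b c d : R) :
  open ([set z | a < fst z < b /\ c < snd z < d]%classic : set pt2).
Proof.
have -> : [set z : pt2 | a < fst z < b /\ c < snd z < d]%classic =
  ([set z | a < fst z] `&` [set z | fst z < b] `&` ([set z | c < snd z] `&` [set z | snd z < d]))%classic.
  by apply/funext => z; apply/propext; split => [[[? ?] [? ?]]|[[? ?] [? ?]]].
by apply: openI; apply: openI; (apply: open_preimage_gt || apply: open_preimage_lt);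
   (exact: fst_continuous || exact: snd_continuous).
Qed.

(** The trace of U on A is relatively open, and relatively closed as the trace of the complement of
    V. Disjointness of U and V is asked only on A, since the enlarged squares do overlap
    elsewhere. *)
Lemma connected_in_open_half (A U V : set pt2) (z : pt2) : open U -> open V ->
  connected A -> (A `<=` U `|` V)%classic -> (forall w, A w -> U w -> V w -> False) ->
  A z -> U z -> (A `<=` U)%classic.
Proof.
move=> oU oV cA AUV dis Az Uz.
have E : (A `&` U)%classic = A.
  apply: cA; first by exists z.
    by exists U.
  exists (~` V)%classic; first exact: open_closedC.
  apply/seteqP; split => w [Aw Xw]; split => //.
    by move=> Vw; exact: (dis w).
  by case: (AUV w Aw).
by rewrite -E => w [].
Qed.

Lemma component_contains (A B : set pt2) (y z : pt2) : connected B -> (B `<=` A)%classic ->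
  B y -> B z -> connected_component A y z.
Proof. by move=> cB BA By Bz; exists B. Qed.

Lemma open_boxes (A : Z * Z -> Prop) : open ([set z | exists t, A t /\
  (IZR (fst t) - /4 < fst z < IZR (fst t) + 5 / 4 /\
   IZR (snd t) - /4 < snd z < IZR (snd t) + 5 / 4)]%classic : set pt2).
Proof.
have -> : [set z : pt2 | exists t, A t /\ (IZR (fst t) - /4 < fst z < IZR (fst t) + 5 / 4 /\
   IZR (snd t) - /4 < snd z < IZR (snd t) + 5 / 4)]%classic =
  (\bigcup_(t in [set t | A t]) [set z : pt2 | IZR (fst t) - /4 < fst z < IZR (fst t) + 5 / 4 /\
   IZR (snd t) - /4 < snd z < IZR (snd t) + 5 / 4])%classic.
  by apply/funext => z; apply/propext; split => [[t [At zt]]|[t At zt]]; exists t.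
by apply: bigcup_open => t _; exact: open_box.
Qed.
End Topology.

(** * Polygons *)

Section Polygons.
Variables p q : nat.
Hypothesis Hpar : even_param p q.
Let zp := Z.of_nat p.
Let zq := Z.of_nat q.

Definition arms (p q : nat) (t : Z * Z) (z : pt2) : Prop :=
  exists s, In s (edges (fst t) (snd t)) /\ good p q s /\
    in_closed_segment (center (fst t) (snd t)) (midpoint s) z.

Definition centerp (t : Z * Z) : pt2 := center (fst t) (snd t).

Lemma plaid_union_arms (z : pt2) : plaid_union p q z <-> exists t, arms p q t z.
Proof.
  split.
  - intros (m & n & s & H). exists (m, n), s. exact H.
  - intros [[m n] [s H]]. exists m, n, s. exact H.
Qed.

Lemma arms_in_square (t : Z * Z) (z : pt2) : arms p q t z ->
  IZR (fst t) <= fst z <= IZR (fst t) + 1 /\ IZR (snd t) <= snd z <= IZR (snd t) + 1.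
Proof.
  destruct t as [m n], z as [x y]. intros (s & I & _ & u & Hu & Ex & Ey).
  cbn [edges fst snd center] in *.
  destruct I as [<-|[<-|[<-|[<-|[]]]]]; cbn [midpoint fst snd] in *; rewrite ?plus_IZR in *; nra.
Qed.

Lemma segment_start (a b : pt2) : in_closed_segment a b a.
Proof. exists 0. split; [lra|]. split; ring. Qed.

Lemma segment_end (a b : pt2) : in_closed_segment a b b.
Proof. exists 1. split; [lra|]. split; ring. Qed.

Lemma half_edge_component (t : Z * Z) (s : useg) :
  In s (edges (fst t) (snd t)) -> good p q s ->
  connected_component (plaid_union p q) (centerp t) (midpoint s).
Proof.
  intros I G. apply component_contains with (B := in_closed_segment (centerp t) (midpoint s)).
  - apply segment_connected_pt2.
  - intros z Hz. exists (fst t), (snd t), s. auto.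
  - apply segment_start.
  - apply segment_end.
Qed.

Lemma shared_edge_component (s t : Z * Z) (e : useg) :
  In e (edges (fst s) (snd s)) -> In e (edges (fst t) (snd t)) -> good p q e ->
  connected_component (plaid_union p q) (centerp s) (centerp t).
Proof.
  intros Is It G. apply connected_component_trans with (midpoint e).
  - apply half_edge_component; auto.
  - apply connected_component_sym, half_edge_component; auto.
Qed.

Lemma conn_component (s t : Z * Z) : plaid_union p q (centerp s) -> conn zp zq s t ->
  connected_component (plaid_union p q) (centerp s) (centerp t).
Proof.
  intros Hs C. apply clos_rt_rtn1 in C. induction C as [|y z A _ IH].
  - apply connected_component_refl. exact Hs.
  - apply connected_component_trans with (centerp y); [exact IH|]. clear IH.
    destruct y as [m n], z as [m' n'].
    destruct A as [(E1 & E2 & G)|[(E1 & E2 & G)|[(E1 & E2 & G)|(E1 & E2 & G)]]];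
      cbn [fst snd] in *; subst;
      first [apply good_V in G | apply good_H in G]; auto;
      eapply shared_edge_component; [| |exact G| | |exact G| | |exact G| | |exact G]; cbn; auto.
Qed.

(** The open square enlarged by 1/4, less than the distance 1/2 from a centre to the sides. *)
Definition near (t : Z * Z) (z : pt2) : Prop :=
  IZR (fst t) - /4 < fst z < IZR (fst t) + 5 / 4 /\
  IZR (snd t) - /4 < snd z < IZR (snd t) + 5 / 4.

Lemma arms_near (t : Z * Z) (z : pt2) : arms p q t z -> near t z.
Proof. intros A. apply arms_in_square in A. unfold near. lra. Qed.

(** An arm keeps distance at least 1/2 from every side of its square except the one it ends on. An
    enlarged square reaching it is therefore t itself or the neighbour across that good edge. *)
Lemma near_conn (s t : Z * Z) (z : pt2) : arms p q t z -> near s z -> conn zp zq s t.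
Proof.
  destruct s as [m n], t as [m' n'], z as [x y].
  intros (e & I & G & u & Hu & Ex & Ey) [Nx Ny].
  cbn [edges fst snd center] in *.
  assert (Close : forall a b, - (5 / 4) < IZR a - IZR b < 5 / 4 -> (-1 <= a - b <= 1)%Z).
  { intros a b H. rewrite <- minus_IZR in H.
    assert (-2 < a - b)%Z by (apply lt_IZR; lra). assert (a - b < 2)%Z by (apply lt_IZR; lra). lia. }
  assert (Same : forall a b, - (3 / 4) - / 8 < IZR a - IZR b < 3 / 4 + / 8 -> a = b).
  { intros a b H. rewrite <- minus_IZR in H.
    assert (-1 < a - b)%Z by (apply lt_IZR; lra). assert (a - b < 1)%Z by (apply lt_IZR; lra). lia. }
  destruct I as [<-|[<-|[<-|[<-|[]]]]]; cbn [midpoint fst snd] in *; rewrite ?plus_IZR in *.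
  - assert (m = m') by (apply Same; nra). subst m'.
    assert (-1 <= n' - n <= 1)%Z by (apply Close; nra).
    assert (n' <> n - 1)%Z by (intros ->; rewrite minus_IZR in *; nra).
    assert (n' = n \/ n' = n + 1)%Z as [->| ->] by lia; [apply rt_refl|].
    apply rt_step. right; right; left. cbn. apply good_H in G; auto.
  - assert (m = m') by (apply Same; nra). subst m'.
    assert (-1 <= n' - n <= 1)%Z by (apply Close; nra).
    assert (n' <> n + 1)%Z by (intros ->; rewrite plus_IZR in *; nra).
    assert (n' = n \/ n = n' + 1)%Z as [->| ->] by lia; [apply rt_refl|].
    apply rt_step. right; right; right. cbn. apply good_H in G; auto.
  - assert (n = n') by (apply Same; nra). subst n'.
    assert (-1 <= m' - m <= 1)%Z by (apply Close; nra).
    assert (m' <> m - 1)%Z by (intros ->; rewrite minus_IZR in *; nra).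
    assert (m' = m \/ m' = m + 1)%Z as [->| ->] by lia; [apply rt_refl|].
    apply rt_step. left. cbn. apply good_V in G; auto.
  - assert (n = n') by (apply Same; nra). subst n'.
    assert (-1 <= m' - m <= 1)%Z by (apply Close; nra).
    assert (m' <> m + 1)%Z by (intros ->; rewrite plus_IZR in *; nra).
    assert (m' = m \/ m = m' + 1)%Z as [->| ->] by lia; [apply rt_refl|].
    apply rt_step. right; left. cbn. apply good_V in G; auto.
Qed.

(* The open neighbourhoods [near t] of the squares of one combinatorial component
   and those of the others together cover the plaid union and separate it. *)
Lemma component_conn (s : Z * Z) (z : pt2) : plaid_union p q (centerp s) ->
  connected_component (plaid_union p q) (centerp s) z ->
  exists t, conn zp zq s t /\ arms p q t z.
Proof.
  intros Hs Hz.
  pose proof (connected_component_sub Hz) as Pz.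
  apply plaid_union_arms in Pz. destruct Pz as [t0 At0].
  exists t0. split; auto.
  destruct (connected_in_open_half (connected_component (plaid_union p q) (centerp s))
     (fun z => exists t, conn zp zq s t /\ near t z)
     (fun z => exists t, ~ conn zp zq s t /\ near t z) (centerp s)) with (t := z)
     as [t [Ct Nt]]; auto.
  - apply (open_boxes (fun t => conn zp zq s t)).
  - apply (open_boxes (fun t => ~ conn zp zq s t)).
  - apply component_connected.
  - intros w Hw. pose proof (connected_component_sub Hw) as Pw.
    apply plaid_union_arms in Pw. destruct Pw as [t At].
    destruct (classic (conn zp zq s t)) as [C|C]; [left|right]; exists t; split; auto using arms_near.
  - intros w Hw [t [Ct Nt]] [t' [Ct' Nt']].
    pose proof (connected_component_sub Hw) as Pw.
    apply plaid_union_arms in Pw. destruct Pw as [r Ar]. apply Ct'.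
    eapply rt_trans; [exact Ct|]. eapply rt_trans; [exact (near_conn _ _ _ Ar Nt)|].
    apply conn_sym. exact (near_conn _ _ _ Ar Nt').
  - apply connected_component_refl. exact Hs.
  - exists s. split; [apply rt_refl|]. unfold near, centerp, center. cbn [fst snd]. lra.
  - eapply rt_trans; [exact Ct|]. exact (near_conn _ _ _ At0 Nt).
Qed.

Lemma center_in_plaid (m n : Z) : goodH zp zq m n = true -> plaid_union p q (centerp (m, n)).
Proof.
  intros G. exists m, n, (Hseg m n). split; [cbn; auto|]. split; [apply good_H; auto|].
  apply segment_start.
Qed.

Lemma center_arms (s t : Z * Z) : arms p q t (centerp s) -> t = s.
Proof.
  intros A. apply arms_in_square in A. destruct s as [m n], t as [m' n'].
  unfold centerp, center in A. cbn [fst snd] in A. destruct A as [[A1 A2] [A3 A4]].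
  f_equal.
  - assert (m' < m + 1)%Z by (apply lt_IZR; rewrite plus_IZR; lra).
    assert (m < m' + 1)%Z by (apply lt_IZR; rewrite plus_IZR; lra). lia.
  - assert (n' < n + 1)%Z by (apply lt_IZR; rewrite plus_IZR; lra).
    assert (n < n' + 1)%Z by (apply lt_IZR; rewrite plus_IZR; lra). lia.
Qed.

Definition block_shift (a b : Z) (t : Z * Z) : Z * Z :=
  ((fst t + a * (zp + zq) * (zp + zq))%Z, (snd t + b * (zp + zq))%Z).

Lemma conn_block_shift (a b : Z) (s t : Z * Z) :
  conn zp zq (block_shift a b s) t <-> exists t', conn zp zq s t' /\ t = block_shift a b t'.
Proof.
  pose proof (even_param_Z _ _ Hpar) as P. split.
  - intros C. exists (fst t + (- a) * (zp + zq) * (zp + zq), snd t + (- b) * (zp + zq))%Z.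
    split.
    + apply (conn_block zp zq (- a) (- b)) in C; auto. unfold block_shift in C. cbn [fst snd] in C.
      eapply eq_rect with (P := fun x => conn zp zq x _); [exact C|].
      destruct s. cbn [fst snd]. f_equal; ring.
    + unfold block_shift. destruct t. cbn [fst snd]. f_equal; ring.
  - intros (t' & C & ->). apply conn_block; auto.
Qed.
End Polygons.

(** * Polygons of a block along the sequence *)

Section Main.
Variables p q : nat -> nat.
Hypothesis Hpar : forall k, even_param (p k) (q k).
Let zp k := Z.of_nat (p k).
Let zq k := Z.of_nat (q k).

Lemma is_tune_alpha_Z (k alpha : nat) :
  is_tune_alpha (p k) (q k) alpha -> tune (zp k) (zq k) (Z.of_nat alpha).
Proof.
  intros (A1 & A2 & A3). destruct (Hpar k) as (B1 & B2 & _).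
  unfold zp, zq. split; [lia|]. split; [lia|].
  destruct A3 as [E|E].
  - exists 1%Z. split; auto. rewrite (Nat.mod_small 1) in E by lia.
    exists (Z.of_nat ((2 * alpha * p k) / (p k + q k))).
    pose proof (Nat.div_mod_eq (2 * alpha * p k) (p k + q k)). nia.
  - exists (-1)%Z. split; auto.
    exists (Z.of_nat ((2 * alpha * p k + 1) / (p k + q k))).
    pose proof (Nat.div_mod_eq (2 * alpha * p k + 1) (p k + q k)). nia.
Qed.

(** p/W is the image of p/q under x / (1 + x). Irrationality excludes the endpoints 0 and 1 for L,
    which makes both bounds on rho strict. *)
Lemma p_over_omega (L : R) : irrational L -> Un_cv (fun k => INR (p k) / INR (q k)) L ->
  exists rho, 0 < rho < / 2 /\ Un_cv (fun k => IZR (zp k) / IZR (zp k + zq k)) rho.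
Proof.
  intros HL cv.
  assert (B : forall k, 0 < INR (p k) < INR (q k)).
  { intros k. destruct (Hpar k) as (B1 & B2 & _). split; [apply lt_0_INR|apply lt_INR]; lia. }
  assert (L0 : 0 < L).
  { destruct (Rtotal_order L 0) as [N|[N|N]]; auto; exfalso.
    - destruct (cv_between _ _ (L - 1) 0 cv) as [K HK]; [lra|].
      specialize (HK K (Nat.le_refl K)). cbn beta in HK. specialize (B K).
      assert (0 < INR (p K) / INR (q K)) by (apply Rdiv_lt_0_compat; lra). lra.
    - apply (HL 0%Z 1%Z ltac:(lia)). lra. }
  assert (L1 : L < 1).
  { destruct (Rtotal_order L 1) as [N|[N|N]]; auto; exfalso.
    - apply (HL 1%Z 1%Z ltac:(lia)). lra.
    - destruct (cv_between _ _ 1 (L + 1) cv) as [K HK]; [lra|].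
      specialize (HK K (Nat.le_refl K)). cbn beta in HK. specialize (B K).
      assert (INR (p K) / INR (q K) < 1).
      { apply Rmult_lt_reg_r with (INR (q K)); [lra|]. unfold Rdiv. rewrite Rmult_assoc, Rinv_l; lra. }
      lra. }
  exists (L / (1 + L)). split.
  - split; [apply Rdiv_lt_0_compat; lra|].
    apply Rmult_lt_reg_r with (1 + L); [lra|]. unfold Rdiv. rewrite Rmult_assoc, Rinv_l; lra.
  - assert (C : continuity_pt (fun x => x / (1 + x)) L) by (reg; lra).
    pose proof (continuity_seq _ _ _ C cv) as S. cbn beta in S.
    intros e He. destruct (S e He) as [K HK]. exists K. intros k Hk. specialize (HK k Hk).
    replace (IZR (zp k) / IZR (zp k + zq k)) with
      (INR (p k) / INR (q k) / (1 + INR (p k) / INR (q k))); [exact HK|].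
    rewrite plus_IZR. unfold zp, zq. rewrite <- !INR_IZR_INZ. specialize (B k). field. lra.
Qed.

Variables (al : nat -> nat) (th rho : R).
Hypothesis Htune : forall k, is_tune_alpha (p k) (q k) (al k).
Hypothesis th_irr : irrational th.
Hypothesis th_lim : Un_cv (fun k => INR (al k) / omega (p k) (q k)) th.
Hypothesis rho_lim : Un_cv (fun k => IZR (zp k) / IZR (zp k + zq k)) rho.
Hypothesis rho_range : 0 < rho < / 2.

Let zal k := Z.of_nat (al k).
Let W k := (zp k + zq k)%Z.
Let Hpar' : forall k, param (zp k) (zq k) := fun k => even_param_Z _ _ (Hpar k).
Let Htune' : forall k, tune (zp k) (zq k) (zal k) := fun k => is_tune_alpha_Z k _ (Htune k).

Lemma th_lim_Z : Un_cv (fun k => IZR (zal k) / IZR (zp k + zq k)) th.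
Proof.
  intros e He. destruct (th_lim e He) as [K HK]. exists K. intros k Hk. specialize (HK k Hk).
  rewrite omega_IZR, INR_IZR_INZ in HK. exact HK.
Qed.

(* Each confined polygon is narrower than all those found before it. *)
Lemma many_wide (N : nat) : exists d, 0 < d /\ for_large (fun k => exists f : nat -> Z * Z,
  (forall i, (i < N)%nat -> wide zp zq d k (fst (f i)) (snd (f i))) /\
  (forall i j, (i < j < N)%nat -> ~ conn (zp k) (zq k) (f j) (f i))).
Proof.
  induction N as [|N (d & Hd & Ev)].
  - exists 1. split; [lra|]. exists 0%nat. intros k _. exists (fun _ => (0, 0)%Z).
    split; intros; lia.
  (* Each earlier polygon contains two squares d W apart in one row, so none of them fits into a
     strip of width d W / 2. *)
  - destruct (wide_confined zp zq zal th rho Hpar' Htune' th_irr th_lim_Z rho_lim rho_range (d / 2))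
      as (d' & Hd' & Ev'); [lra|].
    exists (Rmin d d'). split; [apply Rmin_glb_lt; auto|].
    eapply for_large_impl; [|exact (for_large_and _ _ Ev Ev')].
    cbn beta. intros k [(f & F1 & F2) (m & n & Hw & x1 & x2 & Hx & Conf)].
    exists (fun i => if (i <? N)%nat then f i else (m, n)). split.
    + intros i Hi. destruct (Nat.ltb_spec i N).
      * apply wide_mono with (d := d); auto. apply Rmin_l.
      * apply wide_mono with (d := d'); auto. apply Rmin_r.
    + intros i j Hij. destruct (Nat.ltb_spec j N), (Nat.ltb_spec i N); try lia.
      * apply F2. lia.
      * intros C. destruct (F1 i H0) as (_ & _ & _ & m' & C' & D).
        pose proof (Conf _ C) as B1.
        assert (C2 : conn (zp k) (zq k) (m, n) (m', snd (f i))).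
        { eapply rt_trans; [exact C|]. rewrite (surjective_pairing (f i)). exact C'. }
        apply Conf in C2. cbn [fst] in C2.
        assert (Hb : Rabs (IZR (m' - fst (f i))) <= IZR (x2 - x1)).
        { rewrite <- abs_IZR. apply IZR_le. lia. }
        pose proof (WR_pos zp zq Hpar' k). nra.
Qed.

(** The walls of the block at the origin carry no good segment, so the component stays inside;
    periodicity transports it to any other block. *)
Lemma wide_in_block (a b : Z) (d : R) (k : nat) (m n : Z) : wide zp zq d k m n ->
  let c := centerp (block_shift (p k) (q k) a b (m, n)) in
  plaid_union (p k) (q k) c /\
  (forall z, connected_component (plaid_union (p k) (q k)) c z -> in_block (p k) (q k) a b z) /\
  xdiam_ge (connected_component (plaid_union (p k) (q k)) c) (d * omega (p k) (q k)).
Proof.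
  intros (Hm & Hn & G & m' & C & D). cbn zeta.
  assert (Pc : plaid_union (p k) (q k) (centerp (block_shift (p k) (q k) a b (m, n)))).
  { apply center_in_plaid; auto. cbn [fst snd]. fold (zp k) (zq k).
    rewrite goodH_block; auto. }
  split; auto. split.
  - intros z Hz. apply component_conn in Hz; auto. destruct Hz as (t & Ct & At).
    apply conn_block_shift in Ct; auto. destruct Ct as (t' & Ct & ->).
    apply (conn_in_rect _ _ 0 (W k) 0 (W k)) in Ct;
      [|exact (block_empty_boundary _ _ _ (Hpar' k) (Htune' k)) | split; auto].
    apply arms_in_square in At. destruct Ct as [[T1 T2] [T3 T4]].
    unfold block_shift in At. cbn [fst snd] in At. fold (zp k) (zq k) in At.
    unfold in_block. rewrite omega_IZR. fold (zp k) (zq k).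
    change (zp k + zq k)%Z with (W k) in *.
    apply IZR_le in T1, T3.
    assert (T2' : IZR (fst t') + 1 <= IZR (W k)) by (rewrite <- (plus_IZR _ 1); apply IZR_le; lia).
    assert (T4' : IZR (snd t') + 1 <= IZR (W k)) by (rewrite <- (plus_IZR _ 1); apply IZR_le; lia).
    rewrite !plus_IZR, !mult_IZR in At. cbn [pow]. lra.
  - intros e He. exists (centerp (block_shift (p k) (q k) a b (m, n))), (centerp (block_shift (p k) (q k) a b (m', n))).
    split; [apply connected_component_refl; auto|]. split.
    + apply conn_component; auto. apply conn_block_shift; auto. exists (m', n). auto.
    + unfold centerp, center, block_shift. cbn [fst snd]. rewrite !plus_IZR.
      rewrite omega_IZR. fold (zp k) (zq k). change (zp k + zq k)%Z with (W k).
      match goal with |- Rabs ?x > _ => replace x with (- IZR (m' - m)) by (rewrite minus_IZR; ring) end.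
      rewrite Rabs_Ropp. unfold W in *. lra.
Qed.

(** A centre lies on the arms of its own square only, so equality of topological components can be
    read off at the centres. *)
Lemma distinct_components (a b : Z) (k : nat) (s t : Z * Z) :
  plaid_union (p k) (q k) (centerp (block_shift (p k) (q k) a b s)) ->
  plaid_union (p k) (q k) (centerp (block_shift (p k) (q k) a b t)) ->
  connected_component (plaid_union (p k) (q k)) (centerp (block_shift (p k) (q k) a b s)) =
  connected_component (plaid_union (p k) (q k)) (centerp (block_shift (p k) (q k) a b t)) ->
  conn (zp k) (zq k) s t.
Proof.
  intros Ps Pt E.
  assert (H : connected_component (plaid_union (p k) (q k)) (centerp (block_shift (p k) (q k) a b s))
                (centerp (block_shift (p k) (q k) a b t))).
  { rewrite E. apply connected_component_refl. exact Pt. }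
  apply component_conn in H; auto. destruct H as (r & C & A).
  apply center_arms in A. subst r. apply conn_block_shift in C; auto.
  destruct C as (t' & C & E'). replace t with t'; auto.
  unfold block_shift in E'. injection E' as E1 E2. destruct t, t'. cbn [fst snd] in *. f_equal; lia.
Qed.
End Main.

Lemma dist_le_sum (u v : pt2) : Defs.dist u v <= Rabs (fst u - fst v) + Rabs (snd u - snd v).
Proof.
  unfold Defs.dist. pose proof (Rabs_pos (fst u - fst v)). pose proof (Rabs_pos (snd u - snd v)).
  rewrite <- (sqrt_pow2 (Rabs (fst u - fst v) + Rabs (snd u - snd v))) by lra.
  apply sqrt_le_1_alt.
  rewrite <- (pow2_abs (fst u - fst v)), <- (pow2_abs (snd u - snd v)). nra.
Qed.

Theorem theorem4p2 :
  forall (p q : nat -> nat),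
    (forall k, even_param (p k) (q k)) ->
    irrationally_tuned p q ->
    (exists L, irrational L /\ Un_cv (fun k => INR (p k) / INR (q k)) L) ->
    forall (a b : nat -> Z) (N : nat), (0 < N)%nat ->
    exists delta, 0 < delta /\
    exists K : nat, forall k : nat, (K <= k)%nat ->
      (exists zs : nat -> pt2,
         (forall i, (i < N)%nat ->
            plaid_union (p k) (q k) (zs i) /\
            (forall z, connected_component (plaid_union (p k) (q k)) (zs i) z ->
                       in_block (p k) (q k) (a k) (b k) z) /\
            xdiam_ge (connected_component (plaid_union (p k) (q k)) (zs i))
                     (delta * omega (p k) (q k))) /\
         (forall i j, (i < N)%nat -> (j < N)%nat -> i <> j ->
            connected_component (plaid_union (p k) (q k)) (zs i) <>
            connected_component (plaid_union (p k) (q k)) (zs j))) /\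
      (forall z, in_block (p k) (q k) (a k) (b k) z ->
         exists C, plaid_polygon (p k) (q k) C /\
           xdiam_ge C (delta * omega (p k) (q k)) /\
           dist_le z C (omega (p k) (q k) / INR N)).
Proof.
  intros p q Hpar (al & Htune & th & th_irr & th_lim) (L & HL & cvL) a b N HN.
  destruct (p_over_omega p q Hpar L HL cvL) as (rho & Hrho & rho_lim).
  set (zp := fun k => Z.of_nat (p k)) in *. set (zq := fun k => Z.of_nat (q k)) in *.
  set (zal := fun k => Z.of_nat (al k)).
  assert (Hpar' : forall k, param (zp k) (zq k)) by (intros; apply even_param_Z; auto).
  assert (Htune' : forall k, tune (zp k) (zq k) (zal k)) by (intros; apply is_tune_alpha_Z; auto).
  assert (RN : 1 <= INR N) by (apply (le_INR 1); lia).
  destruct (many_wide p q Hpar al th rho Htune th_irr th_lim rho_lim Hrho N) as (d1 & Hd1 & Ev1).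
  (* Each coordinate is off by at most W/(4N), plus 1/2 from corner to centre. The sum W/(2N) + 1 is
     within W/N once W exceeds 2N. *)
  destruct (wide_dense zp zq zal th rho Hpar' Htune' th_irr (th_lim_Z p q al th th_lim) rho_lim Hrho
     (/ (4 * INR N))) as (d2 & Hd2 & Ev2); [apply Rinv_0_lt_compat; lra|].
  pose proof (W_unbounded zp zq zal th Htune' th_irr (th_lim_Z p q al th th_lim) (2 * Z.of_nat N)) as Ev3.
  exists (Rmin d1 d2). split; [apply Rmin_glb_lt; auto|].
  destruct (for_large_and _ _ Ev1 (for_large_and _ _ Ev2 Ev3)) as [K HK].
  exists K. intros k Hk. destruct (HK k Hk) as [(f & F1 & F2) [D HW]]. clear HK. split.
  - set (zs := fun i => centerp (block_shift (p k) (q k) (a k) (b k) (f i))).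
    assert (Z1 : forall i, (i < N)%nat -> plaid_union (p k) (q k) (zs i) /\
       (forall z, connected_component (plaid_union (p k) (q k)) (zs i) z -> in_block (p k) (q k) (a k) (b k) z) /\
       xdiam_ge (connected_component (plaid_union (p k) (q k)) (zs i)) (Rmin d1 d2 * omega (p k) (q k))).
    { intros i Hi. unfold zs. rewrite (surjective_pairing (f i)).
      apply (wide_in_block p q Hpar al Htune).
      apply wide_mono with (d := d1); auto. apply Rmin_l. }
    exists zs. split; auto.
    assert (Lt : forall i j, (i < j < N)%nat -> connected_component (plaid_union (p k) (q k)) (zs j) <>
            connected_component (plaid_union (p k) (q k)) (zs i)).
    { intros i j Hij E. apply (F2 i j Hij). apply (distinct_components p q Hpar (a k) (b k)).
      - apply Z1. lia.
      - apply Z1. lia.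
      - exact E. }
    intros i j Hi Hj Ne E. destruct (Nat.lt_total i j) as [X|[X|X]]; [|contradiction|].
    + apply (Lt i j); auto.
    + apply (Lt j i); auto.
  - intros [x y] [[X1 X2] [Y1 Y2]]. cbn [fst snd] in *.
    pose proof (omega_IZR (p k) (q k)) as EO.
    change (Z.of_nat (p k) + Z.of_nat (q k))%Z with (zp k + zq k)%Z in EO.
    rewrite EO in *. set (w := IZR (zp k + zq k)) in *.
    destruct (D (x - IZR (a k) * w ^ 2) (y - IZR (b k) * w)) as (m & n & Hw & Hm & Hn); [lra|lra|].
    destruct (wide_in_block p q Hpar al Htune (a k) (b k) (Rmin d1 d2) k m n) as (P1 & _ & P3).
    { apply wide_mono with (d := d2); auto. apply Rmin_r. }
    set (c := centerp (block_shift (p k) (q k) (a k) (b k) (m, n))) in *.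
    exists (connected_component (plaid_union (p k) (q k)) c). split; [|split].
    + exists c. auto.
    + rewrite EO in P3. exact P3.
    + intros e He. exists c. split; [apply connected_component_refl; auto|].
      eapply Rle_lt_trans; [apply dist_le_sum|].
      unfold c, centerp, center, block_shift. cbn [fst snd].
      change (Z.of_nat (p k) + Z.of_nat (q k))%Z with (zp k + zq k)%Z.
      rewrite !plus_IZR, !mult_IZR. fold w.
      change (IZR (zp k + zq k)) with w in Hm, Hn.
      assert (T : 2 * (/ (4 * INR N) * w) + 1 <= w / INR N).
      { apply IZR_lt in HW. rewrite mult_IZR, <- INR_IZR_INZ in HW. change (IZR (zp k + zq k)) with w in HW.
        apply Rmult_le_reg_r with (2 * INR N); [lra|].
        replace ((2 * (/ (4 * INR N) * w) + 1) * (2 * INR N)) with (w + 2 * INR N) by (field; lra).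
        replace (w / INR N * (2 * INR N)) with (2 * w) by (field; lra). lra. }
      assert (A1 : Rabs (x - (IZR m + IZR (a k) * w * w + / 2)) <= / (4 * INR N) * w + / 2).
      { replace (x - (IZR m + IZR (a k) * w * w + / 2)) with
          (- (IZR m - (x - IZR (a k) * w ^ 2)) + - / 2) by ring.
        eapply Rle_trans; [apply Rabs_triang|]. rewrite !Rabs_Ropp, (Rabs_pos_eq (/ 2)) by lra. lra. }
      assert (A2 : Rabs (y - (IZR n + IZR (b k) * w + / 2)) <= / (4 * INR N) * w + / 2).
      { replace (y - (IZR n + IZR (b k) * w + / 2)) with
          (- (IZR n - (y - IZR (b k) * w)) + - / 2) by ring.
        eapply Rle_trans; [apply Rabs_triang|]. rewrite !Rabs_Ropp, (Rabs_pos_eq (/ 2)) by lra. lra. }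
      lra.
Qed.
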